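(* Let $h>0$. (i) If two operators $A$ and $B$ belong to $C_h$, then $A\circ B$ belongs to $C_h$, and for every $V\in\mathbb{R}^{2n}$, $$d_h(A\circ B)(V)\le(2\pi h)^{-n}\int_{\mathbb{R}^{2n}}(d_hA)(V-U)\,(d_hB)(U)\,dU .$$ (ii) Let $F$ and $G$ be in $D_h(\mathbb{R}^{2n})$, and set $A_h={\rm Op}_h^{\rm Wick}(F)$, $B_h={\rm Op}_h^{\rm Wick}(G)$. Then there exists a function in $D_h(\mathbb{R}^{2n})$, denoted $F\sharp_h^{\rm Wick}G$, such that $$\sigma_h^{\rm Wick}(A_h\circ B_h)=F\sharp_h^{\rm Wick}G .$$ In addition, for all $X\in\mathbb{R}^{2n}$, $$(F\sharp_h^{\rm Wick}G)(X)=(2\pi h)^{-n}\int_{\mathbb{R}^{2n}}F^{\rm ext}(X+T,X)\,G^{\rm ext}(X,X+T)\,e^{-\frac1{2h}|T|^2}\,dT .$$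
   Context: The scalar product $\langle\cdot,\cdot\rangle$ of $L^2(\mathbb{R}^n)$ is linear in the first variable. For $X=(x,\xi)\in\mathbb{R}^{2n}$ the coherent state is $\Psi_{Xh}(u)=(\pi h)^{-n/4}e^{-\frac{|u-x|^2}{2h}}e^{\frac ihu\cdot\xi-\frac i{2h}x\cdot\xi}$, and $\Pi_{Xh}f=\langle f,\Psi_{Xh}\rangle\Psi_{Xh}$. The Wick symbol of a bounded operator $A$ is $\sigma_h^{\rm Wick}(A)(X)=\langle A\Psi_{Xh},\Psi_{Xh}\rangle$, and its confinement function is $d_hA(V)=\sup_{X-Y=V}|\langle A\Psi_{Xh},\Psi_{Yh}\rangle|$. $C_h$ is the space of bounded operators $A$ in $L^2(\mathbb{R}^n)$ with $d_hA\in L^1(\mathbb{R}^{2n})$. $D_h(\mathbb{R}^{2n})$ is the set of functions $F:\mathbb{R}^{2n}\to\mathbb{C}$ for which there is a real-analytic function $F^{\rm ext}(X,Y)$ on $\mathbb{R}^{2n}\times\mathbb{R}^{2n}$ (the sesqui-holomorphic extension; unique) such that, with $X=(x,\xi)$, $Y=(y,\eta)$: (1) $(\partial_{x_j}+i\partial_{\xi_j})F^{\rm ext}=0$ and $(\partial_{y_j}-i\partial_{\eta_j})F^{\rm ext}=0$ for $1\le j\le n$; (2) $F^{\rm ext}(X,X)=F(X)$; (3) there is $\psi_F\in L^1(\mathbb{R}^{2n})\cap L^\infty(\mathbb{R}^{2n})$ with $|F^{\rm ext}(X,Y)|\le e^{\frac1{4h}|X-Y|^2}\psi_F(X-Y)$.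 For $F\in D_h(\mathbb{R}^{2n})$, ${\rm Op}_h^{\rm Wick}(F)$ is the bounded operator $(2\pi h)^{-2n}\int_{\mathbb{R}^{4n}}F^{\rm ext}(Y,X)\,\Pi_{Xh}\Pi_{Yh}\,dX\,dY$ (weak integral). *)

(* Defs.v *)
From HB Require Import structures.
From mathcomp Require Import all_boot all_order all_algebra finmap.
From mathcomp Require Import complex.
From mathcomp Require Import all_classical all_reals all_analysis.

Set Implicit Arguments.
Unset Strict Implicit.
Unset Printing Implicit Defensive.

Import Order.TTheory GRing.Theory Num.Theory.
Import numFieldNormedType.Exports.
Import ComplexField.Normc.

Local Open Scope classical_set_scope.
Local Open Scope ring_scope.
Local Open Scope complex_scope.

Definition rvec_display : measure_display.
Proof. exact: default_measure_display. Qed.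

Section rvec_measurable.
Context {R : realType} {n : nat}.

Let coor (i : 'I_n) (u : 'rV[R]_n) : measurableTypeR R := u ord0 i.

Let rvec_set0 : g_sigma_preimage coor set0.
Proof. exact: sigma_algebra0. Qed.

Let rvec_setC A : g_sigma_preimage coor A -> g_sigma_preimage coor (~` A).
Proof. exact: sigma_algebraC. Qed.

Let rvec_bigcup (F : _^nat) : (forall i, g_sigma_preimage coor (F i)) ->
  g_sigma_preimage coor (\bigcup_i (F i)).
Proof. exact: sigma_algebra_bigcup. Qed.

(* The product (= Borel) sigma-algebra, generated by the coordinates. *)
HB.instance Definition _ := @isMeasurable.Build rvec_display
  'rV[R]_n (g_sigma_preimage coor) rvec_set0 rvec_setC rvec_bigcup.

Lemma measurable_coord (i : 'I_n) :
  measurable_fun [set: 'rV[R]_n] (fun u => u ord0 i : measurableTypeR R).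
Proof.
move=> _ Y mY; rewrite setTI; apply: sub_sigma_algebra => /=.
rewrite -bigcup_seq/=; exists i => /=; first by rewrite mem_index_enum.
by exists Y => //; rewrite setTI.
Qed.

Lemma measurable_rvec d (T : measurableType d) (f : T -> 'rV[R]_n) :
  (forall i, measurable_fun setT (fun t => f t ord0 i : measurableTypeR R)) ->
  measurable_fun setT f.
Proof.
move=> mf _ Y mY; rewrite setTI; move: Y mY.
suff H : g_sigma_preimage coor `<=` [set Y | measurable (f @^-1` Y)] by [].
apply: smallest_sub.
  split => /=.
  - by rewrite preimage_set0; exact: measurable0.
  - move=> A mA; rewrite /= setTD preimage_setC; exact: measurableC.
  - by move=> F mF; rewrite /= preimage_bigcup; exact: bigcup_measurable.
move=> A; rewrite -bigcup_seq => -[i /= _ [B mB <-]].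
by rewrite setTI; have := mf i measurableT B mB; rewrite setTI.
Qed.

End rvec_measurable.

(* [\x] with its sigma-finite structure: for [m1 \x m2] itself the library's
   canonical instance only fires when both factors are subprobabilities. *)
Section prod_measure.
Context d1 d2 (T1 : measurableType d1) (T2 : measurableType d2) (R : realType).
Variable m1 : {sigma_finite_measure set T1 -> \bar R}.
Variable m2 : {sigma_finite_measure set T2 -> \bar R}.

Definition prod_measure : set (T1 * T2) -> \bar R := (m1 \x m2)%E.

HB.instance Definition _ := Measure.on prod_measure.

Let prod_measure_sigma_finite : sigma_finite setT prod_measure.
Proof.
have /sigma_finiteP[F [TF ndF Foo]] := sigma_finiteT m1.
have /sigma_finiteP[G [TG ndG Goo]] := sigma_finiteT m2.
exists (fun n => F n `*` G n).
  rewrite -setXTT TF TG predeqE => -[x y]; split.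
    move=> [/= [n _ Fnx] [k _ Gky]]; exists (maxn n k) => //; split.
    - by move: x Fnx; exact/subsetPset/ndF/leq_maxl.
    - by move: y Gky; exact/subsetPset/ndG/leq_maxr.
  by move=> [n _ []/= ? ?]; split; exists n.
move=> k; have [? ?] := Foo k; have [? ?] := Goo k.
split; first exact: measurableX.
by rewrite /prod_measure product_measure1E// lte_mul_pinfty// ge0_fin_numE.
Qed.

HB.instance Definition _ := Measure_isSigmaFinite.Build _ _ _ prod_measure
  prod_measure_sigma_finite.

End prod_measure.

Section lebesgue_measure_rvec.
Context {R : realType}.

Definition vcons n (p : measurableTypeR R * 'rV[R]_n) : 'rV[R]_n.+1 :=
  row_mx (const_mx p.1 : 'rV[R]_1) p.2.

Definition vuncons n (u : 'rV[R]_n.+1) : measurableTypeR R * 'rV[R]_n :=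
  (u ord0 ord0, rsubmx (u : 'rV[R]_(1 + n))).

Lemma vunconsK n : cancel (@vuncons n) (@vcons n).
Proof.
move=> u; rewrite /vcons /vuncons /=.
transitivity (row_mx (lsubmx (u : 'rV[R]_(1 + n))) (rsubmx (u : 'rV[R]_(1 + n)))).
  by f_equal; apply/rowP => i; rewrite !mxE ord1; congr (u _ _); apply: ord_inj => /=; case: i => [[]].
exact: (@hsubmxK R 1 1 n u).
Qed.

Lemma vconsK n : cancel (@vcons n) (@vuncons n).
Proof.
move=> [x u]; rewrite /vcons /vuncons /= row_mxKr; congr pair.
rewrite mxE; case: splitP => [j _|j]; first by rewrite mxE.
by [].
Qed.

Lemma measurable_vcons n : measurable_fun setT (@vcons n).
Proof.
apply: measurable_rvec => i.
rewrite (_ : (fun t => _) = fun t : measurableTypeR R * 'rV[R]_n =>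
    match @fintype.split 1 n i with inl _ => t.1 | inr j => t.2 ord0 j end); last first.
  by apply/funext => -[x u]; rewrite !mxE; case: fintype.split => // j; rewrite mxE.
case: fintype.split => [_|j]; first exact: measurable_fst.
apply: (@measurableT_comp _ _ _ _ _ _ (fun u : 'rV[R]_n => u ord0 j)).
  exact: measurable_coord.
exact: measurable_snd.
Qed.

Lemma measurable_vuncons n : measurable_fun setT (@vuncons n).
Proof.
apply/measurable_fun_pairP; split; first exact: measurable_coord.
apply: measurable_rvec => i.
rewrite (_ : (fun t => _) = fun u : 'rV[R]_n.+1 =>
  u ord0 (rshift 1 i) : measurableTypeR R); first exact: measurable_coord.
by apply/funext => u /=; rewrite mxE.
Qed.

Section lebesgue_cons.
Variables (n : nat) (mu : {sigma_finite_measure set 'rV[R]_n -> \bar R}).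

Definition lebesgue_cons : set 'rV[R]_n.+1 -> \bar R :=
  pushforward (prod_measure (@lebesgue_measure R) mu) (@vcons n).

Let lebesgue_cons0 : lebesgue_cons set0 = 0%E.
Proof. by rewrite /lebesgue_cons /pushforward preimage_set0 measure0. Qed.

Let lebesgue_cons_ge0 A : (0 <= lebesgue_cons A)%E.
Proof. by rewrite /lebesgue_cons /pushforward measure_ge0. Qed.

Let lebesgue_cons_sigma_additive : semi_sigma_additive lebesgue_cons.
Proof.
exact: (@measure_semi_sigma_additive _ _ _
  (measure_function_pushforward__canonical__measure_function_Measure
    (prod_measure (@lebesgue_measure R) mu) (@measurable_vcons n))).
Qed.

HB.instance Definition _ := isMeasure.Build _ _ _ lebesgue_cons
  lebesgue_cons0 lebesgue_cons_ge0 lebesgue_cons_sigma_additive.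

Let lebesgue_cons_sigma_finite : sigma_finite setT lebesgue_cons.
Proof.
pose m : {sigma_finite_measure set (measurableTypeR R * 'rV[R]_n)%type -> \bar R} :=
  (prod_measure (@lebesgue_measure R) mu).
have [F TF mF] := sigma_finiteT m.
exists (fun k => @vuncons n @^-1` F k).
  by rewrite -preimage_bigcup -TF preimage_setT.
move=> k; have [mFk Fkoo] := mF k; split.
  by rewrite -[X in measurable X]setTI; exact: measurable_vuncons.
rewrite /lebesgue_cons /pushforward -comp_preimage.
rewrite (_ : _ \o _ = id) ?preimage_id//.
by apply/funext => p /=; rewrite vconsK.
Qed.

HB.instance Definition _ := Measure_isSigmaFinite.Build _ _ _ lebesgue_cons
  lebesgue_cons_sigma_finite.

End lebesgue_cons.

Fixpoint lebesgue_rvec n : {sigma_finite_measure set 'rV[R]_n -> \bar R} :=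
  match n return {sigma_finite_measure set 'rV[R]_n -> \bar R} with
  | 0 => dirac (0 : 'rV[R]_0)
  | n'.+1 => lebesgue_cons (lebesgue_rvec n')
  end.

End lebesgue_measure_rvec.

Section complex_valued.
Context {R : realType}.

Definition expi (t : R) : R[i] := cos t +i* sin t.

Section integral.
Context d (T : measurableType d) (mu : {measure set T -> \bar R}).

Definition cmeasurable (f : T -> R[i]) :=
  measurable_fun setT (fun x => complex.Re (f x)) /\
  measurable_fun setT (fun x => complex.Im (f x)).

Definition cintegrable (f : T -> R[i]) :=
  mu.-integrable setT (fun x => (complex.Re (f x))%:E) /\
  mu.-integrable setT (fun x => (complex.Im (f x))%:E).

Definition cintegral (f : T -> R[i]) : R[i] :=
  (\int[mu]_x complex.Re (f x)) +i* (\int[mu]_x complex.Im (f x)).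

End integral.

(* Unconditional convergence of the family [u], with sum [s]. *)
Definition has_csum (I : choiceType) (u : I -> R[i]) (s : R[i]) :=
  forall e : R, 0 < e -> exists A0 : {fset I}, forall A : {fset I},
    (A0 `<=` A)%fset -> normc (\sum_(i <- A) u i - s) < e.

(* Real-analyticity on R^m: around every point, f is the sum of a power series
   in m variables, the multi-indices being the functions from 'I_m to nat. *)
Definition real_analytic m (f : 'rV[R]_m -> R[i]) :=
  forall p, exists a : {ffun 'I_m -> nat} -> R[i], exists2 r : R, 0 < r &
    forall v : 'rV[R]_m, (forall i, `|v ord0 i| < r) ->
      has_csum (fun alpha => a alpha * (\prod_i v ord0 i ^+ alpha i)%:C)
               (f (p + v)).

Definition cderive (V : normedModType R) (v : V) (f : V -> R[i]) (x : V) : R[i] :=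
  ('D_v (fun y => complex.Re (f y)) x) +i* ('D_v (fun y => complex.Im (f y)) x).

End complex_valued.

Section L2.
Context {R : realType} {n : nat}.
Local Notation leb := (@lebesgue_rvec R n).
Local Notation fct := ('rV[R]_n -> R[i]).

Definition L2norm (f : fct) : \bar R := 'N[leb]_2[EFin \o (fun u => normc (f u))]%E.

Definition L2 (f : fct) := cmeasurable f /\ (L2norm f < +oo)%E.

Definition inner (f g : fct) : R[i] :=
  cintegral leb (fun u => f u * conjc (g u)).

(* Operators act on representatives; linearity and boundedness force them to
   respect equality almost everywhere on L^2.  Their values on functions that
   are not in L^2 are irrelevant. *)
Definition bounded_op (A : fct -> fct) :=
  [/\ forall f, L2 f -> L2 (A f),
      forall (a : R[i]) f g, L2 f -> L2 g ->
        {ae leb, forall u, A (fun w => a * f w + g w) u = a * A f u + A g u} &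
      exists C : R, forall f, L2 f -> (L2norm (A f) <= C%:E * L2norm f)%E].

End L2.

Section wick.
Context {R : realType} {n : nat} (h : R).
Local Notation vec := 'rV[R]_n.
Local Notation phase := ('rV[R]_n * 'rV[R]_n)%type.
Local Notation fct := ('rV[R]_n -> R[i]).

Definition phase_measure :=
  prod_measure (@lebesgue_rvec R n) (@lebesgue_rvec R n).

Definition dot (u v : vec) : R := \sum_i u ord0 i * v ord0 i.

Definition sqnorm (X : phase) : R := dot X.1 X.1 + dot X.2 X.2.

Definition coherent (X : phase) : fct := fun u =>
  ((pi * h) `^ (- (n%:R / 4)) * expR (- (dot (u - X.1) (u - X.1) / (2 * h))))%:C
  * expi (dot u X.2 / h - dot X.1 X.2 / (2 * h)).

Definition cproj (X : phase) (f : fct) : fct :=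
  fun u => inner f (coherent X) * coherent X u.

Definition wick_symbol (A : fct -> fct) (X : phase) : R[i] :=
  inner (A (coherent X)) (coherent X).

Definition confinement (A : fct -> fct) (V : phase) : \bar R :=
  ereal_sup [set (normc (inner (A (coherent Z.1)) (coherent Z.2)))%:E |
              Z in [set Z : phase * phase | Z.1 - Z.2 = V]].

Definition C_h (A : fct -> fct) :=
  bounded_op A /\ phase_measure.-integrable setT (confinement A).

Definition phase_of_row (w : 'rV[R]_(n + n)) : phase := (lsubmx w, rsubmx w).

Definition dir_pos (j : 'I_n) : phase := (delta_mx ord0 j, 0).
Definition dir_mom (j : 'I_n) : phase := (0, delta_mx ord0 j).

Definition is_sesqui_ext (F : phase -> R[i]) (Fe : phase -> phase -> R[i]) :=
  [/\ real_analytic (fun w : 'rV[R]_((n + n) + (n + n)) =>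
        Fe (phase_of_row (lsubmx w)) (phase_of_row (rsubmx w))),
      forall j X Y,
        cderive (dir_pos j) (Fe^~ Y) X + (0 +i* 1) * cderive (dir_mom j) (Fe^~ Y) X = 0 /\
        cderive (dir_pos j) (Fe X) Y - (0 +i* 1) * cderive (dir_mom j) (Fe X) Y = 0,
      forall X, Fe X X = F X &
      exists psi : phase -> R,
        [/\ psi \in Lfun phase_measure 1%E,
            psi \in Lfun phase_measure +oo%E &
            forall X Y,
              normc (Fe X Y) <= expR (sqnorm (X - Y) / (4 * h)) * psi (X - Y)]].

Definition D_h (F : phase -> R[i]) := exists Fe, is_sesqui_ext F Fe.

(* The extension is unique when it exists; outside D_h the value is irrelevant. *)
Definition sesqui_ext (F : phase -> R[i]) : phase -> phase -> R[i] :=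
  xget (fun _ _ => 0) [set Fe | is_sesqui_ext F Fe].

(* [A] is Op_h^Wick(F): bounded, and equal to the weak integral of
   (2 pi h)^(-2n) F^ext(Y, X) Pi_X Pi_Y over (X, Y) = Z. *)
Definition is_op_wick (F : phase -> R[i]) (A : fct -> fct) :=
  bounded_op A /\
  forall f g, L2 f -> L2 g ->
    let K := fun Z : phase * phase =>
      sesqui_ext F Z.2 Z.1 * inner (cproj Z.1 (cproj Z.2 f)) g in
    cintegrable (prod_measure phase_measure phase_measure) K /\
    inner (A f) g = ((2 * pi * h) ^- (2 * n))%:C *
      cintegral (prod_measure phase_measure phase_measure) K.

End wick.

(* Main.v *)
Require Import Defs.
From HB Require Import structures.
From mathcomp Require Import all_boot all_order all_algebra finmap.
From mathcomp Require Import complex.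
From mathcomp Require Import all_classical all_reals all_analysis.
From mathcomp Require Import measurable_realfun ess_sup_inf ring lra.

Set Implicit Arguments.
Unset Strict Implicit.
Unset Printing Implicit Defensive.

Import Order.TTheory GRing.Theory Num.Theory.
Import numFieldNormedType.Exports.
Import ComplexField.Normc.

Local Open Scope classical_set_scope.
Local Open Scope ring_scope.
Local Open Scope complex_scope.


(** * Measure-preserving maps *)

Lemma measurable_preimageT d1 d2 (T1 : measurableType d1)
    (T2 : measurableType d2) (f : T1 -> T2) (A : set T2) :
  measurable_fun setT f -> measurable A -> measurable (f @^-1` A).
Proof. by move=> mf mA; rewrite -[_ @^-1` _]setTI; exact: mf. Qed.

Section preserves.
Context d (T : measurableType d) {R : realType}.
Implicit Types (mu : {measure set T -> \bar R}) (phi : T -> T).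

Definition preserves (mu : set T -> \bar R) phi :=
  measurable_fun setT phi /\
  forall A, measurable A -> mu (phi @^-1` A) = mu A.

Lemma preserves_comp mu phi psi :
  preserves mu phi -> preserves mu psi -> preserves mu (phi \o psi).
Proof.
move=> [mphi phiE] [mpsi psiE]; split; first exact: measurableT_comp.
move=> A mA; rewrite comp_preimage psiE ?phiE//.
exact: measurable_preimageT.
Qed.

Lemma ge0_integral_preserves mu phi (f : T -> \bar R) :
  preserves mu phi -> measurable_fun setT f -> (forall x, 0 <= f x)%E ->
  (\int[mu]_x f (phi x) = \int[mu]_x f x)%E.
Proof.
move=> [mphi phiE] mf f0.
rewrite -[LHS]/(\int[mu]_(x in phi @^-1` setT) (f \o phi) x)%E.
rewrite -ge0_integral_pushforward//.
by apply: eq_measure_integral => A mA _; exact: phiE.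
Qed.

Lemma integral_preserves mu phi (f : T -> \bar R) :
  preserves mu phi -> measurable_fun setT f ->
  (\int[mu]_x f (phi x) = \int[mu]_x f x)%E.
Proof.
move=> pphi mf; rewrite [LHS]integralE [RHS]integralE; congr (_ - _)%E.
  rewrite -(@ge0_integral_preserves mu phi (f^\+)%E)//.
    by apply: eq_integral => x _; rewrite -[RHS]/((f^\+ \o phi) x)%E -funepos_comp.
  exact: measurable_funepos.
rewrite -(@ge0_integral_preserves mu phi (f^\-)%E)//.
  by apply: eq_integral => x _; rewrite -[RHS]/((f^\- \o phi) x)%E -funeneg_comp.
exact: measurable_funeneg.
Qed.

Lemma ae_preserves mu phi (P : T -> Prop) :
  preserves mu phi -> {ae mu, forall x, P x} -> {ae mu, forall x, P (phi x)}.
Proof.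
move=> [mphi phiE] [N [mN N0 sN]]; exists (phi @^-1` N); split.
- exact: measurable_preimageT.
- by rewrite phiE.
- by move=> x /= nP; exact: sN.
Qed.

End preserves.

Section preserves_product.
Context d1 d2 (T1 : measurableType d1) (T2 : measurableType d2) {R : realType}.
Variable m1 : {sigma_finite_measure set T1 -> \bar R}.
Variable m2 : {sigma_finite_measure set T2 -> \bar R}.

(** The product measure of a set is the integral of the measures of its
    slices, so it is enough that each slice is preserved. *)
Lemma preserves_shear (psi : T1 -> T2 -> T2) :
  measurable_fun setT (fun z : T1 * T2 => psi z.1 z.2) ->
  (forall x, preserves m2 (psi x)) ->
  preserves (prod_measure m1 m2) (fun z => (z.1, psi z.1 z.2)).
Proof.
move=> mpsi ppsi; split; first exact: measurable_fun_pair.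
move=> A mA; rewrite /prod_measure /product_measure1 /=.
apply: eq_integral => x _ /=; rewrite -[RHS](ppsi x).2; last exact: measurable_xsection.
by congr (m2 _); apply/seteqP; split => y; rewrite /xsection /= !inE.
Qed.

Lemma preserves_prod phi1 phi2 : preserves m1 phi1 -> preserves m2 phi2 ->
  preserves (prod_measure m1 m2) (fun z => (phi1 z.1, phi2 z.2)).
Proof.
move=> [mphi1 phi1E] [mphi2 phi2E].
have mphi : measurable_fun setT (fun z : T1 * T2 => (phi1 z.1, phi2 z.2)).
  by apply: measurable_fun_pair; exact: measurableT_comp.
split=> // A mA.
pose m' : {measure set (T1 * T2) -> \bar R} :=
  measure_function_pushforward__canonical__measure_function_Measure
    (prod_measure m1 m2) mphi.
apply/esym; apply: (@product_measure_unique _ _ _ _ _ m1 m2 m') => // B C mB mC.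
rewrite /m' /= /pushforward -[LHS]/(prod_measure m1 m2 _) /=.
have -> : (fun z => (phi1 z.1, phi2 z.2)) @^-1` (B `*` C) =
   (phi1 @^-1` B) `*` (phi2 @^-1` C) by [].
rewrite /prod_measure product_measure1E; last 2 first.
- exact: measurable_preimageT.
- exact: measurable_preimageT.
by congr (_ * _)%E; [exact: phi1E|exact: phi2E].
Qed.

Lemma preserves_swap (m : {sigma_finite_measure set T1 -> \bar R}) :
  preserves (prod_measure m m) (fun z => (z.2, z.1)).
Proof.
have ms : measurable_fun setT (fun z : T1 * T1 => (z.2, z.1)).
  by apply: measurable_fun_pair; [exact: measurable_snd|exact: measurable_fst].
split=> // A mA.
pose m' : {measure set (T1 * T1) -> \bar R} :=
  measure_function_pushforward__canonical__measure_function_Measure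
    (prod_measure m m) ms.
apply/esym; apply: (@product_measure_unique _ _ _ _ _ m m m') => // B C mB mC.
rewrite /m' /= /pushforward -[LHS]/(prod_measure m m _) /=.
have -> : (fun z => (z.2, z.1)) @^-1` (B `*` C) = C `*` B.
  by apply/seteqP; split => -[x y] /= [].
by rewrite /prod_measure product_measure1E// muleC.
Qed.

End preserves_product.

Section lebesgue_rvec_invariance.
Context {R : realType}.

Lemma preserves_shift1 (a : R) : preserves (@lebesgue_measure R)
  (fun x : measurableTypeR R => (x + a : measurableTypeR R)).
Proof.
have ms : measurable_fun setT
  (fun x : measurableTypeR R => (x + a : measurableTypeR R)).
  by apply: measurable_funD => //; exact: measurable_cst.
split=> // A mA.
pose m' := measure_function_pushforward__canonical__measure_function_Measure
    (@lebesgue_measure R) ms.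
apply/esym; apply: (@lebesgue_measure_unique _ m') => //= _ [[b c]] _ <-.
rewrite /pushforward /=.
have -> : (fun x => x + a) @^-1` `]b, c]%classic = `]b - a, c - a]%classic.
  by apply/seteqP; split => x /=; rewrite !in_itv /= lerBrDr ltrBlDr.
by rewrite !lebesgue_measure_itv/= !lte_fin ltrD2r; case: ifP => // _; congr EFin; ring.
Qed.

Lemma preserves_opp1 : preserves (@lebesgue_measure R)
  (fun x : measurableTypeR R => (- x : measurableTypeR R)).
Proof.
split; last by move=> A mA; exact: lebesgue_measureN.
exact: (@oppr_measurable R).
Qed.

(** [lebesgue_rvec n.+1] is transported from a product, hence so is every
    invariance that acts separately on the head and on the tail. *)
Lemma preserves_vcons n (phi1 : measurableTypeR R -> measurableTypeR R)
    (phi2 : 'rV[R]_n -> 'rV[R]_n) (phi : 'rV[R]_n.+1 -> 'rV[R]_n.+1) :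
  preserves (@lebesgue_measure R) phi1 -> preserves (@lebesgue_rvec R n) phi2 ->
  measurable_fun setT phi ->
  (forall p, phi (vcons p) = vcons (phi1 p.1, phi2 p.2)) ->
  preserves (@lebesgue_rvec R n.+1) phi.
Proof.
move=> p1 p2 mphi phiE; split=> // A mA /=.
rewrite /lebesgue_cons /pushforward.
have mA' : measurable (@vcons R n @^-1` A).
  exact: measurable_preimageT (@measurable_vcons R n) mA.
have [_ /(_ _ mA') <-] := preserves_prod p1 p2.
congr (prod_measure _ _ _); apply/seteqP; split => p /=; by rewrite phiE.
Qed.

Lemma vconsE n (p : measurableTypeR R * 'rV[R]_n) i :
  vcons p ord0 i = match @fintype.split 1 n i with
                   | inl _ => p.1 | inr j => p.2 ord0 j end.
Proof. by rewrite /vcons mxE; case: fintype.split => j; rewrite ?mxE. Qed.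

Lemma vconsD n (p q : measurableTypeR R * 'rV[R]_n) :
  vcons p + vcons q = vcons (p.1 + q.1, p.2 + q.2).
Proof.
by apply/rowP => i; rewrite mxE !vconsE; case: fintype.split => // j; rewrite mxE.
Qed.

Lemma vconsN n (p : measurableTypeR R * 'rV[R]_n) :
  - vcons p = vcons (- p.1, - p.2).
Proof.
by apply/rowP => i; rewrite mxE !vconsE; case: fintype.split => // j; rewrite mxE.
Qed.

Lemma measurable_rvecD d (T : measurableType d) n (f g : T -> 'rV[R]_n) :
  measurable_fun setT f -> measurable_fun setT g ->
  measurable_fun setT (fun t => f t + g t).
Proof.
move=> mf mg; apply: measurable_rvec => i.
rewrite (_ : (fun t => _) = (fun t => f t ord0 i + g t ord0 i)); last first.
  by apply/funext => t; rewrite mxE.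
by apply: measurable_funD;
  exact: (measurableT_comp (@measurable_coord R n i)).
Qed.

Lemma measurable_rvecZ d (T : measurableType d) n (a : R) (f : T -> 'rV[R]_n) :
  measurable_fun setT f -> measurable_fun setT (fun t => a *: f t).
Proof.
move=> mf; apply: measurable_rvec => i.
rewrite (_ : (fun t => _) = (fun t => a * f t ord0 i)); last first.
  by apply/funext => t; rewrite mxE.
apply: measurable_funM; first exact: measurable_cst.
exact: (measurableT_comp (@measurable_coord R n i)).
Qed.

Lemma measurable_rvecN d (T : measurableType d) n (f : T -> 'rV[R]_n) :
  measurable_fun setT f -> measurable_fun setT (fun t => - f t).
Proof.
move=> mf; under eq_fun do rewrite -scaleN1r.
exact: measurable_rvecZ.
Qed.

Lemma preserves_shift n (a : 'rV[R]_n) :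
  preserves (@lebesgue_rvec R n) (fun u => u + a).
Proof.
elim: n a => [|n IH] a.
  split=> [|A mA]; first exact: measurable_rvecD.
  by congr (lebesgue_rvec _ _); apply/seteqP; split => u /=;
    rewrite (_ : u + a = u)//; apply/rowP => -[].
have := IH (vuncons a).2; have := preserves_shift1 (vuncons a).1.
move=> /preserves_vcons/[apply]; apply; first exact: measurable_rvecD.
by move=> p; rewrite -{1}(vunconsK a) vconsD.
Qed.

Lemma preserves_opp n : preserves (@lebesgue_rvec R n) (fun u => - u).
Proof.
elim: n => [|n IH].
  split=> [|A mA]; first exact: measurable_rvecN.
  by congr (lebesgue_rvec _ _); apply/seteqP; split => u /=;
    rewrite (_ : - u = u)//; apply/rowP => -[].
have := IH; have := preserves_opp1.
move=> /preserves_vcons/[apply]; apply; first exact: measurable_rvecN.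
by move=> p; rewrite vconsN.
Qed.

End lebesgue_rvec_invariance.

Section phase_invariance.
Context {R : realType} {n : nat}.
Local Notation phase := ('rV[R]_n * 'rV[R]_n)%type.
Local Notation pm := (@phase_measure R n).

Lemma measurable_phaseD d (T : measurableType d) (f g : T -> phase) :
  measurable_fun setT f -> measurable_fun setT g ->
  measurable_fun setT (fun t => f t + g t).
Proof.
move=> /measurable_fun_pairP[f1 f2] /measurable_fun_pairP[g1 g2].
by apply: measurable_fun_pair; exact: measurable_rvecD.
Qed.

Lemma measurable_phaseN d (T : measurableType d) (f : T -> phase) :
  measurable_fun setT f -> measurable_fun setT (fun t => - f t).
Proof.
move=> /measurable_fun_pairP[f1 f2].
by apply: measurable_fun_pair; exact: measurable_rvecN.
Qed.

Lemma measurable_phaseB d (T : measurableType d) (f g : T -> phase) :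
  measurable_fun setT f -> measurable_fun setT g ->
  measurable_fun setT (fun t => f t - g t).
Proof. by move=> mf mg; apply: measurable_phaseD => //; exact: measurable_phaseN. Qed.

Lemma preserves_phase_shift (A : phase) : preserves pm (fun X => X + A).
Proof. exact: (preserves_prod (preserves_shift A.1) (preserves_shift A.2)). Qed.

Lemma preserves_phase_opp : preserves pm (fun X => - X).
Proof. exact: (preserves_prod (@preserves_opp R n) (@preserves_opp R n)). Qed.

Lemma preserves_phase_reflect (A : phase) : preserves pm (fun X => A - X).
Proof.
have := preserves_comp (mu := pm) (preserves_phase_shift A) preserves_phase_opp.
by rewrite (_ : _ \o _ = (fun X => A - X))//; apply/funext => X /=; rewrite addrC.
Qed.

(** The real-linear action of complex numbers on phase space, seen as C^n. *)
Definition cscale (z : R[i]) (X : phase) : phase :=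
  (complex.Re z *: X.1 - complex.Im z *: X.2,
   complex.Im z *: X.1 + complex.Re z *: X.2).

Lemma preserves_shear2 (a : R) : preserves pm (fun X => (X.1, X.2 + a *: X.1)).
Proof.
apply: (@preserves_shear _ _ _ _ R (lebesgue_rvec n) (lebesgue_rvec n) (fun x y => y + a *: x)).
  by apply: measurable_rvecD => //; exact: measurable_rvecZ.
by move=> x; exact: preserves_shift.
Qed.

Lemma preserves_shear1 (a : R) : preserves pm (fun X => (X.1 + a *: X.2, X.2)).
Proof.
have sw := preserves_swap (@lebesgue_rvec R n).
exact: (preserves_comp (mu := pm) sw
  (preserves_comp (mu := pm) (preserves_shear2 a) sw)).
Qed.

(** A rotation of angle different from pi is a product of three shears. *)
Lemma preserves_rotation (t : R) : cos t != -1 -> preserves pm (cscale (expi t)).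
Proof.
move=> ct; set a := - (sin t / (1 + cos t)).
have c1 : 1 + cos t != 0 by rewrite addrC -[1]opprK subr_eq0.
have := preserves_comp (mu := pm) (preserves_shear1 a)
  (preserves_comp (mu := pm) (preserves_shear2 (sin t)) (preserves_shear1 a)).
have as_ : 1 + a * sin t = cos t.
  rewrite /a mulNr -mulrAC -expr2 sin2cos2.
  by apply: (mulIf c1); rewrite mulrBl mul1r mulfVK//; ring.
have aa : a + a * (1 + sin t * a) = - sin t.
  rewrite [sin t * a]mulrC as_ -{1}[a]mulr1 -mulrDr /a mulNr mulfVK//.
rewrite (_ : _ \o _ = cscale (expi t))//; apply/funext => -[x y].
rewrite /cscale /=; congr pair; apply/rowP => i; rewrite !mxE.
  rewrite -as_ -[- (_ * _)]mulNr -aa; ring.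
by rewrite -as_; ring.
Qed.

End phase_invariance.

(** * Complex numbers and the complex exponential *)

Section complex_basics.
Context {R : realType}.
Implicit Types (z w : R[i]) (x y : R).

Lemma ReD z w : complex.Re (z + w) = complex.Re z + complex.Re w.
Proof. by case: z; case: w. Qed.

Lemma ImD z w : complex.Im (z + w) = complex.Im z + complex.Im w.
Proof. by case: z; case: w. Qed.

Lemma ReN z : complex.Re (- z) = - complex.Re z.
Proof. by case: z. Qed.

Lemma ImN z : complex.Im (- z) = - complex.Im z.
Proof. by case: z. Qed.

Lemma ReM z w : complex.Re (z * w) =
  complex.Re z * complex.Re w - complex.Im z * complex.Im w.
Proof. by case: z; case: w. Qed.

Lemma ImM z w : complex.Im (z * w) =
  complex.Re z * complex.Im w + complex.Im z * complex.Re w.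
Proof. by case: z; case: w. Qed.

Lemma Re_conjc z : complex.Re (conjc z) = complex.Re z.
Proof. by case: z. Qed.

Lemma Im_conjc z : complex.Im (conjc z) = - complex.Im z.
Proof. by case: z. Qed.

Lemma complex_ext z w :
  complex.Re z = complex.Re w -> complex.Im z = complex.Im w -> z = w.
Proof. by case: z => a b; case: w => c d /= -> ->. Qed.

Lemma ReImK z : complex.Re z +i* complex.Im z = z.
Proof. by case: z. Qed.

Lemma normc_ge0 z : 0 <= normc z.
Proof. by case: z => a b; rewrite /normc sqrtr_ge0. Qed.

Lemma sqr_normcE z : normc z ^+ 2 = complex.Re z ^+ 2 + complex.Im z ^+ 2.
Proof. by case: z => a b; rewrite /normc sqr_sqrtr// addr_ge0// sqr_ge0. Qed.

Lemma normcR x : normc x%:C = `|x|.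
Proof. by rewrite /normc /= expr0n /= addr0 sqrtr_sqr. Qed.

Lemma normcRge0 x : 0 <= x -> normc x%:C = x.
Proof. by move=> x0; rewrite normcR ger0_norm. Qed.

Lemma normc_conjc z : normc (conjc z) = normc z.
Proof. by case: z => a b; rewrite /normc /= sqrrN. Qed.

Lemma Re_le_normc z : `|complex.Re z| <= normc z.
Proof.
rewrite -(@ler_pXn2r _ 2) ?nnegrE ?normc_ge0// sqr_normcE real_normK ?num_real//.
by rewrite lerDl sqr_ge0.
Qed.

Lemma Im_le_normc z : `|complex.Im z| <= normc z.
Proof.
rewrite -(@ler_pXn2r _ 2) ?nnegrE ?normc_ge0// sqr_normcE real_normK ?num_real//.
by rewrite lerDr sqr_ge0.
Qed.

Lemma normc_le_ReIm z : normc z <= `|complex.Re z| + `|complex.Im z|.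
Proof.
rewrite -(@ler_pXn2r _ 2) ?nnegrE ?normc_ge0 ?addr_ge0// sqr_normcE sqrrD.
rewrite !real_normK ?num_real// -addrA [X in _ <= _ + X]addrC addrA lerDl.
by rewrite mulrn_wge0// mulr_ge0.
Qed.

Lemma normcB z w : normc (z - w) = normc (w - z).
Proof. by rewrite -normcN opprB. Qed.

Lemma le_normcB z w : normc (z - w) <= normc z + normc w.
Proof. by rewrite -[normc w]normcN le_normcD. Qed.

Lemma normcX z k : normc (z ^+ k) = normc z ^+ k.
Proof.
elim: k => [|k IH]; first by rewrite !expr0 normc1.
by rewrite !exprS normcM IH.
Qed.

Lemma le_normc_sum (I : Type) (r : seq I) (P : pred I) (F : I -> R[i]) :
  normc (\sum_(i <- r | P i) F i) <= \sum_(i <- r | P i) normc (F i).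
Proof.
elim/big_ind2 : _ => //; first by rewrite normc0.
by move=> a b c d ab cd; apply: le_trans (le_normcD _ _) _; exact: lerD.
Qed.

Lemma mul_conjc z : z * conjc z = ((normc z) ^+ 2)%:C.
Proof.
apply: complex_ext; rewrite ?ReM ?ImM Re_conjc Im_conjc.
  by rewrite sqr_normcE mulrN opprK -!expr2.
by rewrite mulrN mulrC addNr.
Qed.

Definition cexp z : R[i] := (expR (complex.Re z))%:C * expi (complex.Im z).

Lemma expiD x y : expi (x + y) = expi x * expi y :> R[i].
Proof.
by apply: complex_ext; rewrite /expi ?ReM ?ImM /= ?cosD ?sinD// addrC.
Qed.

Lemma expi0 : expi 0 = 1 :> R[i].
Proof. by rewrite /expi cos0 sin0. Qed.

Lemma normc_expi x : normc (expi x) = 1.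
Proof.
apply/eqP; rewrite -(@eqrXn2 _ 2) ?normc_ge0//.
by rewrite sqr_normcE /= cos2Dsin2 expr1n.
Qed.

Lemma conjc_expi x : conjc (expi x) = expi (- x) :> R[i].
Proof. by rewrite /expi /= cosN sinN. Qed.

Lemma cexpD z w : cexp (z + w) = cexp z * cexp w.
Proof. by rewrite /cexp ReD ImD expRD expiD rmorphM; ring. Qed.

Lemma cexp0 : cexp 0 = 1.
Proof. by rewrite /cexp /= expR0 expi0 mulr1. Qed.

Lemma normc_cexp z : normc (cexp z) = expR (complex.Re z).
Proof. by rewrite /cexp normcM normc_expi mulr1 normcRge0 ?expR_ge0. Qed.

Lemma cexp_real x : cexp x%:C = (expR x)%:C.
Proof. by rewrite /cexp /= expi0 mulr1. Qed.

Lemma cexp_imag x : cexp (0 +i* x) = expi x.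
Proof. by rewrite /cexp /= expR0 mul1r. Qed.

Lemma conjc_cexp z : conjc (cexp z) = cexp (conjc z).
Proof.
by apply: complex_ext;
  rewrite /cexp ?Re_conjc ?Im_conjc /= ?cosN ?sinN; ring.
Qed.

Lemma cexpN z : cexp z * cexp (- z) = 1.
Proof. by rewrite -cexpD subrr cexp0. Qed.

End complex_basics.

(** * Integration of complex-valued functions *)

Section cmeasurable.
Context {R : realType} d (T : measurableType d).
Implicit Types f g : T -> R[i].

Lemma cmeasurable_cst (z : R[i]) : cmeasurable (fun _ : T => z).
Proof. by split; exact: measurable_cst. Qed.

Lemma cmeasurable_comp d' (T' : measurableType d') (phi : T' -> T) f :
  cmeasurable f -> measurable_fun setT phi -> cmeasurable (fun t => f (phi t)).
Proof.
move=> [mf mg] mphi; split.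
  exact: (measurableT_comp mf mphi).
exact: (measurableT_comp mg mphi).
Qed.

Lemma cmeasurableD f g :
  cmeasurable f -> cmeasurable g -> cmeasurable (fun x => f x + g x).
Proof.
move=> [? ?] [? ?]; split.
  by under eq_fun do rewrite ReD; exact: measurable_funD.
by under eq_fun do rewrite ImD; exact: measurable_funD.
Qed.

Lemma cmeasurableM f g :
  cmeasurable f -> cmeasurable g -> cmeasurable (fun x => f x * g x).
Proof.
move=> [? ?] [? ?]; split.
  by under eq_fun do rewrite ReM; apply: measurable_funB; exact: measurable_funM.
by under eq_fun do rewrite ImM; apply: measurable_funD; exact: measurable_funM.
Qed.

Lemma cmeasurableN f : cmeasurable f -> cmeasurable (fun x => - f x).
Proof.
move=> mf; under eq_fun do rewrite -mulN1r.
by apply: cmeasurableM => //; exact: cmeasurable_cst.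
Qed.

Lemma cmeasurableB f g :
  cmeasurable f -> cmeasurable g -> cmeasurable (fun x => f x - g x).
Proof. by move=> mf mg; apply: cmeasurableD => //; exact: cmeasurableN. Qed.

Lemma cmeasurable_conjc f : cmeasurable f -> cmeasurable (fun x => conjc (f x)).
Proof.
move=> [? ?]; split; first by under eq_fun do rewrite Re_conjc.
by under eq_fun do rewrite Im_conjc; exact: measurableT_comp.
Qed.

Lemma cmeasurableR (f : T -> R) :
  measurable_fun setT f -> cmeasurable (fun x => (f x)%:C).
Proof. by move=> mf; split => //=; exact: measurable_cst. Qed.

Lemma cmeasurable_expi (f : T -> R) :
  measurable_fun setT f -> cmeasurable (fun x => expi (f x)).
Proof.
move=> mf; split => /=; apply: measurableT_comp => //.
  by apply: continuous_measurable_fun; exact: continuous_cos.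
by apply: continuous_measurable_fun; exact: continuous_sin.
Qed.

Lemma cmeasurable_cexp f : cmeasurable f -> cmeasurable (fun x => cexp (f x)).
Proof.
move=> [mf mg]; apply: cmeasurableM; last exact: cmeasurable_expi.
by apply: cmeasurableR; apply: measurableT_comp.
Qed.

Lemma cmeasurable_sum (I : Type) (r : seq I) (F : I -> T -> R[i]) :
  (forall i, cmeasurable (F i)) -> cmeasurable (fun x => \sum_(i <- r) F i x).
Proof.
move=> mF; elim: r => [|i r IH].
  by under eq_fun do rewrite big_nil; exact: cmeasurable_cst.
by under eq_fun do rewrite big_cons; exact: cmeasurableD.
Qed.

Lemma cmeasurable_prod (I : Type) (r : seq I) (F : I -> T -> R[i]) :
  (forall i, cmeasurable (F i)) -> cmeasurable (fun x => \prod_(i <- r) F i x).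
Proof.
move=> mF; elim: r => [|i r IH].
  by under eq_fun do rewrite big_nil; exact: cmeasurable_cst.
by under eq_fun do rewrite big_cons; exact: cmeasurableM.
Qed.

Lemma cmeasurableX f k : cmeasurable f -> cmeasurable (fun x => f x ^+ k).
Proof.
move=> mf; elim: k => [|k IH].
  by under eq_fun do rewrite expr0; exact: cmeasurable_cst.
by under eq_fun do rewrite exprS; exact: cmeasurableM.
Qed.

Lemma measurable_normc f :
  cmeasurable f -> measurable_fun setT (fun x => normc (f x)).
Proof.
move=> [mf mg]; under eq_fun do rewrite -[normc _]ger0_norm ?normc_ge0// -sqrtr_sqr sqr_normcE.
apply: measurableT_comp.
  by apply: continuous_measurable_fun; exact: sqrt_continuous.
by apply: measurable_funD; exact: measurable_funX.
Qed.

Lemma measurable_normcE f :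
  cmeasurable f -> measurable_fun setT (fun x => (normc (f x))%:E).
Proof. by move=> mf; apply/measurable_EFinP; exact: measurable_normc. Qed.

End cmeasurable.

Section cintegral_theory.
Context {R : realType} d (T : measurableType d) (mu : {measure set T -> \bar R}).
Implicit Types f g : T -> R[i].
Local Notation intb g := (mu.-integrable setT (EFin \o g)).

Lemma cintegrable_meas f : cintegrable mu f -> cmeasurable f.
Proof.
by move=> [/integrableP[mf _] /integrableP[mg _]]; split;
  exact/measurable_EFinP.
Qed.

Lemma integrable_le_ge0 (f : T -> R) (g : T -> R) : measurable_fun setT f ->
  intb g -> (forall x, `|f x| <= g x) -> intb f.
Proof.
move=> mf ig fg; apply: (le_integrable measurableT _ _ ig).
  exact/measurable_EFinP.
move=> x _ /=; rewrite lee_fin; apply: le_trans (fg x) _; exact: ler_norm.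
Qed.

Lemma cintegrable_le f (g : T -> R) : cmeasurable f -> intb g ->
  (forall x, normc (f x) <= g x) -> cintegrable mu f.
Proof.
move=> [mf mf'] ig fg; split.
  apply: (@integrable_le_ge0 (fun x => complex.Re (f x)) g) => // x.
  exact: le_trans (Re_le_normc _) (fg x).
apply: (@integrable_le_ge0 (fun x => complex.Im (f x)) g) => // x.
exact: le_trans (Im_le_normc _) (fg x).
Qed.

Lemma cintegrable_normc f : cintegrable mu f -> intb (fun x => normc (f x)).
Proof.
move=> fi; have mf := cintegrable_meas fi; case: fi => fi1 fi2.
apply: (@integrable_le_ge0 _
  (fun x => `|complex.Re (f x)| + `|complex.Im (f x)|)) => //.
- exact: measurable_normc.
- rewrite (_ : _ \o _ = (fun x => `|complex.Re (f x)|%:E + `|complex.Im (f x)|%:E)%E)//.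
  by apply: integrableD => //; [exact: integrable_abse fi1|exact: integrable_abse fi2].
- by move=> x; rewrite ger0_norm ?normc_ge0//; exact: normc_le_ReIm.
Qed.

Lemma cintegrableP f : cintegrable mu f <->
  cmeasurable f /\ (\int[mu]_x (normc (f x))%:E < +oo)%E.
Proof.
split=> [fi|[mf foo]].
  split; first exact: cintegrable_meas.
  have /integrableP[_] := cintegrable_normc fi.
  by under eq_integral do rewrite /= ger0_norm ?normc_ge0//.
apply: (cintegrable_le (g := fun x => normc (f x))) => //.
apply/integrableP; split; first exact: measurable_normcE.
by under eq_integral do rewrite /= ger0_norm ?normc_ge0//.
Qed.

Lemma cintegrableD f g : cintegrable mu f -> cintegrable mu g ->
  cintegrable mu (fun x => f x + g x).
Proof.
move=> [f1 f2] [g1 g2]; split.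
  by under eq_fun do rewrite ReD EFinD; exact: integrableD.
by under eq_fun do rewrite ImD EFinD; exact: integrableD.
Qed.

Lemma cintegrableZ (z : R[i]) f : cintegrable mu f ->
  cintegrable mu (fun x => z * f x).
Proof.
move=> fi; apply: (cintegrable_le (g := fun x => normc z * normc (f x))).
- by apply: cmeasurableM; [exact: cmeasurable_cst|exact: cintegrable_meas].
- rewrite (_ : _ \o _ = (fun x => (normc z)%:E * (normc (f x))%:E)%E)//.
  by apply: integrableZl => //; exact: cintegrable_normc.
- by move=> x; rewrite normcM.
Qed.

Lemma cintegrableB f g : cintegrable mu f -> cintegrable mu g ->
  cintegrable mu (fun x => f x - g x).
Proof.
move=> fi gi; apply: cintegrableD => //.
by under eq_fun do rewrite -mulN1r; exact: cintegrableZ.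
Qed.

Lemma cintegrable0 : cintegrable mu (fun=> 0).
Proof. by split; exact: integrable0. Qed.

Lemma cintegrable_sum (I : Type) (r : seq I) (F : I -> T -> R[i]) :
  (forall i, cintegrable mu (F i)) ->
  cintegrable mu (fun x => \sum_(i <- r) F i x).
Proof.
move=> mF; elim: r => [|i r IH].
  by under eq_fun do rewrite big_nil; exact: cintegrable0.
by under eq_fun do rewrite big_cons; exact: cintegrableD.
Qed.

Lemma cintegrable_conjc f : cintegrable mu f ->
  cintegrable mu (fun x => conjc (f x)).
Proof.
move=> fi; apply: (cintegrable_le (g := fun x => normc (f x))).
- by apply: cmeasurable_conjc; exact: cintegrable_meas.
- exact: cintegrable_normc.
- by move=> x; rewrite normc_conjc.
Qed.

Lemma cintegralD f g : cintegrable mu f -> cintegrable mu g ->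
  cintegral mu (fun x => f x + g x) = cintegral mu f + cintegral mu g.
Proof.
move=> [f1 f2] [g1 g2]; apply: complex_ext; rewrite ?ReD ?ImD /=.
  by rewrite -RintegralD//; apply: eq_Rintegral => x _; rewrite ReD.
by rewrite -RintegralD//; apply: eq_Rintegral => x _; rewrite ImD.
Qed.

Lemma eq_cintegral f g : (forall x, f x = g x) ->
  cintegral mu f = cintegral mu g.
Proof. by move=> fg; rewrite (_ : f = g)//; apply/funext. Qed.

Lemma cintegralZ (z : R[i]) f : cintegrable mu f ->
  cintegral mu (fun x => z * f x) = z * cintegral mu f.
Proof.
move=> [f1 f2]; apply: complex_ext; rewrite ?ReM ?ImM /=.
  rewrite -!RintegralZl// -RintegralB//; first by apply: eq_Rintegral => x _; rewrite ReM.
  - by rewrite (_ : _ \o _ = (fun x => (complex.Re z)%:E * (complex.Re (f x))%:E)%E)//;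
      exact: integrableZl.
  - by rewrite (_ : _ \o _ = (fun x => (complex.Im z)%:E * (complex.Im (f x))%:E)%E)//;
      exact: integrableZl.
rewrite -!RintegralZl// -RintegralD//; first by apply: eq_Rintegral => x _; rewrite ImM.
- by rewrite (_ : _ \o _ = (fun x => (complex.Re z)%:E * (complex.Im (f x))%:E)%E)//;
    exact: integrableZl.
- by rewrite (_ : _ \o _ = (fun x => (complex.Im z)%:E * (complex.Re (f x))%:E)%E)//;
    exact: integrableZl.
Qed.

Lemma cintegralZr (z : R[i]) f : cintegrable mu f ->
  cintegral mu (fun x => f x * z) = cintegral mu f * z.
Proof. by move=> fi; rewrite mulrC -cintegralZ//; apply: eq_cintegral => x; exact: mulrC. Qed.

Lemma cintegralB f g : cintegrable mu f -> cintegrable mu g ->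
  cintegral mu (fun x => f x - g x) = cintegral mu f - cintegral mu g.
Proof.
move=> fi gi; rewrite -mulN1r -cintegralZ// -cintegralD//; last exact: cintegrableZ.
by apply: eq_cintegral => x; rewrite mulN1r.
Qed.

Lemma cintegral0 : cintegral mu (fun=> 0) = 0.
Proof. by apply: complex_ext => /=; rewrite Rintegral_cst// mul0r. Qed.

Lemma cintegral_sum (I : Type) (r : seq I) (F : I -> T -> R[i]) :
  (forall i, cintegrable mu (F i)) ->
  cintegral mu (fun x => \sum_(i <- r) F i x) = \sum_(i <- r) cintegral mu (F i).
Proof.
move=> iF; elim: r => [|i r IH].
  by under eq_fun do rewrite big_nil; rewrite big_nil cintegral0.
under eq_fun do rewrite big_cons.
by rewrite cintegralD// ?IH ?big_cons//; exact: cintegrable_sum.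
Qed.

Lemma cintegral_conjc f : cintegrable mu f ->
  cintegral mu (fun x => conjc (f x)) = conjc (cintegral mu f).
Proof.
move=> [f1 f2]; apply: complex_ext; rewrite ?Re_conjc ?Im_conjc /=.
  by apply: eq_Rintegral => x _; rewrite Re_conjc.
rewrite -mulN1r -RintegralZl//; apply: eq_Rintegral => x _.
by rewrite Im_conjc mulN1r.
Qed.

Lemma cintegralR (f : T -> R) :
  cintegral mu (fun x => (f x)%:C) = (\int[mu]_x f x)%:C.
Proof. by apply: complex_ext => //=; rewrite Rintegral_cst// mul0r. Qed.

Lemma cintegrableR (f : T -> R) : intb f -> cintegrable mu (fun x => (f x)%:C).
Proof. by move=> fi; split => //=; exact: integrable0. Qed.

(** Multiplying by the conjugate of the integral turns its modulus into the
    real part of an integral. *)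
Lemma normc_cintegral_le f : cintegrable mu f ->
  normc (cintegral mu f) <= \int[mu]_x normc (f x).
Proof.
move=> fi; set I := cintegral mu f.
have [->|I0] := eqVneq I 0.
  by rewrite normc0; apply: Rintegral_ge0 => x _; exact: normc_ge0.
have nI : 0 < normc I.
  by rewrite lt_neqAle normc_ge0 andbT eq_sym; apply: contra_neq I0 => /eq0_normc.
rewrite -(ler_pM2l nI) -expr2.
have -> : normc I ^+ 2 = complex.Re (cintegral mu (fun x => conjc I * f x)).
  by rewrite cintegralZ// -/I mulrC mul_conjc.
have fiI := cintegrableZ (conjc I) fi.
have nf := cintegrable_normc fi.
rewrite -RintegralZl//; apply: le_Rintegral => //.
- exact: fiI.1.
- by rewrite (_ : _ \o _ = (fun x => (normc I)%:E * (normc (f x))%:E)%E)//;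
    exact: integrableZl.
move=> x _; rewrite -[normc I]normc_conjc -normcM.
by apply: le_trans (Re_le_normc _); exact: ler_norm.
Qed.

Lemma normc_cintegral_leE f : cintegrable mu f ->
  ((normc (cintegral mu f))%:E <= \int[mu]_x (normc (f x))%:E)%E.
Proof.
move=> fi; have := normc_cintegral_le fi.
rewrite -lee_fin /Rintegral fineK//; apply: integrable_fin_num => //.
exact: cintegrable_normc.
Qed.

Lemma eq_cintegrable f g : (forall x, f x = g x) ->
  cintegrable mu f -> cintegrable mu g.
Proof. by move=> fg; rewrite (_ : f = g)//; apply/funext. Qed.

Lemma cintegral_preserves (phi : T -> T) f : preserves mu phi ->
  cmeasurable f -> cintegral mu (fun x => f (phi x)) = cintegral mu f.
Proof.
move=> pphi [mf mf']; apply: complex_ext; congr fine.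
  by apply: (integral_preserves (f := fun x => (complex.Re (f x))%:E)) => //;
    exact/measurable_EFinP.
by apply: (integral_preserves (f := fun x => (complex.Im (f x))%:E)) => //;
    exact/measurable_EFinP.
Qed.

Lemma cintegrable_preserves (phi : T -> T) f : preserves mu phi ->
  cintegrable mu f -> cintegrable mu (fun x => f (phi x)).
Proof.
move=> pphi /cintegrableP[mf foo]; apply/cintegrableP; split.
  by apply: cmeasurable_comp => //; case: pphi.
rewrite (@ge0_integral_preserves _ _ _ mu phi (fun x => (normc (f x))%:E))//.
  exact: measurable_normcE.
by move=> x; exact: normc_ge0.
Qed.

Lemma ae_eq_cintegral f g : cmeasurable f -> cmeasurable g ->
  {ae mu, forall x, f x = g x} -> cintegral mu f = cintegral mu g.
Proof.
move=> [mf mf'] [mg mg'] fg; apply: complex_ext; congr fine.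
  apply: ae_eq_integral => //; try exact/measurable_EFinP.
  by apply: filterS fg => x -> _.
apply: ae_eq_integral => //; try exact/measurable_EFinP.
by apply: filterS fg => x -> _.
Qed.

Lemma cdominated (f_ : nat -> T -> R[i]) f (g : T -> R) :
  (forall k, cmeasurable (f_ k)) -> cmeasurable f -> intb g ->
  (forall x, normc (f_ k x - f x) @[k --> \oo] --> 0) ->
  (forall k x, normc (f_ k x) <= g x) ->
  normc (cintegral mu (f_ k) - cintegral mu f) @[k --> \oo] --> 0.
Proof.
move=> mf_ mf ig f_f f_g.
have fg x : normc (f x) <= g x.
  apply/ler_addgt0Pr => e e0; have /cvgrPdist_lt/(_ _ e0)[k _ /(_ k)] := f_f x.
  move=> /(_ (leqnn k)); rewrite sub0r normrN ger0_norm ?normc_ge0// => fke.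
  rewrite -[f x](subKr (f_ k x)); apply: le_trans (le_normcB _ _) _.
  by apply: lerD => //; exact: ltW.
have fi_ k : cintegrable mu (f_ k) by exact: cintegrable_le (f_g k).
have fi : cintegrable mu f by exact: cintegrable_le fg.
have [|||||_ _] := @dominated_convergence _ T R mu setT measurableT
  (fun k x => (normc (f_ k x - f x))%:E) (fun=> 0%E) (EFin \o (fun x => 2 * g x)).
- by move=> k; apply: measurable_normcE; exact: cmeasurableB.
- exact: measurable_cst.
- apply: aeW => x _; apply: cvg_EFin; first exact: nearW.
  exact: f_f.
- rewrite (_ : _ \o _ = (fun x => 2%:E * (g x)%:E)%E)//.
  exact: integrableZl.
- apply: aeW => x k _ /=; rewrite lee_fin ger0_norm ?normc_ge0//.
  apply: le_trans (le_normcB _ _) _.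
  by rewrite mulr_natl mulr2n; exact: lerD.
rewrite integral0 => cvE.
have {cvE} cv : \int[mu]_x normc (f_ k x - f x) @[k --> \oo] --> 0.
  have /fine_cvgP[_] := cvE; apply: cvg_trans; apply: near_eq_cvg.
  apply: nearW => k /=; congr fine; apply: eq_integral => x _ /=.
apply: (squeeze_cvgr _ (cvg_cst 0) cv); apply: nearW => k.
rewrite normc_ge0 andTb -cintegralB//; apply: normc_cintegral_le.
exact: cintegrableB.
Qed.

End cintegral_theory.

Section cfubini.
Context {R : realType} d1 d2 (T1 : measurableType d1) (T2 : measurableType d2).
Variable m1 : {sigma_finite_measure set T1 -> \bar R}.
Variable m2 : {sigma_finite_measure set T2 -> \bar R}.
Implicit Types f : T1 * T2 -> R[i].
Local Notation mm := (prod_measure m1 m2).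

Lemma cintegrable_prod12 f : cmeasurable f ->
  (\int[m1]_x \int[m2]_y (normc (f (x, y)))%:E < +oo)%E -> cintegrable mm f.
Proof.
move=> mf foo; apply/cintegrableP; split => //.
rewrite /prod_measure (fubini_tonelli1 (fun z => (normc (f z))%:E))//.
  exact: measurable_normcE.
by move=> x; exact: normc_ge0.
Qed.

Lemma cintegrable_prod21 f : cmeasurable f ->
  (\int[m2]_y \int[m1]_x (normc (f (x, y)))%:E < +oo)%E -> cintegrable mm f.
Proof.
move=> mf foo; apply/cintegrableP; split => //.
rewrite /prod_measure (fubini_tonelli2 (fun z => (normc (f z))%:E))//.
  exact: measurable_normcE.
by move=> x; exact: normc_ge0.
Qed.

Lemma fine_abse_le (z : \bar R) : (`|(fine z)%:E| <= `|z|)%E.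
Proof. by case: z => [r||]; rewrite /= ?normr0 ?leey. Qed.

Lemma cintegrable_fubini1 f : cintegrable mm f ->
  cintegrable m1 (fun x => cintegral m2 (fun y => f (x, y))).
Proof.
move=> [f1 f2].
have h (g : T1 * T2 -> R) : mm.-integrable setT (EFin \o g) ->
    m1.-integrable setT (fun x => (\int[m2]_y g (x, y))%:E).
  move=> gi; have Fi := integrable_fubini_F gi.
  apply: le_integrable (Fi) => //.
    apply/measurable_EFinP; apply: measurableT_comp => //.
    exact: measurable_int Fi.
  by move=> x _; exact: fine_abse_le.
by split; [exact: h f1|exact: h f2].
Qed.

Lemma cintegral_fubini1 f : cintegrable mm f ->
  cintegral mm f = cintegral m1 (fun x => cintegral m2 (fun y => f (x, y))).
Proof.
move=> [f1 f2].
have h (g : T1 * T2 -> R) : mm.-integrable setT (EFin \o g) ->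
    \int[mm]_z g z = \int[m1]_x \int[m2]_y g (x, y).
  move=> gi; have Fi := integrable_fubini_F gi.
  rewrite /Rintegral; congr fine.
  rewrite -[LHS](integral12_prod_meas1 gi); apply: ae_eq_integral => //.
  - exact: measurable_int Fi.
  - apply/measurable_EFinP; apply: measurableT_comp => //.
    exact: measurable_int Fi.
  - have [N [mN N0 sN]] := integrable_ae measurableT Fi.
    exists N; split => // x /= nx; apply: sN => /= h; apply: nx => _.
    by rewrite /= fineK//; exact: h.
by apply: complex_ext; [exact: h f1|exact: h f2].
Qed.

Lemma integrable_fubini_G_swap (g : T1 * T2 -> \bar R) :
  mm.-integrable setT g -> m2.-integrable setT (fubini_G m1 g).
Proof.
move=> gi; have mg := measurable_int _ gi.
have mg' : measurable_fun setT (fun z : T2 * T1 => g (z.2, z.1)).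
  apply: (measurableT_comp (f := g)) => //.
  by apply: measurable_fun_pair; [exact: measurable_snd|exact: measurable_fst].
apply: (@integrable_fubini_F _ _ _ _ _ m2 m1 (fun z : T2 * T1 => g (z.2, z.1))).
apply: ((integrable12ltyP m2 m1 mg').2).
exact: ((integrable21ltyP m1 m2 mg).1 gi).
Qed.

Lemma cintegrable_fubini2 f : cintegrable mm f ->
  cintegrable m2 (fun y => cintegral m1 (fun x => f (x, y))).
Proof.
move=> [f1 f2].
have h (g : T1 * T2 -> R) : mm.-integrable setT (EFin \o g) ->
    m2.-integrable setT (fun y => (\int[m1]_x g (x, y))%:E).
  move=> gi; have Gi := integrable_fubini_G_swap gi.
  apply: le_integrable (Gi) => //.
    apply/measurable_EFinP; apply: measurableT_comp => //.
    exact: measurable_int Gi.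
  by move=> x _; exact: fine_abse_le.
by split; [exact: h f1|exact: h f2].
Qed.

Lemma cintegral_fubini2 f : cintegrable mm f ->
  cintegral mm f = cintegral m2 (fun y => cintegral m1 (fun x => f (x, y))).
Proof.
move=> [f1 f2].
have h (g : T1 * T2 -> R) : mm.-integrable setT (EFin \o g) ->
    \int[mm]_z g z = \int[m2]_y \int[m1]_x g (x, y).
  move=> gi; have Gi := integrable_fubini_G_swap gi.
  rewrite /Rintegral; congr fine.
  rewrite -[LHS](integral21_prod_meas1 gi); apply: ae_eq_integral => //.
  - exact: measurable_int Gi.
  - apply/measurable_EFinP; apply: measurableT_comp => //.
    exact: measurable_int Gi.
  - have [N [mN N0 sN]] := integrable_ae measurableT Gi.
    exists N; split => // x /= nx; apply: sN => /= hx; apply: nx => _.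
    by rewrite /= fineK//; exact: hx.
by apply: complex_ext; [exact: h f1|exact: h f2].
Qed.

End cfubini.

(** * Topology against measurability *)

Section network.
Context d (T : measurableType d) {R : realType}.

(** A countable family of measurable sets refining every neighbourhood: what is
    needed for open sets to be measurable, and stable under products. *)
Definition measurable_network (nb : T -> set_system T) :=
  exists (I : countType) (B : I -> set T), (forall i, measurable (B i)) /\
    forall x U, nb x U -> exists2 i, B i x & B i `<=` U.

Lemma network_measurable nb (U : set T) : measurable_network nb ->
  (forall x, U x -> nb x U) -> measurable U.
Proof.
move=> [I [B [mB nB]]] Uo.
rewrite (_ : U = \bigcup_i (if `[< B i `<=` U >] then B i else set0)).
  apply: countable_bigcupT_measurable; first exact: countableP.
  by move=> i; case: asboolP.
apply/seteqP; split=> [x Ux|x [i _]].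
  have [i Bx BU] := nB x U (Uo _ Ux).
  by exists i => //; case: asboolP.
by case: asboolP => // BU; exact: BU.
Qed.

Lemma lsc_measurable nb (f : T -> \bar R) : measurable_network nb ->
  (forall x (a : R), (a%:E < f x)%E -> nb x [set y | (a%:E < f y)%E]) ->
  measurable_fun setT f.
Proof.
move=> ntw lsc; apply: (measurability _ (ErealGenOInfty.measurableE R)).
move=> _ [_ [a [-> <-]]]; rewrite setTI.
apply: (network_measurable ntw) => x /=; rewrite in_itv/= andbT => ax.
have := lsc _ _ ax; congr (nb x).
by apply/seteqP; split => y /=; rewrite in_itv/= andbT.
Qed.

Lemma continuous_network_measurable nb (f : T -> R) : measurable_network nb ->
  (forall x, Filter (nb x)) -> (forall x, f @ nb x --> f x) ->
  measurable_fun setT f.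
Proof.
move=> ntw Fnb cf; apply/measurable_EFinP; apply: (lsc_measurable ntw) => x a.
rewrite /= lte_fin => ax.
have h : nb x [set t | a < f t] :=
  @cvgr_gt R T (nb x) _ f (f x) (cf x) a ax.
by apply: filterS (h (Fnb x)) => y /=; rewrite lte_fin.
Qed.

End network.

Section rvec_network.
Context {R : realType}.

Lemma rvec_coord_le n (u : 'rV[R]_n) i : `|u ord0 i| <= `|u|.
Proof.
rewrite [leRHS]/Num.norm /= mx_normrE; apply/bigmax_geP; right => /=.
by exists (ord0, i).
Qed.

Lemma rvec_norm_lt n (u : 'rV[R]_n) e :
  0 < e -> (forall i, `|u ord0 i| < e) -> `|u| < e.
Proof.
move=> e0 ue; rewrite [ltLHS]/Num.norm /= mx_normrE; apply/bigmax_ltP; split=> // -[i j] _ /=.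
by rewrite ord1.
Qed.

Lemma rvec_norm_le n (u : 'rV[R]_n) e :
  0 <= e -> (forall i, `|u ord0 i| <= e) -> `|u| <= e.
Proof.
move=> e0 ue; rewrite [leLHS]/Num.norm /= mx_normrE; apply/bigmax_leP; split=> // -[i j] _ /=.
by rewrite ord1.
Qed.

Definition dyadic_cell n (k : nat * 'rV[int]_n) : set 'rV[R]_n :=
  [set u | forall i, ((k.2 ord0 i)%:~R <= u ord0 i * k.1.+1%:R) /\
                     (u ord0 i * k.1.+1%:R < (k.2 ord0 i)%:~R + 1)].

Lemma measurable_dyadic_cell n k : measurable (@dyadic_cell n k).
Proof.
rewrite (_ : dyadic_cell k = \bigcap_(i in [set: 'I_n])
   ((fun u => u ord0 i * k.1.+1%:R : measurableTypeR R) @^-1`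
     `[(k.2 ord0 i)%:~R, (k.2 ord0 i)%:~R + 1[%classic)); last first.
  apply/seteqP; split => u /= cu i; last first.
    by have := cu i Logic.I; rewrite /= in_itv => /andP[].
  by move=> _; rewrite /= in_itv; apply/andP; exact: cu.
apply: fin_bigcap_measurable => // i _; apply: measurable_preimageT => //.
by apply: measurable_funM; [exact: measurable_coord|exact: measurable_cst].
Qed.

Lemma rvec_network n : measurable_network (fun u : 'rV[R]_n => nbhs u).
Proof.
exists (nat * 'rV[int]_n)%type, (@dyadic_cell n); split.
  by move=> k; exact: measurable_dyadic_cell.
move=> u U /nbhs_ballP[e /= e0 eU].
have [k ke] : exists k : nat, (k.+1%:R)^-1 < e.
  have [k _ /(_ k (leqnn k))] := near_infty_natSinv_lt (PosNum e0).
  by exists k.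
have k0 : 0 < k.+1%:R :> R by [].
exists (k, \row_i Num.floor (u ord0 i * k.+1%:R)).
  by move=> i; rewrite /= mxE; split; [exact: floor_le|rewrite -intrD1; exact: floorD1_gt].
move=> v vk; apply: eU; rewrite -ball_normE /=; apply: le_lt_trans ke.
apply: rvec_norm_le => [|i]; first by rewrite invr_ge0 ltW.
have [v1 v2] := vk i; rewrite /= mxE in v1 v2.
have u1 := floor_le (u ord0 i * k.+1%:R).
have u2 := floorD1_gt (u ord0 i * k.+1%:R); rewrite intrD1 in u2.
rewrite !mxE -[leRHS]mul1r ler_pdivlMr// -[X in _ * X <= _](ger0_norm (ltW k0)).
rewrite -normrM mulrBl ler_norml; apply/andP; split; lra.
Qed.

End rvec_network.

Lemma prod_network d1 d2 (T1 : measurableType d1) (T2 : measurableType d2)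
    (nb1 : T1 -> set_system T1) (nb2 : T2 -> set_system T2) :
  measurable_network nb1 -> measurable_network nb2 ->
  measurable_network (fun x : T1 * T2 => filter_prod (nb1 x.1) (nb2 x.2)).
Proof.
move=> [I1 [B1 [mB1 nB1]]] [I2 [B2 [mB2 nB2]]].
exists (I1 * I2)%type, (fun i => B1 i.1 `*` B2 i.2); split.
  by move=> i; exact: measurableX.
move=> x U [[A1 A2] /= [xA1 xA2] AU].
have [i1 Bi1 BA1] := nB1 _ _ xA1; have [i2 Bi2 BA2] := nB2 _ _ xA2.
by exists (i1, i2) => //= y [y1 y2]; apply: AU; split; [exact: BA1|exact: BA2].
Qed.

Section phase_network.
Context {R : realType} {n : nat}.
Local Notation phase := ('rV[R]_n * 'rV[R]_n)%type.

Lemma phase_network : measurable_network (fun X : phase => nbhs X).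
Proof. exact: (prod_network (@rvec_network R n) (@rvec_network R n)). Qed.

Lemma phase2_network : measurable_network (fun X : phase * phase => nbhs X).
Proof. exact: (prod_network phase_network phase_network). Qed.

Lemma continuous_phase_measurable (f : phase -> R) :
  continuous f -> measurable_fun setT f.
Proof. by move=> cf; exact: (continuous_network_measurable phase_network). Qed.

Lemma continuous_phase2_measurable (f : phase * phase -> R) :
  continuous f -> measurable_fun setT f.
Proof. by move=> cf; exact: (continuous_network_measurable phase2_network). Qed.

End phase_network.

(** * Holomorphic functions on phase space and their Gaussian means *)

Section epsilon_derivative.
Context {R : realType}.

Lemma is_derive_dist (V : normedModType R) (v : V) (f : V -> R) (x : V) (l : R) :
  is_derive x v f l -> forall e : R, 0 < e -> exists2 d : R, 0 < d &
    forall t, `|t| < d -> `|f (t *: v + x) - f x - t * l| <= e * `|t|.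
Proof.
move=> [df <-] e e0.
have /cvgrPdist_lt/(_ _ e0)[d /= d0 dP] := df.
exists d => // t td; have [->|t0] := eqVneq t 0.
  by rewrite scale0r add0r subrr mul0r subr0 normr0 mulr0.
have := dP t; rewrite /= sub0r normrN => /(_ td t0) /ltW h.
rewrite -(ler_pM2r (_ : 0 < `|t|)) ?normr_gt0// -normrM in h.
apply: le_trans h; rewrite le_eqVlt -normrN; apply/orP; left; apply/eqP.
congr (`|_|); rewrite /GRing.scale /= /derive /GRing.scale /=.
by rewrite mulrBl mulrAC mulVf// mul1r opprB mulrC.
Qed.

Lemma dist_is_derive (V : normedModType R) (v : V) (f : V -> R) (x : V) (l : R) :
  (forall e : R, 0 < e -> exists2 d : R, 0 < d &
    forall t, `|t| < d -> `|f (t *: v + x) - f x - t * l| <= e * `|t|) ->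
  is_derive x v f l.
Proof.
move=> H.
have cv : (fun t : R => t^-1 *: (f (t *: v + x) - f x)) @ 0^' --> l.
  apply/cvgrPdist_le => e e0; have [d d0 dP] := H _ e0.
  exists d => // t; rewrite /= sub0r normrN => td t0.
  rewrite -(ler_pM2r (_ : 0 < `|t|)) ?normr_gt0// -normrM.
  apply: le_trans (dP t td); rewrite le_eqVlt -normrN; apply/orP; left; apply/eqP.
  congr (`|_|); rewrite /GRing.scale /=.
  by rewrite mulrBl opprB mulrAC mulVf// mul1r [l * t]mulrC.
split; first by apply/cvg_ex; exists l.
exact: cvg_lim cv.
Qed.

Lemma expR_dist (e : R) : 0 < e -> exists2 d : R, 0 < d &
  forall t, `|t| < d -> `|expR t - 1 - t| <= e * `|t|.
Proof.
move=> e0; have [d d0 dP] := is_derive_dist (is_derive_expR (0 : R)) e0.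
exists d => // t /dP; rewrite expR0 mulr1 addr0 [t *: _]mulr1.
by [].
Qed.

Lemma expi_dist (e : R) : 0 < e -> exists2 d : R, 0 < d &
  forall t, `|t| < d -> normc (expi t - 1 - (0 +i* t)) <= e * `|t|.
Proof.
move=> e0; have e20 : 0 < e / 2 by rewrite divr_gt0.
have [d d0 dP] := is_derive_dist (is_derive_sin (0 : R)) e20.
have [d' d'0 dP'] := is_derive_dist (is_derive_cos (0 : R)) e20.
exists (Num.min d d'); first by rewrite lt_min d0.
move=> t; rewrite lt_min => /andP[/dP h /dP' h'].
rewrite cos0 mulr1 addr0 [t *: _]mulr1 sin0 subr0 in h.
rewrite sin0 oppr0 cos0 mulr0 addr0 subr0 [t *: _]mulr1 in h'.
apply: le_trans (normc_le_ReIm _) _; rewrite /= !subr0.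
by rewrite [e]splitr mulrDl lerD.
Qed.

Lemma cexp_dist (e : R) : 0 < e -> exists2 d : R, 0 < d &
  forall w : R[i], normc w < d -> normc (cexp w - 1 - w) <= e * normc w.
Proof.
move=> e0; pose e' := Num.min 1 (e / 8).
have e'0 : 0 < e' by rewrite lt_min ltr01 divr_gt0.
have e'1 : e' <= 1 by rewrite ge_min lexx.
have e'e : e' <= e / 8 by rewrite ge_min lexx orbT.
clearbody e'.
have [d1 d10 dP1] := expR_dist e'0.
have [d2 d20 dP2] := expi_dist e'0.
exists (Num.min e' (Num.min d1 d2)); first by rewrite !lt_min e'0 d10.
move=> [x y]; set w := x +i* y; rewrite !lt_min => /and3P[we w1 w2].
have xw : `|x| <= normc w := Re_le_normc w.
have yw : `|y| <= normc w := Im_le_normc w.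
have h1 := dP1 _ (le_lt_trans xw w1).
have h2 := dP2 _ (le_lt_trans yw w2).
have h3 : `|expR x - 1| <= 2 * `|x|.
  rewrite -[_ - 1](subrK x); apply: le_trans (ler_normD _ _) _.
  by have := normr_ge0 x; nra.
have h4 : normc (expi y - 1) <= 2 * `|y|.
  rewrite -[_ - 1](subrK (0 +i* y)); apply: le_trans (le_normcD _ _) _.
  have -> : normc (0 +i* y) = `|y| by rewrite /normc /= expr0n /= add0r sqrtr_sqr.
  by have := normr_ge0 y; nra.
have -> : cexp w - 1 - w = (expR x - 1 - x)%:C + (expR x - 1)%:C * (expi y - 1)
   + (expi y - 1 - (0 +i* y)).
  by apply: complex_ext; rewrite /cexp /expi /w /= ; ring.
apply: le_trans (le_normcD _ _) _.
apply: le_trans (lerD (le_normcD _ _) (lexx _)) _.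
rewrite normcM !normcR.
have h5 : `|expR x - 1| * normc (expi y - 1) <= (2 * `|x|) * (2 * `|y|).
  by apply: ler_pM => //; exact: normc_ge0.
have x0 := normr_ge0 x; have y0 := normr_ge0 y.
have h6 : `|x| * `|y| <= normc w * e' by apply: ler_pM => //; apply: le_trans yw (ltW we).
have h7 : e' * `|x| <= e' * normc w by rewrite ler_pM2l.
have h8 : e' * `|y| <= e' * normc w by rewrite ler_pM2l.
have h9 : e' * normc w <= e / 8 * normc w by rewrite ler_wpM2r ?normc_ge0.
have h10 : e / 8 * 6 * normc w <= e * normc w.
  by rewrite ler_wpM2r ?normc_ge0//; lra.
nra.
Qed.

(** Strict differentiability of the complex exponential. *)
Lemma cexp_strict (c : R[i]) (e : R) : 0 < e -> exists2 d : R, 0 < d &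
  forall a b, normc (a - c) < d -> normc (b - c) < d ->
    normc (cexp a - cexp b - cexp c * (a - b)) <= e * normc (a - b).
Proof.
move=> e0; pose M := normc (cexp c).
have M0 : 0 < M by rewrite /M normc_cexp expR_gt0.
pose e' := Num.min 1 (e / (8 * M)).
have M8 : 0 < 8 * M by rewrite mulr_gt0.
have e'0 : 0 < e' by rewrite lt_min ltr01 divr_gt0.
have e'1 : e' <= 1 by rewrite ge_min lexx.
have e'e : M * e' <= e / 8.
  have : e' <= e / (8 * M) by rewrite ge_min lexx orbT.
  rewrite ler_pdivlMr// => h; lra.
clearbody e'.
have [d d0 dP] := cexp_dist e'0.
exists (Num.min (d / 2) (e' / 2)); first by rewrite lt_min !divr_gt0.
move=> a b; rewrite !lt_min => /andP[ad ae] /andP[bd be].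
have abd : normc (a - b) < d.
  rewrite (_ : a - b = (a - c) - (b - c)); last by ring.
  by apply: le_lt_trans (le_normcB _ _) _; lra.
have hab := dP _ abd.
have hbc := dP (b - c) (lt_trans bd _).
have {hbc} hbc : normc (cexp (b - c) - 1) <= 2 * normc (b - c).
  rewrite -[_ - 1](subrK (b - c)); apply: le_trans (le_normcD _ _) _.
  have := hbc ltac:(lra); have := normc_ge0 (b - c); nra.
have {}hbc : normc (cexp (b - c) - 1) <= e' by lra.
have Eb : cexp b = cexp c * cexp (b - c) by rewrite -cexpD addrC subrK.
have Ea : cexp a = cexp c * cexp (b - c) * cexp (a - b).
  by rewrite -Eb -cexpD addrC subrK.
have -> : cexp a - cexp b - cexp c * (a - b) =
   cexp c * ((cexp (a - b) - 1 - (a - b))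
     + (cexp (b - c) - 1) * (cexp (a - b) - 1 - (a - b))
     + (cexp (b - c) - 1) * (a - b)).
  by rewrite Ea Eb; ring.
rewrite normcM -/M.
set A := normc (a - b) in hab *; have A0 : 0 <= A := normc_ge0 _.
set P := cexp (a - b) - 1 - (a - b) in hab *; set Q := cexp (b - c) - 1 in hbc *.
have : normc (P + Q * P + Q * (a - b)) <= 3 * e' * A.
  apply: le_trans (le_normcD _ _) _; rewrite normcM -/A.
  apply: le_trans (lerD (le_normcD _ _) (lexx _)) _; rewrite normcM.
  have := normc_ge0 P; have := normc_ge0 Q; nra.
move=> /(ler_wpM2l (ltW M0))/le_trans; apply.
rewrite !mulrA; apply: ler_wpM2r => //; lra.
Qed.

End epsilon_derivative.

Section holo.
Context {R : realType} {n : nat}.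
Local Notation phase := ('rV[R]_n * 'rV[R]_n)%type.
Implicit Types (X Y T : phase) (H : phase -> R[i]).

Lemma phase_ext X Y : (forall i, X.1 ord0 i = Y.1 ord0 i) ->
  (forall i, X.2 ord0 i = Y.2 ord0 i) -> X = Y.
Proof.
by case: X => a b; case: Y => c d /= h1 h2; congr pair; apply/rowP.
Qed.

Lemma cscaleDl (z w : R[i]) X : cscale (z + w) X = cscale z X + cscale w X.
Proof.
by apply: phase_ext => i; rewrite /cscale ReD ImD /= !mxE; ring.
Qed.

Lemma cscaleDr (z : R[i]) X Y : cscale z (X + Y) = cscale z X + cscale z Y.
Proof.
by apply: phase_ext => i; rewrite /cscale /= !mxE; ring.
Qed.

Lemma cscaleN (z : R[i]) X : cscale (- z) X = - cscale z X.
Proof.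
by apply: phase_ext => i; rewrite /cscale ReN ImN /= !mxE; ring.
Qed.

Lemma cscaleA (z w : R[i]) X : cscale (z * w) X = cscale z (cscale w X).
Proof.
by apply: phase_ext => i; rewrite /cscale ReM ImM /= !mxE; ring.
Qed.

Lemma cscale1 X : cscale 1 X = X.
Proof.
by apply: phase_ext => i; rewrite /cscale /= !mxE; ring.
Qed.

Lemma cscale0 (z : R[i]) : cscale z (0 : phase) = 0.
Proof.
by apply: phase_ext => i; rewrite /cscale /= !mxE; ring.
Qed.

Lemma norm_cscale (z : R[i]) X : `|cscale z X| <= 2 * normc z * `|X|.
Proof.
have h (a b : R) (u v : 'rV[R]_n) : `|a| <= normc z -> `|b| <= normc z ->
    `|u| <= `|X| -> `|v| <= `|X| -> `|a *: u + b *: v| <= 2 * normc z * `|X|.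
  move=> az bz uX vX; apply: le_trans (ler_normD _ _) _; rewrite !normrZ.
  rewrite mulr_natl mulr2n mulrDl.
  by apply: lerD; apply: ler_pM.
have X1 : `|X.1| <= `|X| by rewrite prod_normE le_max lexx.
have X2 : `|X.2| <= `|X| by rewrite prod_normE le_max lexx orbT.
rewrite [leLHS]prod_normE ge_max; apply/andP; split => /=.
  rewrite -scaleNr; apply: h => //; rewrite ?normrN;
    [exact: Re_le_normc|exact: Im_le_normc].
by apply: h => //; [exact: Im_le_normc|exact: Re_le_normc].
Qed.

Lemma measurable_cscale (z : R[i]) : measurable_fun setT (cscale z : phase -> phase).
Proof.
apply: measurable_fun_pair; apply: measurable_rvecD.
- exact: measurable_rvecZ.
- by apply: measurable_rvecN; exact: measurable_rvecZ.
- exact: measurable_rvecZ.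
- exact: measurable_rvecZ.
Qed.

Definition clinear (L : phase -> R[i]) :=
  [/\ forall X Y, L (X + Y) = L X + L Y,
      forall z X, L (cscale z X) = z * L X &
      exists2 C : R, 0 <= C & forall X, normc (L X) <= C * `|X|].

Lemma clinearB L X Y : clinear L -> L (X - Y) = L X - L Y.
Proof.
move=> [LD LZ _]; rewrite LD; congr (_ + _).
by rewrite -[Y in LHS]cscale1 -cscaleN LZ mulN1r.
Qed.

(** Strict differentiability, with a complex-linear derivative: strictness makes
    the linear approximation uniform near each point, so that no continuity of
    the derivative is needed to integrate it over a compact set. *)
Definition holo H := forall X0, exists2 L, clinear L &
  forall e : R, 0 < e -> exists2 d : R, 0 < d &
    forall X Y, `|X - X0| < d -> `|Y - X0| < d ->
      normc (H X - H Y - L (X - Y)) <= e * `|X - Y|.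

Lemma holo_lip H X0 : holo H -> exists2 d : R, 0 < d & exists2 C : R, 0 < C &
  forall X Y, `|X - X0| < d -> `|Y - X0| < d ->
    normc (H X - H Y) <= C * `|X - Y|.
Proof.
move=> /(_ X0)[L Llin /(_ _ ltr01)[d d0 dP]].
have [_ _ [C C0 LC]] := Llin.
exists d => //; exists (1 + C); first by rewrite ltr_wpDr.
move=> X Y Xd Yd; rewrite -[_ - _](subrK (L (X - Y))).
apply: le_trans (le_normcD _ _) _; rewrite mulrDl; apply: lerD => //.
exact: dP.
Qed.

Lemma holo_dist H X0 : holo H -> forall e : R, 0 < e ->
  exists2 d : R, 0 < d & forall X, `|X - X0| < d -> normc (H X - H X0) < e.
Proof.
move=> hH e e0; have [d d0 [C C0 dP]] := holo_lip X0 hH.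
exists (Num.min d (e / C)); first by rewrite lt_min d0 divr_gt0.
move=> X; rewrite lt_min => /andP[Xd Xe].
apply: le_lt_trans (dP _ _ Xd _) _; first by rewrite subrr normr0.
by rewrite mulrC -ltr_pdivlMr.
Qed.

Lemma holo_continuous H : holo H ->
  continuous (fun X => complex.Re (H X)) /\ continuous (fun X => complex.Im (H X)).
Proof.
move=> hH; split => X0; apply/cvgrPdist_lt => e e0;
  have [d d0 dP] := holo_dist X0 hH e0; near=> X.
  rewrite -ReN -ReD; apply: le_lt_trans (Re_le_normc _) _.
  rewrite normcB; apply: dP; rewrite distrC; near: X.
  by apply: (@cvgr_dist_lt _ phase).
rewrite -ImN -ImD; apply: le_lt_trans (Im_le_normc _) _.
rewrite normcB; apply: dP; rewrite distrC; near: X.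
by apply: (@cvgr_dist_lt _ phase).
Unshelve. all: by end_near. Qed.

Lemma holo_cmeasurable H : holo H -> cmeasurable H.
Proof.
by move=> /holo_continuous[cr ci]; split; exact: continuous_phase_measurable.
Qed.

Lemma holo_mul H H' : holo H -> holo H' -> holo (fun X => H X * H' X).
Proof.
move=> hH hH' X0.
have [L Llin LP] := hH X0; have [L' Llin' LP'] := hH' X0.
exists (fun T => L T * H' X0 + H X0 * L' T).
  have [LD LZ [C C0 LC]] := Llin; have [LD' LZ' [C' C'0 LC']] := Llin'.
  split=> [X Y|z X|]; first by rewrite LD LD'; ring.
    by rewrite LZ LZ'; ring.
  exists (C * normc (H' X0) + normc (H X0) * C').
    by rewrite addr_ge0// mulr_ge0// normc_ge0.
  move=> X; apply: le_trans (le_normcD _ _) _; rewrite !normcM mulrDl; apply: lerD.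
    by rewrite mulrAC ler_wpM2r ?normc_ge0.
  by rewrite -mulrA ler_wpM2l ?normc_ge0.
move=> e e0.
have [dc dc0 [K K0 KP]] := holo_lip X0 hH.
have [dc' dc'0 [K' K'0 KP']] := holo_lip X0 hH'.
pose M := normc (H X0) + normc (H' X0) + K + K' + 2.
have nH := normc_ge0 (H X0); have nH' := normc_ge0 (H' X0).
have [M0 HM HM' KM KM'] : [/\ 1 < M, normc (H X0) <= M, normc (H' X0) <= M,
  K <= M & K' <= M] by rewrite /M; split; lra.
pose e' := Num.min 1 (e / (8 * M)).
have M8 : 0 < 8 * M by lra.
have e'0 : 0 < e' by rewrite lt_min ltr01 divr_gt0.
have e'1 : e' <= 1 by rewrite ge_min lexx.
have e'e : M * e' <= e / 8.
  have : e' <= e / (8 * M) by rewrite ge_min lexx orbT.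
  rewrite ler_pdivlMr// => h; lra.
clearbody e'.
have [d1 d10 P1] := LP _ e'0; have [d2 d20 P2] := LP' _ e'0.
have [d3 d30 P3] := holo_dist X0 hH e'0.
have [d4 d40 P4] := holo_dist X0 hH' e'0.
exists (Num.min (Num.min dc dc') (Num.min (Num.min d1 d2) (Num.min d3 d4))).
  by rewrite !lt_min dc0 dc'0 d10 d20 d30 d40.
move=> X Y; rewrite !lt_min => /and3P[/andP[Xc Xc'] /andP[X1 X2] /andP[X3 X4]].
move=> /and3P[/andP[Yc Yc'] /andP[Y1 Y2] /andP[Y3 Y4]].
have h1 := P1 _ _ X1 Y1; have h2 := P2 _ _ X2 Y2.
have h3 := P3 _ X3; have h3' := P3 _ Y3.
have h4 := P4 _ X4; have h4' := P4 _ Y4.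
have hc := KP _ _ Xc Yc.
set A := `|X - Y| in h1 h2 hc *; have A0 : 0 <= A := normr_ge0 _.
have hc' := KP' _ _ Xc' Yc'.
rewrite -/A in hc'.
have -> : H X * H' X - H Y * H' Y - (L (X - Y) * H' X0 + H X0 * L' (X - Y)) =
  (H X - H Y - L (X - Y)) * H' X0 + (H X - H Y) * (H' X - H' X0)
  + (H X0 * (H' X - H' Y - L' (X - Y)) + (H Y - H X0) * (H' X - H' Y)) by ring.
have b1 : normc ((H X - H Y - L (X - Y)) * H' X0) <= e' * A * M.
  by rewrite normcM; apply: ler_pM => //; exact: normc_ge0.
have b2 : normc ((H X - H Y) * (H' X - H' X0)) <= M * A * e'.
  rewrite normcM; apply: ler_pM; rewrite ?normc_ge0//; last exact: ltW.
  by apply: le_trans hc _; rewrite ler_wpM2r.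
have b3 : normc (H X0 * (H' X - H' Y - L' (X - Y))) <= M * (e' * A).
  by rewrite normcM; apply: ler_pM => //; exact: normc_ge0.
have b4 : normc ((H Y - H X0) * (H' X - H' Y)) <= e' * (M * A).
  rewrite normcM; apply: ler_pM; rewrite ?normc_ge0//; first exact: ltW.
  by apply: le_trans hc' _; rewrite ler_wpM2r.
apply: le_trans (le_normcD _ _) _.
apply: le_trans (lerD (le_normcD _ _) (le_normcD _ _)) _.
have : e / 2 * A <= e * A by rewrite ler_wpM2r//; lra.
have : M * e' * A <= e / 8 * A by rewrite ler_wpM2r.
lra.
Qed.

Lemma holo_add H H' : holo H -> holo H' -> holo (fun X => H X + H' X).
Proof.
move=> hH hH' X0; have [L [LD LZ [C C0 LC]] LP] := hH X0.
have [L' [LD' LZ' [C' C'0 LC']] LP'] := hH' X0.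
exists (fun T => L T + L' T).
  split=> [X Y|z X|]; first by rewrite LD LD'; ring.
    by rewrite LZ LZ'; ring.
  exists (C + C') => [|X]; first exact: addr_ge0.
  by apply: le_trans (le_normcD _ _) _; rewrite mulrDl lerD.
move=> e e0; have e20 : 0 < e / 2 by rewrite divr_gt0.
have [d d0 dP] := LP _ e20; have [d' d'0 dP'] := LP' _ e20.
exists (Num.min d d'); first by rewrite lt_min d0.
move=> X Y; rewrite !lt_min => /andP[X1 X2] /andP[Y1 Y2].
rewrite (_ : _ - _ - _ = (H X - H Y - L (X - Y)) + (H' X - H' Y - L' (X - Y))); last by ring.
apply: le_trans (le_normcD _ _) _; rewrite [e]splitr mulrDl.
by apply: lerD; [exact: dP|exact: dP'].
Qed.

Lemma holo_clinear L : clinear L -> holo L.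
Proof.
move=> Llin X0; exists L => // e e0; exists 1 => // X Y _ _.
by rewrite clinearB// subrr normc0 mulr_ge0// ltW.
Qed.

Lemma holo_cst (a : R[i]) : holo (fun=> a).
Proof.
move=> X0; exists (fun=> 0).
  split=> [X Y|z X|]; rewrite ?addr0 ?mulr0//.
  by exists 0 => // X; rewrite normc0 mul0r.
move=> e e0; exists 1 => // X Y _ _.
by rewrite subrr subr0 normc0 mulr_ge0// ltW.
Qed.

Lemma holo_exp H : holo H -> holo (fun X => cexp (H X)).
Proof.
move=> hH X0; have [L [LD LZ [C C0 LC]] LP] := hH X0; set c := H X0.
exists (fun T => cexp c * L T).
  split=> [X Y|z X|]; first by rewrite LD mulrDr.
    by rewrite LZ mulrCA.
  exists (normc (cexp c) * C); first by rewrite mulr_ge0 ?normc_ge0.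
  by move=> X; rewrite normcM -mulrA ler_wpM2l ?normc_ge0.
move=> e e0; have [d0 d00 [K K0 KP]] := holo_lip X0 hH.
have M0 : 0 < normc (cexp c) by rewrite normc_cexp expR_gt0.
set M := normc (cexp c) in M0 *.
have e1 : 0 < e / (2 * K) by rewrite divr_gt0// mulr_gt0.
have e2 : 0 < e / (2 * M) by rewrite divr_gt0// mulr_gt0.
have [d1 d10 P1] := cexp_strict c e1; have [d2 d20 P2] := LP _ e2.
have [d3 d30 P3] := holo_dist X0 hH d10.
exists (Num.min d0 (Num.min d2 d3)); first by rewrite !lt_min d00 d20.
move=> X Y; rewrite !lt_min => /and3P[X1 X2 X3] /and3P[Y1 Y2 Y3].
have h1 := P1 _ _ (P3 _ X3) (P3 _ Y3); have h2 := P2 _ _ X2 Y2.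
have h3 := KP _ _ X1 Y1.
rewrite (_ : _ - _ - _ = (cexp (H X) - cexp (H Y) - cexp c * (H X - H Y))
  + cexp c * (H X - H Y - L (X - Y))); last by ring.
apply: le_trans (le_normcD _ _) _; rewrite normcM -/M [e]splitr mulrDl; apply: lerD.
  apply: le_trans h1 _; apply: le_trans (ler_wpM2l (ltW e1) h3) _.
  by rewrite mulrA le_eqVlt; apply/orP; left; apply/eqP; congr (_ * _); field; rewrite gt_eqF.
apply: le_trans (ler_wpM2l (ltW M0) h2) _.
by rewrite mulrA le_eqVlt; apply/orP; left; apply/eqP; congr (_ * _); field; rewrite gt_eqF.
Qed.

Lemma holo_cexp L (a : R[i]) : clinear L -> holo (fun X => cexp (a + L X)).
Proof.
move=> Llin; apply: holo_exp; apply: holo_add; first exact: holo_cst.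
exact: holo_clinear.
Qed.

Lemma holo_shift H P : holo H -> holo (fun X => H (X + P)).
Proof.
move=> hH X0; have [L Llin LP] := hH (X0 + P); exists L => // e /LP[d d0 dP].
have E A B : A + P - (B + P) = A - B by rewrite opprD addrACA subrr addr0.
exists d => // X Y Xd Yd; have := dP (X + P) (Y + P).
by rewrite !E; exact.
Qed.

End holo.

Section mean_value.
Context {R : realType} {n : nat}.
Local Notation phase := ('rV[R]_n * 'rV[R]_n)%type.
Local Notation pm := (@phase_measure R n).
Implicit Types (X Y T : phase) (H : phase -> R[i]).

Lemma cscaleBr (z : R[i]) X Y : cscale z (X - Y) = cscale z X - cscale z Y.
Proof. by apply: phase_ext => i; rewrite /cscale /= !mxE; ring. Qed.

Lemma compact_phase_box (K : R) : compact [set T : phase | `|T| <= K].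
Proof.
have cK : compact [set v : 'rV[R]_n | forall i, `[- K, K]%classic (v ord0 i)].
  by apply: (@rV_compact R n (fun=> `[- K, K]%classic)) => i; exact: segment_compact.
have [K0|K0] := ltP K 0.
  have -> : [set T : phase | `|T| <= K] = set0; last exact: compact0.
  by rewrite -subset0 => T /=; apply/negP; rewrite -ltNge (lt_le_trans K0).
have -> : [set T : phase | `|T| <= K] =
  [set v : 'rV[R]_n | forall i, `[- K, K]%classic (v ord0 i)] `*`
  [set v : 'rV[R]_n | forall i, `[- K, K]%classic (v ord0 i)]; last exact: compact_setX.
apply/seteqP; split => -[x y] /=; rewrite prod_normE /= ge_max.
  move=> /andP[xK yK]; split => i; rewrite /= in_itv /= -ler_norml.
    exact: le_trans (rvec_coord_le _ _) xK.
  exact: le_trans (rvec_coord_le _ _) yK.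
move=> [xK yK]; apply/andP; split; apply: rvec_norm_le => // i.
  by have := xK i; rewrite /= in_itv /= -ler_norml.
by have := yK i; rewrite /= in_itv /= -ler_norml.
Qed.

(** Compactness turns a bound near each point of the box into a uniform one. *)
Lemma phase_box_uniform (K : R) (P : R -> phase -> Prop) :
  (forall T0, `|T0| <= K -> exists2 r : R, 0 < r &
     forall T t, `|T - T0| < r -> `|t| < r -> P t T) ->
  exists2 r : R, 0 < r & forall t T, `|t| < r -> `|T| <= K -> P t T.
Proof.
move=> H.
have := (compact_near_coveringP [set T : phase | `|T| <= K]).1 (@compact_phase_box K).
move=> /(_ R (nbhs (0 : R)) P _) [].
  move=> T0 /H[r r0 rP]; exists ([set T | `|T - T0| < r], [set t : R | `|t| < r]).
    split => /=.
      apply/nbhs_ballP; exists r => //= T; rewrite -ball_normE /= distrC.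
      by [].
    apply/nbhs_ballP; exists r => //= t; rewrite -ball_normE /= sub0r normrN.
    by [].
  by move=> [T t] [/= TT0 tr]; exact: rP.
move=> r /= r0 rP; exists r => // t T tr TK.
by apply: (rP t) => //=; rewrite sub0r normrN.
Qed.

Lemma holo_bounded H (K : R) : holo H -> exists2 M : R, 0 <= M &
  forall T, `|T| <= K -> normc (H T) <= M.
Proof.
move=> hH.
have [[cr ci] ck] := (holo_continuous hH, @compact_phase_box K).
have bd (f : phase -> R) : continuous f ->
    exists2 M, 0 <= M & forall T, `|T| <= K -> `|f T| <= M.
  move=> cf.
  have /compact_bounded : compact (f @` [set T : phase | `|T| <= K]).
    by apply: continuous_compact => //; exact: continuous_subspaceT.
  move=> [M [_ /(_ (`|M| + 1))]].
  rewrite (le_lt_trans (ler_norm M)) ?ltrDl// => /(_ isT) MP.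
  exists (`|M| + 1); first by rewrite addr_ge0.
  by move=> T TK; apply: MP; exists T.
have [M M0 MP] := bd _ cr; have [M' M'0 MP'] := bd _ ci.
exists (M + M'); first by rewrite addr_ge0.
by move=> T TK; apply: le_trans (normc_le_ReIm _) (lerD (MP _ TK) (MP' _ TK)).
Qed.

Definition rotation_invariant (w : phase -> R) :=
  forall (t : R) T, w (cscale (expi t) T) = w T.

Let scl (r : R) T : phase := cscale (expR r)%:C T.

(** Moving radially and moving along the rotation by the same small amount have
    proportional effects on a holomorphic function, with ratio -i. *)
Let cauchy_riemann_increment H (r0 K e : R) : holo H -> 0 < e ->
  exists2 d : R, 0 < d & forall t T, `|t| < d -> `|T| <= K ->
    normc (H (scl (r0 + t) T) - H (scl r0 T) +
      (0 +i* 1) * (H (cscale (expi t) (scl r0 T)) - H (scl r0 T))) <= e * `|t|.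
Proof.
move=> hH e0; apply: phase_box_uniform => T0 T0K.
have [L Llin LP] := hH (scl r0 T0); have [_ LZ [C C0 LC]] := Llin.
pose E := 2 * expR r0.
have E0 : 0 < E by rewrite mulr_gt0 ?expR_gt0.
have sclE T : `|scl r0 T| <= E * `|T|.
  by apply: le_trans (norm_cscale _ _) _; rewrite normcRge0 ?expR_ge0.
have sclB T : `|scl r0 T - scl r0 T0| <= E * `|T - T0|.
  rewrite (_ : scl r0 T - scl r0 T0 = scl r0 (T - T0)); first exact: sclE.
  by rewrite /scl cscaleBr.
pose B := E * (`|T0| + 1).
have B0 : 0 < B by rewrite mulr_gt0// ltr_wpDl.
pose e1 := e / (16 * B).
have e10 : 0 < e1 by rewrite divr_gt0// mulr_gt0.
pose e2 := Num.min 1 (e / (4 * (C * B + 1))).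
have CB : 0 < C * B + 1 by rewrite ltr_wpDl// mulr_ge0// ltW.
have e20 : 0 < e2 by rewrite lt_min ltr01 divr_gt0// mulr_gt0.
have e21 : e2 <= 1 by rewrite ge_min lexx.
have e2e : e2 * (C * B) <= e / 4.
  have : e2 <= e / (4 * (C * B + 1)) by rewrite ge_min lexx orbT.
  by rewrite ler_pdivlMr ?mulr_gt0// => h; nra.
clearbody e2.
have [d d0 dP] := LP _ e10.
have [d1 d10 dP1] := expR_dist e20; have [d2 d20 dP2] := expi_dist e20.
pose r := Num.min (Num.min d1 d2) (Num.min 1 (Num.min (d / (8 * B)) (d / (2 * E)))).
have r_gt0 : 0 < r.
  rewrite !lt_min d10 d20 ltr01 /=; apply/andP.
  by split; apply: divr_gt0 => //; exact: mulr_gt0.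
exists r => // T t TT0.
rewrite !lt_min => /andP[/andP[/dP1 h1 /dP2 h2] /and3P[t1 t2 t3]].
move: TT0; rewrite !lt_min => /andP[_ /and3P[T1 T2 T3]].
set X := scl r0 T.
have XB : `|X| <= B.
  apply: le_trans (sclE _) _; rewrite ler_wpM2l ?(ltW E0)//.
  by rewrite -[T](subrK T0) addrC; apply: le_trans (ler_normD _ _) _;
    rewrite lerD// ltW.
have h3 : normc ((expR t)%:C - 1) <= 2 * `|t|.
  rewrite -rmorphB normcR -[_ - 1](subrK t); apply: le_trans (ler_normD _ _) _.
  by have := normr_ge0 t; nra.
have h4 : normc (expi t - 1) <= 2 * `|t|.
  rewrite -[_ - 1](subrK (0 +i* t)); apply: le_trans (le_normcD _ _) _.
  have -> : normc (0 +i* t) = `|t| by rewrite /normc /= expr0n /= add0r sqrtr_sqr.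
  by have := normr_ge0 t; nra.
have XX0 : `|X - scl r0 T0| < d / 2.
  apply: le_lt_trans (sclB _) _; by move: T3; rewrite ltr_pdivlMr => [?|]; [lra|exact: mulr_gt0].
have inc (z : R[i]) : normc (z - 1) <= 2 * `|t| ->
    `|cscale z X - X| <= 4 * `|t| * B /\ `|cscale z X - scl r0 T0| < d.
  move=> zt; have b : `|cscale z X - X| <= 4 * `|t| * B.
    rewrite -[X in _ - X]cscale1 -cscaleN -cscaleDl.
    apply: le_trans (norm_cscale _ _) _; apply: ler_pM => //.
      by rewrite mulr_ge0// normc_ge0.
    by lra.
  split=> //; rewrite -[_ - scl r0 T0](subrKA X).
  apply: le_lt_trans (ler_normD _ _) _.
  by move: t2; rewrite ltr_pdivlMr => [?|]; [lra|exact: mulr_gt0].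
have [b3 X3] := inc _ h3; have [b4 X4] := inc _ h4.
have X' : `|X - scl r0 T0| < d by apply: lt_trans XX0 _; lra.
have sclD : scl (r0 + t) T = cscale (expR t)%:C X.
  by rewrite /X /scl -cscaleA -rmorphM -expRD addrC.
have h5 := dP _ _ X3 X'; have h6 := dP _ _ X4 X'.
rewrite sclD.
have LE (z : R[i]) : L (cscale z X - X) = (z - 1) * L X.
  by rewrite clinearB// LZ; ring.
rewrite LE in h5; rewrite LE in h6.
set P := _ - _ - _ in h5; set Q := _ - _ - _ in h6.
have ii : (0 +i* 1) * (0 +i* t) = - t%:C :> R[i].
  by apply: complex_ext => /=; ring.
have -> : H (cscale (expR t)%:C X) - H X + (0 +i* 1) * (H (cscale (expi t) X) - H X)
  = P + (0 +i* 1) * Q + ((expR t - 1 - t)%:C * L X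
     + (0 +i* 1) * ((expi t - 1 - (0 +i* t)) * L X)).
  rewrite /P /Q !rmorphB /= mulrBl.
  have -> : (0 +i* 1) * ((expi t - 1 - (0 +i* t)) * L X) =
     (0 +i* 1) * ((expi t - 1) * L X) + t%:C * L X.
     by rewrite mulrBl mulrBr [X in _ - X]mulrA ii; ring.
  by ring.
have ni : normc (0 +i* 1 : R[i]) = 1.
  by rewrite /normc /= expr0n /= expr1n add0r sqrtr1.
apply: le_trans (le_normcD _ _) _.
apply: le_trans (lerD (le_normcD _ _) (le_normcD _ _)) _.
rewrite !normcM ni !mul1r normcR.
have LX : normc (L X) <= C * B by apply: le_trans (LC _) _; rewrite ler_wpM2l.
have a1 : `|expR t - 1 - t| * normc (L X) <= (e2 * `|t|) * (C * B).
  by apply: ler_pM => //; exact: normc_ge0.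
have a2 : normc (expi t - 1 - (0 +i* t)) * normc (L X) <= (e2 * `|t|) * (C * B).
  by apply: ler_pM => //; exact: normc_ge0.
have a3 : normc P <= e1 * (4 * `|t| * B).
  by apply: le_trans h5 _; rewrite ler_wpM2l// ltW.
have a4 : normc Q <= e1 * (4 * `|t| * B).
  by apply: le_trans h6 _; rewrite ler_wpM2l// ltW.
have e1E : e1 * (4 * `|t| * B) = e / 4 * `|t|.
  by rewrite /e1; field; rewrite gt_eqF.
have e2E : (e2 * `|t|) * (C * B) <= e / 4 * `|t|.
  by rewrite mulrAC ler_wpM2r.
by rewrite e1E in a3 a4; lra.
Qed.

Let mean_value_box H (K : R) (w : phase -> R) : 0 <= K -> holo H ->
  measurable_fun setT w -> (forall T, 0 <= w T) -> rotation_invariant w ->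
  pm.-integrable setT (EFin \o w) -> (forall T, K < `|T| -> w T = 0) ->
  cintegral pm (fun T => H T * (w T)%:C) = H 0 * (\int[pm]_T w T)%:C.
Proof.
move=> K0 hH mw w0 wrot iw wK; set W := \int[pm]_T w T.
have W0 : 0 <= W by apply: Rintegral_ge0.
have mH := holo_cmeasurable hH.
have mwc : cmeasurable (fun T => (w T)%:C) by exact: cmeasurableR.
have mscl (z : R[i]) : cmeasurable (fun T => H (cscale z T)).
  exact: cmeasurable_comp mH (measurable_cscale z).
have iwZ (M : R) : pm.-integrable setT (EFin \o (fun T => M * w T)).
  rewrite (_ : _ \o _ = (fun x => M%:E * (w x)%:E)%E)//.
  exact: integrableZl.
have iH (z : R[i]) : cintegrable pm (fun T => H (cscale z T) * (w T)%:C).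
  have [M M0 MP] := holo_bounded (2 * normc z * K) hH.
  apply: (cintegrable_le (g := fun T => M * w T)); [|exact: iwZ|].
    exact: cmeasurableM.
  move=> T; rewrite normcM normcRge0//; have [KT|TK] := ltP K `|T|.
    by rewrite wK// !mulr0.
  apply: ler_wpM2r => //; apply: MP; apply: le_trans (norm_cscale _ _) _.
  by rewrite ler_wpM2l// mulr_ge0// normc_ge0.
pose I r := cintegral pm (fun T => H (scl r T) * (w T)%:C).
have rotI r t : cos t != -1 ->
    cintegral pm (fun T => H (cscale (expi t) (scl r T)) * (w T)%:C) = I r.
  move=> ct; rewrite /I -(cintegral_preserves
    (f := fun T => H (scl r T) * (w T)%:C) (preserves_rotation ct)); last first.
    by apply: cmeasurableM => //; exact: mscl.
  by apply: eq_cintegral => T; rewrite wrot /scl -!cscaleA [_ * expi t]mulrC.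
have dI r (e : R) : 0 < e -> exists2 d : R, 0 < d &
    forall t, `|t| < d -> normc (I (r + t) - I r) <= e * `|t|.
  move=> e0; have We : 0 < e / (W + 1) by rewrite divr_gt0// ltr_wpDl.
  have [d d0 dP] := cauchy_riemann_increment r K hH We.
  have [d' d'0 dP'] := expi_dist (ltr01 : 0 < 1 :> R).
  exists (Num.min d (Num.min d' 1)); first by rewrite !lt_min d0 d'0 ltr01.
  move=> t; rewrite !lt_min => /and3P[td td' t1].
  have ct : cos t != -1.
    have := le_trans (Re_le_normc _) (dP' _ td'); rewrite /= subr0 mul1r => h.
    apply/eqP => c1; move: h; rewrite c1 => h.
    have := le_lt_trans h t1; rewrite (_ : -1 - 1 = - 2); last by lra.
    by rewrite normrN ger0_norm// => ?; lra.
  have i1 := iH (expR (r + t))%:C; have i2 := iH (expR r)%:C.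
  have i3 : cintegrable pm (fun T => H (cscale (expi t) (scl r T)) * (w T)%:C).
    by apply: eq_cintegrable (iH (expi t * (expR r)%:C)) => T; rewrite cscaleA.
  have -> : I (r + t) - I r = cintegral pm (fun T =>
     (H (scl (r + t) T) - H (scl r T) +
      (0 +i* 1) * (H (cscale (expi t) (scl r T)) - H (scl r T))) * (w T)%:C).
    have e2 : cintegral pm (fun T => (0 +i* 1) *
        (H (cscale (expi t) (scl r T)) * (w T)%:C - H (scl r T) * (w T)%:C)) = 0.
      rewrite cintegralZ; last exact: cintegrableB.
      by rewrite cintegralB// (rotI r t ct) -/(I r) subrr mulr0.
    rewrite /I -(cintegralB i1 i2) -[LHS]addr0 -e2 -cintegralD; last 2 first.
    - exact: cintegrableB.
    - by apply: cintegrableZ; exact: cintegrableB.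
    by apply: eq_cintegral => T; ring.
  have iD : cintegrable pm (fun T =>
     (H (scl (r + t) T) - H (scl r T) +
      (0 +i* 1) * (H (cscale (expi t) (scl r T)) - H (scl r T))) * (w T)%:C).
    have := cintegrableD (cintegrableB i1 i2)
      (cintegrableZ (0 +i* 1) (cintegrableB i3 i2)).
    by apply: eq_cintegrable => T; rewrite -/(scl _ _) -/(scl _ _); ring.
  apply: le_trans (normc_cintegral_le iD) _.
  apply: (@le_trans _ _ (\int[pm]_T ((e / (W + 1) * `|t|) * w T))).
    apply: le_Rintegral => //; first exact: cintegrable_normc iD.
    move=> T _; rewrite normcM normcRge0//; have [KT|TK] := ltP K `|T|.
      by rewrite wK// !mulr0.
    by apply: ler_wpM2r => //; exact: dP.
  rewrite RintegralZl// -/W mulrAC ler_wpM2r//.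
  by rewrite mulrAC ler_pdivrMr ?ltr_wpDl// ler_pM2l// lerDl.
have Icst r : I r = I 0.
  have cst (g : R -> R) : (forall r (e : R), 0 < e -> exists2 d : R, 0 < d &
      forall t, `|t| < d -> `|g (r + t) - g r| <= e * `|t|) -> g r = g 0.
    move=> gP; apply: is_derive_0_is_cst => x; apply: dist_is_derive => e e0.
    have [d d0 dP] := gP x _ e0; exists d => // t td.
    by rewrite mulr0 subr0 [t *: _]mulr1 [t + x]addrC; exact: dP.
  apply: complex_ext.
    apply: (cst (fun r => complex.Re (I r))) => x e /(dI x)[d d0 dP].
    exists d => // t /dP; apply: le_trans.
    by rewrite -ReN -ReD; exact: Re_le_normc.
  apply: (cst (fun r => complex.Im (I r))) => x e /(dI x)[d d0 dP].
  exists d => // t /dP; apply: le_trans.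
  by rewrite -ImN -ImD; exact: Im_le_normc.
have I0 : I 0 = cintegral pm (fun T => H T * (w T)%:C).
  by apply: eq_cintegral => T; rewrite /scl expR0 cscale1.
have cst_int : cintegral pm (fun T => H 0 * (w T)%:C) = H 0 * W%:C.
  by rewrite cintegralZ ?cintegralR//; exact: cintegrableR.
rewrite -I0; apply/eqP; rewrite -subr_eq0; apply/eqP/eq0_normc/eqP.
rewrite eq_le normc_ge0 andbT; apply/ler_addgt0Pr => e e0; rewrite add0r.
have We : 0 < e / (W + 1) by rewrite divr_gt0// ltr_wpDl.
have [d d0 dP] := holo_dist 0 hH We.
have K1 : 0 < 2 * (K + 1) by rewrite mulr_gt0// ltr_wpDl.
pose r := ln (d / (2 * (K + 1))).
rewrite -(Icst r) -cst_int /I -cintegralB; last 2 first.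
- exact: iH.
- by apply: cintegrableZ; exact: cintegrableR.
have iD : cintegrable pm (fun T => H (scl r T) * (w T)%:C - H 0 * (w T)%:C).
  by apply: cintegrableB; [exact: iH|apply: cintegrableZ; exact: cintegrableR].
apply: le_trans (normc_cintegral_le iD) _.
apply: (@le_trans _ _ (\int[pm]_T (e / (W + 1) * w T))).
  apply: le_Rintegral => //; first exact: cintegrable_normc iD.
  move=> T _; rewrite -mulrBl normcM normcRge0//; have [KT|TK] := ltP K `|T|.
    by rewrite wK// !mulr0.
  apply: ler_wpM2r => //; apply/ltW/dP; rewrite subr0.
  apply: le_lt_trans (norm_cscale _ _) _.
  rewrite normcRge0 ?expR_ge0// /r lnK ?posrE ?divr_gt0//.
  apply: (@le_lt_trans _ _ (2 * (d / (2 * (K + 1))) * K)).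
    by rewrite ler_wpM2l// mulr_ge0// divr_ge0// ltW.
  rewrite (_ : 2 * (d / (2 * (K + 1))) * K = d * K / (K + 1)); last first.
    by field; rewrite gt_eqF// ltr_wpDl.
  by rewrite ltr_pdivrMr ?ltr_wpDl// ltr_pM2l// ltrDl.
rewrite RintegralZl// -/W mulrAC ler_pdivrMr ?ltr_wpDl// ler_pM2l// lerDl.
by [].
Qed.

Lemma dot_ge0 (u : 'rV[R]_n) : 0 <= dot u u.
Proof. by apply: sumr_ge0 => i _; rewrite -expr2 sqr_ge0. Qed.

Lemma coord_sqr_le_dot (u : 'rV[R]_n) i : u ord0 i ^+ 2 <= dot u u.
Proof.
rewrite /dot (bigD1 i)//= -expr2 lerDl.
by apply: sumr_ge0 => j _; rewrite -expr2 sqr_ge0.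
Qed.

Lemma sqnorm_ge0 T : 0 <= sqnorm T.
Proof. by rewrite addr_ge0 ?dot_ge0. Qed.

Lemma sqr_norm_le_sqnorm T : `|T| ^+ 2 <= sqnorm T.
Proof.
have h (u : 'rV[R]_n) : dot u u <= sqnorm T -> `|u| <= Num.sqrt (sqnorm T).
  move=> uT; apply: rvec_norm_le => [|i]; first exact: sqrtr_ge0.
  rewrite -sqrtr_sqr ler_wsqrtr//; apply: le_trans uT; exact: coord_sqr_le_dot.
rewrite -(sqr_sqrtr (sqnorm_ge0 T)) ler_pXn2r ?nnegrE ?sqrtr_ge0//.
rewrite prod_normE ge_max; apply/andP; split; apply: h.
  by rewrite /sqnorm lerDl dot_ge0.
by rewrite /sqnorm lerDr dot_ge0.
Qed.

Lemma sqnorm_cscale (z : R[i]) T : sqnorm (cscale z T) = normc z ^+ 2 * sqnorm T.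
Proof.
rewrite /sqnorm /dot -!big_split /= mulr_sumr; apply: eq_bigr => i _.
by rewrite !mxE sqr_normcE; ring.
Qed.

Lemma measurable_coord1 i : measurable_fun setT (fun T : phase => T.1 ord0 i).
Proof. exact: (measurableT_comp (@measurable_coord R n i) (@measurable_fst _ _ _ _)). Qed.

Lemma measurable_coord2 i : measurable_fun setT (fun T : phase => T.2 ord0 i).
Proof. exact: (measurableT_comp (@measurable_coord R n i) (@measurable_snd _ _ _ _)). Qed.

Lemma measurable_dot d (S : measurableType d) (f g : S -> 'rV[R]_n) :
  measurable_fun setT f -> measurable_fun setT g ->
  measurable_fun setT (fun t => dot (f t) (g t)).
Proof.
move=> mf mg; apply: measurable_sum => i; apply: measurable_funM;
exact: (measurableT_comp (@measurable_coord R n i)).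
Qed.

Lemma measurable_sqnorm : measurable_fun setT (@sqnorm R n).
Proof.
by apply: measurable_funD; apply: measurable_dot;
  (exact: measurable_fst || exact: measurable_snd).
Qed.

(** Mean value property against a rotation-invariant weight, by exhausting phase
    space with balls. *)
Theorem mean_value H (w : phase -> R) : holo H ->
  measurable_fun setT w -> (forall T, 0 <= w T) -> rotation_invariant w ->
  pm.-integrable setT (EFin \o w) ->
  cintegrable pm (fun T => H T * (w T)%:C) ->
  cintegral pm (fun T => H T * (w T)%:C) = H 0 * (\int[pm]_T w T)%:C.
Proof.
move=> hH mw w0 wrot iw iHw.
pose w_ (k : nat) T := if sqnorm T <= k%:R then w T else 0.
have w_0 k T : 0 <= w_ k T by rewrite /w_; case: ifP.
have w_w k T : w_ k T <= w T by rewrite /w_; case: ifP.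
have mw_ k : measurable_fun setT (w_ k).
  apply: measurable_fun_ifT => //.
  by apply: measurable_fun_ler => //; exact: measurable_sqnorm.
have iw_ k : pm.-integrable setT (EFin \o w_ k).
  by apply: (integrable_le_ge0 (mw_ k) iw) => T; rewrite ger0_norm.
have w_cv T : \forall k \near \oo, w_ k T = w T.
  near=> k; rewrite /w_ ifT//; near: k; exact: nbhs_infty_ger.
have mH := holo_cmeasurable hH.
have E k : cintegral pm (fun T => H T * (w_ k T)%:C) = H 0 * (\int[pm]_T w_ k T)%:C.
  apply: (@mean_value_box H (Num.sqrt k%:R)) => //.
    by move=> t T; rewrite /w_ wrot sqnorm_cscale normc_expi expr1n mul1r.
  move=> T kT; rewrite /w_ ifF//; apply/negP => Tk.
  move: kT; rewrite ltNge => /negP; apply.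
  rewrite -(@ler_pXn2r _ 2) ?nnegrE ?sqrtr_ge0// sqr_sqrtr//.
  exact: le_trans (sqr_norm_le_sqnorm _) Tk.
have cv1 := @cdominated R _ _ pm (fun k T => H T * (w_ k T)%:C)
  (fun T => H T * (w T)%:C) (fun T => normc (H T * (w T)%:C)) _ _ _ _ _.
have {cv1} := cv1
  (fun k => cmeasurableM mH (cmeasurableR (mw_ k)))
  (cintegrable_meas iHw) (cintegrable_normc iHw).
have cvz (f : nat -> R[i]) (l : R[i]) : (\forall k \near \oo, f k = l) ->
    normc (f k - l) @[k --> \oo] --> 0.
  move=> fl; apply: cvg_near_cst; near=> k.
  have -> : f k = l by near: k.
  by rewrite subrr normc0.
have nle k T : normc (H T * (w_ k T)%:C) <= normc (H T * (w T)%:C).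
  by rewrite !normcM !normcRge0// ler_wpM2l ?normc_ge0.
move=> /(_ _ nle) cv1.
have {cv1} cv1 : normc (H 0 * (\int[pm]_T w_ k T)%:C -
    cintegral pm (fun T => H T * (w T)%:C)) @[k --> \oo] --> 0.
  under eq_fun do rewrite -E.
  apply: cv1 => T; apply: cvz; near=> k.
  by congr (_ * _%:C); near: k.
have cv2 := @cdominated R _ _ pm (fun k T => (w_ k T)%:C)
  (fun T => (w T)%:C) w (fun k => cmeasurableR (mw_ k)) (cmeasurableR mw) iw.
have {cv2} cv2 : normc ((\int[pm]_T w_ k T)%:C - (\int[pm]_T w T)%:C)
    @[k --> \oo] --> 0.
  under eq_fun do rewrite -!cintegralR.
  apply: cv2 => [T|k T]; last by rewrite normcRge0.
  by apply: cvz; near=> k; congr (_%:C); near: k.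
apply/eqP; rewrite -subr_eq0; apply/eqP/eq0_normc.
set A := cintegral pm _ in cv1 *; set B := _%:C.
have cv3 : normc (A - H 0 * B) @[k --> \oo] --> 0.
  have cvs : normc (H 0 * (\int[pm]_T w_ k T)%:C - A) +
      normc (H 0) * normc ((\int[pm]_T w_ k T)%:C - B) @[k --> \oo] --> (0 : R).
    rewrite -[X in _ --> X]addr0 -[X in _ --> _ + X](mulr0 (normc (H 0))).
    by apply: cvgD => //; apply: cvgM => //; exact: cvg_cst.
  apply: (squeeze_cvgr _ (cvg_cst 0) cvs); apply: nearW => k.
  rewrite normc_ge0 andTb -normcM.
  rewrite [X in _ <= X + _]normcB; apply: le_trans (le_normcD _ _).
  by rewrite le_eqVlt; apply/orP; left; apply/eqP; congr normc; rewrite /B; ring.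
by have /cvg_lim <- := cv3; rewrite ?lim_cst.
Unshelve. all: by end_near. Qed.

End mean_value.

(** * Gaussian integrals and the reproducing formula *)

Section real_scaling.
Context d (T : measurableType d) {R : realType} (mu : {measure set T -> \bar R}).

Lemma integralZl_ge0 (k : R) (f : T -> R) : 0 <= k -> measurable_fun setT f ->
  (forall x, 0 <= f x) ->
  (\int[mu]_x (k * f x)%:E = k%:E * \int[mu]_x (f x)%:E)%E.
Proof.
move=> k0 mf f0; under eq_integral do rewrite EFinM.
apply: (@ge0_integralZl_EFin _ _ _ mu _ measurableT (EFin \o f)) => //.
- by move=> x _; rewrite lee_fin.
- exact/measurable_EFinP.
Qed.

Lemma integralZr_ge0 (k : R) (f : T -> R) : 0 <= k -> measurable_fun setT f ->
  (forall x, 0 <= f x) ->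
  (\int[mu]_x (f x * k)%:E = (\int[mu]_x (f x)%:E) * k%:E)%E.
Proof.
move=> k0 mf f0; rewrite muleC -integralZl_ge0//.
by apply: eq_integral => x _; rewrite mulrC.
Qed.

End real_scaling.

Section gauss.
Context {R : realType}.

Definition gauss_mass (a : R) n := Num.sqrt (pi / a) ^+ n.

Lemma gauss_mass_gt0 a n : 0 < a -> 0 < gauss_mass a n.
Proof. by move=> a0; rewrite exprn_gt0// sqrtr_gt0 divr_gt0// pi_gt0. Qed.

Lemma gauss_integral1 (a : R) : 0 < a ->
  (\int[@lebesgue_measure R]_x (expR (- (a * x ^+ 2)))%:E =
    (Num.sqrt (pi / a))%:E)%E.
Proof.
move=> a0; pose s := Num.sqrt (2 * a)^-1.
have s2 : s ^+ 2 = (2 * a)^-1 by rewrite sqr_sqrtr// invr_ge0 mulr_ge0// ltW.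
have s0 : s != 0 by rewrite sqrtr_eq0 -ltNge invr_gt0 mulr_gt0.
have E x : normal_pdf 0 s x = (Num.sqrt (pi / a))^-1 * expR (- (a * x ^+ 2)).
  rewrite normal_pdfE// /normal_peak /normal_fun s2 subr0.
  congr (_^-1 * expR _); last by field; rewrite gt_eqF.
  by congr (Num.sqrt _); field; rewrite gt_eqF.
have p0 : 0 < Num.sqrt (pi / a) by rewrite sqrtr_gt0 divr_gt0// pi_gt0.
have := @integral_normal_pdf R 0 s.
under eq_integral do rewrite E.
have mE : measurable_fun setT (fun x : R => expR (- (a * x ^+ 2))).
  apply: measurableT_comp => //; apply: measurableT_comp => //.
  by apply: measurable_funM => //; exact: measurable_funX.
rewrite integralZl_ge0// ?invr_ge0 ?(ltW p0)//.
move=> /(congr1 (mule (Num.sqrt (pi / a))%:E)); rewrite mule1 muleA -EFinM.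
by rewrite divff ?gt_eqF// mul1e.
Qed.

Lemma dot_vcons n (p q : measurableTypeR R * 'rV[R]_n) :
  dot (vcons p) (vcons q) = p.1 * q.1 + dot p.2 q.2.
Proof.
rewrite /dot big_ord_recl !vconsE; congr (_ + _).
  by case: splitP => // j; rewrite ord1.
apply: eq_bigr => i _; rewrite !vconsE; case: splitP => j.
  by rewrite ord1.
by move=> ij; have -> : j = i by apply: val_inj; move: ij => /= [].
Qed.

Lemma measurable_rvec_gauss n (a : R) :
  measurable_fun setT (fun u : 'rV[R]_n => expR (- (a * dot u u))).
Proof.
apply: measurableT_comp => //; apply: measurableT_comp => //.
by apply: measurable_funM => //; exact: measurable_dot.
Qed.

Lemma gauss_integral_rvec n (a : R) : 0 < a ->
  (\int[@lebesgue_rvec R n]_u (expR (- (a * dot u u)))%:E = (gauss_mass a n)%:E)%E.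
Proof.
move=> a0; elim: n => [|n IH].
  rewrite integral_dirac//; last first.
    by apply/measurable_EFinP; exact: measurable_rvec_gauss.
  by rewrite diracT mul1e /dot big_ord0 mulr0 oppr0 expR0 /gauss_mass expr0.
rewrite [LHS](_ : _ = \int[prod_measure (@lebesgue_measure R) (@lebesgue_rvec R n)]_p
    (expR (- (a * dot (vcons p) (vcons p))))%:E)%E; last first.
  rewrite /= /lebesgue_cons ge0_integral_pushforward//.
  - exact: measurable_vcons.
  - by apply/measurable_EFinP; exact: measurable_rvec_gauss.
rewrite [LHS](fubini_tonelli1 (fun p => (expR (- (a * dot (vcons p) (vcons p))))%:E)); last 2 first.
- apply/measurable_EFinP.
  exact: (measurableT_comp (measurable_rvec_gauss a) (@measurable_vcons R n)).
- by move=> p; rewrite lee_fin expR_ge0.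
have E (x : R) (u : 'rV[R]_n) : expR (- (a * dot (vcons (x, u)) (vcons (x, u)))) =
   expR (- (a * x ^+ 2)) * expR (- (a * dot u u)).
  by rewrite dot_vcons /= mulrDr opprD expRD expr2.
have mE : measurable_fun setT (fun x : R => expR (- (a * x ^+ 2))).
  apply: measurableT_comp => //; apply: measurableT_comp => //.
  by apply: measurable_funM => //; exact: measurable_funX.
under eq_integral => x _.
  rewrite /fubini_F; under eq_integral do rewrite E.
  rewrite integralZl_ge0 ?expR_ge0//; last exact: measurable_rvec_gauss.
  rewrite IH -EFinM; over.
rewrite integralZr_ge0//; last by rewrite ltW// gauss_mass_gt0.
by rewrite gauss_integral1// -EFinM /gauss_mass exprS.
Qed.

End gauss.

Section hermitian.
Context {R : realType} {n : nat}.
Local Notation vec := 'rV[R]_n.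
Local Notation phase := ('rV[R]_n * 'rV[R]_n)%type.
Local Notation pm := (@phase_measure R n).
Implicit Types (X Y T P : phase) (u v : vec) (H : phase -> R[i]).

Lemma dotC u v : dot u v = dot v u.
Proof. by apply: eq_bigr => i _; rewrite mulrC. Qed.

Lemma dotDl u v w : dot (u + v) w = dot u w + dot v w.
Proof. by rewrite /dot -big_split; apply: eq_bigr => i _; rewrite mxE mulrDl. Qed.

Lemma dotDr u v w : dot w (u + v) = dot w u + dot w v.
Proof. by rewrite dotC dotDl !(dotC w). Qed.

Lemma dotZl a u v : dot (a *: u) v = a * dot u v.
Proof. by rewrite /dot mulr_sumr; apply: eq_bigr => i _; rewrite mxE mulrA. Qed.

Lemma dotZr a u v : dot u (a *: v) = a * dot u v.
Proof. by rewrite dotC dotZl dotC. Qed.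

Lemma dotNl u v : dot (- u) v = - dot u v.
Proof. by rewrite -scaleN1r dotZl mulN1r. Qed.

Lemma dotNr u v : dot u (- v) = - dot u v.
Proof. by rewrite dotC dotNl dotC. Qed.

Lemma dot0l u : dot 0 u = 0 :> R.
Proof. by rewrite -(scale0r 0) dotZl mul0r. Qed.

Lemma dot0r u : dot u 0 = 0 :> R.
Proof. by rewrite dotC dot0l. Qed.

Definition dotE := (dotDl, dotDr, dotNl, dotNr, dotZl, dotZr).

(** The hermitian product of C^n, phase space being identified with C^n by
    (x, xi) |-> x + i xi. *)
Definition herm X Y : R[i] :=
  (dot X.1 Y.1 + dot X.2 Y.2) +i* (dot X.2 Y.1 - dot X.1 Y.2).

Lemma hermDl X Y P : herm (X + Y) P = herm X P + herm Y P.
Proof. by apply: complex_ext => /=; rewrite !dotE; ring. Qed.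

Lemma hermDr X Y P : herm P (X + Y) = herm P X + herm P Y.
Proof. by apply: complex_ext => /=; rewrite !dotE; ring. Qed.

Lemma hermZl (t : R) X Y : herm (t *: X) Y = t%:C * herm X Y.
Proof. by apply: complex_ext; rewrite ?(ReM, ImM) /= !dotE; ring. Qed.

Lemma hermZr (t : R) X Y : herm X (t *: Y) = t%:C * herm X Y.
Proof. by apply: complex_ext; rewrite ?(ReM, ImM) /= !dotE; ring. Qed.

Lemma hermNl X Y : herm (- X) Y = - herm X Y.
Proof. by apply: complex_ext => /=; rewrite !dotE; ring. Qed.

Lemma hermNr X Y : herm X (- Y) = - herm X Y.
Proof. by apply: complex_ext => /=; rewrite !dotE; ring. Qed.

Lemma herm_cscale (z : R[i]) X Y : herm (cscale z X) Y = z * herm X Y.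
Proof.
by case: z => a b; apply: complex_ext => /=; rewrite !dotE /=; ring.
Qed.

Lemma conjc_herm X Y : conjc (herm X Y) = herm Y X.
Proof. by apply: complex_ext => /=; rewrite !(dotC Y.1) !(dotC Y.2); ring. Qed.

Lemma hermXX X : herm X X = (sqnorm X)%:C.
Proof. by apply: complex_ext => //=; rewrite (dotC X.2) subrr. Qed.

Lemma Re_herm_le X Y : 2 * complex.Re (herm X Y) <= sqnorm X + sqnorm Y.
Proof.
have := sqnorm_ge0 (X - Y); rewrite /sqnorm /= !dotE !(dotC Y.1) !(dotC Y.2) => h.
by rewrite -subr_ge0; apply: le_trans h _; rewrite le_eqVlt; apply/orP; left; apply/eqP; ring.
Qed.

Lemma sqnormB X Y :
  sqnorm (X - Y) = sqnorm X + sqnorm Y - 2 * complex.Re (herm X Y).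
Proof. by rewrite /sqnorm /= !dotE !(dotC Y.1) !(dotC Y.2); ring. Qed.

Lemma sqnormN X : sqnorm (- X) = sqnorm X.
Proof. by rewrite /sqnorm /= !dotE; ring. Qed.

Lemma dot_norm_le u v : `|dot u v| <= n%:R * (`|u| * `|v|).
Proof.
apply: le_trans (ler_norm_sum _ _ _) _.
rewrite mulr_natl -[X in _ *+ X]card_ord -sumr_const; apply: ler_sum => i _.
by rewrite normrM; apply: ler_pM => //; exact: rvec_coord_le.
Qed.

Lemma normc_herm_le X Y : normc (herm X Y) <= 4 * n%:R * `|Y| * `|X|.
Proof.
apply: le_trans (normc_le_ReIm _) _ => /=.
have n1 Z : `|Z.1| <= `|Z : phase| by rewrite prod_normE le_max lexx.
have n2 Z : `|Z.2| <= `|Z : phase| by rewrite prod_normE le_max lexx orbT.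
have h u v : `|u| <= `|X| -> `|v| <= `|Y| -> `|dot u v| <= n%:R * (`|X| * `|Y|).
  move=> uX vY; apply: le_trans (dot_norm_le _ _) _.
  by rewrite ler_wpM2l//; exact: ler_pM.
have := h _ _ (n1 X) (n1 Y); have := h _ _ (n2 X) (n2 Y).
have := h _ _ (n2 X) (n1 Y); have := h _ _ (n1 X) (n2 Y).
move=> h1 h2 h3 h4; pose A := n%:R * (`|X| * `|Y|).
have -> : 4 * n%:R * `|Y| * `|X| = (A + A) + (A + A) by rewrite /A; ring.
apply: lerD; first by apply: le_trans (ler_normD _ _) (lerD _ _).
by apply: le_trans (ler_normB _ _) (lerD _ _).
Qed.

Lemma clinear_herm (z : R[i]) Y : clinear (fun X => z * herm X Y).
Proof.
split=> [X X'|w X|]; first by rewrite hermDl mulrDr.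
  by rewrite herm_cscale mulrCA.
exists (normc z * (4 * n%:R * `|Y|)); first by rewrite !mulr_ge0// normc_ge0.
by move=> X; rewrite normcM -[leRHS]mulrA ler_wpM2l ?normc_ge0// normc_herm_le.
Qed.

Lemma cmeasurable_herm d (S : measurableType d) (f g : S -> phase) :
  measurable_fun setT f -> measurable_fun setT g ->
  cmeasurable (fun t => herm (f t) (g t)).
Proof.
move=> /measurable_fun_pairP[f1 f2] /measurable_fun_pairP[g1 g2]; split => /=.
  by apply: measurable_funD; exact: measurable_dot.
by apply: measurable_funB; exact: measurable_dot.
Qed.

Lemma measurable_sqnorm_comp d (S : measurableType d) (f : S -> phase) :
  measurable_fun setT f -> measurable_fun setT (fun t => sqnorm (f t)).
Proof. by move=> mf; exact: (measurableT_comp (@measurable_sqnorm R n)). Qed.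

Lemma measurable_phase_gauss (a : R) :
  measurable_fun setT (fun T : phase => expR (- (a * sqnorm T))).
Proof.
apply: measurableT_comp => //; apply: measurableT_comp => //.
by apply: measurable_funM => //; exact: measurable_sqnorm.
Qed.

Lemma gauss_integral_phase (a : R) : 0 < a ->
  (\int[pm]_T (expR (- (a * sqnorm T)))%:E = (gauss_mass a n ^+ 2)%:E)%E.
Proof.
move=> a0; rewrite [LHS](fubini_tonelli1 (fun T => (expR (- (a * sqnorm T)))%:E)); last 2 first.
- by apply/measurable_EFinP; exact: measurable_phase_gauss.
- by move=> p; rewrite lee_fin expR_ge0.
have E (x u : vec) : expR (- (a * sqnorm (x, u))) =
   expR (- (a * dot x x)) * expR (- (a * dot u u)).
  by rewrite /sqnorm mulrDr opprD expRD.
under eq_integral => x _.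
  rewrite /fubini_F; under eq_integral do rewrite E.
  rewrite integralZl_ge0 ?expR_ge0//; last exact: measurable_rvec_gauss.
  rewrite gauss_integral_rvec// -EFinM; over.
rewrite integralZr_ge0//; last 2 first.
- by rewrite ltW// gauss_mass_gt0.
- exact: measurable_rvec_gauss.
by rewrite gauss_integral_rvec// -EFinM expr2.
Qed.

Lemma gauss_mass2 (a : R) : 0 < a -> gauss_mass a n ^+ 2 = (pi / a) ^+ n.
Proof.
by move=> a0; rewrite /gauss_mass exprAC sqr_sqrtr// divr_ge0// ?pi_ge0// ltW.
Qed.

Lemma integrable_phase_gauss (a : R) : 0 < a ->
  pm.-integrable setT (EFin \o (fun T => expR (- (a * sqnorm T)))).
Proof.
move=> a0; apply/integrableP; split.
  by apply/measurable_EFinP; exact: measurable_phase_gauss.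
under eq_integral do rewrite /= ger0_norm ?expR_ge0//.
by rewrite gauss_integral_phase// ltry.
Qed.

Lemma integrable_rvec_gauss (a : R) : 0 < a ->
  (@lebesgue_rvec R n).-integrable setT (EFin \o (fun u => expR (- (a * dot u u)))).
Proof.
move=> a0; apply/integrableP; split.
  by apply/measurable_EFinP; exact: measurable_rvec_gauss.
under eq_integral do rewrite /= ger0_norm ?expR_ge0//.
by rewrite gauss_integral_rvec// ltry.
Qed.

(** The reproducing kernel of the Gaussian weight of parameter [a]. *)
Definition bargmann (a : R) P Y : R[i] :=
  cexp (a%:C * (herm P Y - (sqnorm Y)%:C)).

Lemma cmeasurable_bargmann (a : R) d (S : measurableType d) (f g : S -> phase) :
  measurable_fun setT f -> measurable_fun setT g ->
  cmeasurable (fun t => bargmann a (f t) (g t)).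
Proof.
move=> mf mg; apply: cmeasurable_cexp; apply: cmeasurableM; first exact: cmeasurable_cst.
apply: cmeasurableB; first exact: cmeasurable_herm.
by apply: cmeasurableR; exact: measurable_sqnorm_comp.
Qed.

(** After the translation Y = P + T the kernel is the Gaussian times an entire
    function equal to 1 at T = 0. *)
Lemma reproducing (a : R) H P : 0 < a -> holo H ->
  cintegrable pm (fun Y => H Y * bargmann a P Y) ->
  cintegral pm (fun Y => H Y * bargmann a P Y) = ((pi / a) ^+ n)%:C * H P.
Proof.
move=> a0 hH iH.
pose H' T := H (T + P) * cexp (0 + (- a%:C) * herm T P).
have hH' : holo H'.
  apply: holo_mul; first exact: holo_shift.
  by apply: holo_cexp; exact: clinear_herm.
have E T : H (T + P) * bargmann a P (T + P) = H' T * (expR (- (a * sqnorm T)))%:C.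
  rewrite /H' /bargmann -mulrA -cexp_real -cexpD; congr (_ * cexp _).
  rewrite -!hermXX !hermDl !hermDr !rmorphN /= rmorphM /= -hermXX.
  by rewrite !hermXX; ring.
rewrite -(cintegral_preserves (preserves_phase_shift P)); last exact: cintegrable_meas iH.
under eq_cintegral do rewrite E.
rewrite mean_value//.
- rewrite /H' add0r add0r (_ : herm 0 P = 0) ?mulr0 ?cexp0 ?mulr1.
    rewrite mulrC; congr (_%:C * _).
    by rewrite /Rintegral gauss_integral_phase//= gauss_mass2.
  by apply: complex_ext => /=; rewrite !dot0l; ring.
- exact: measurable_phase_gauss.
- by move=> t T; rewrite sqnorm_cscale normc_expi expr1n mul1r.
- exact: integrable_phase_gauss.
- have := cintegrable_preserves (preserves_phase_shift P) iH.
  by apply: eq_cintegrable => T; rewrite E.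
Qed.

(** The Fourier transform of a Gaussian follows from the reproducing formula,
    applied to an exponential: the other factor of the integral is real. *)
Lemma gauss_fourier (a : R) (b : vec) : 0 < a ->
  cintegral (@lebesgue_rvec R n)
    (fun u => expi (dot u b) * (expR (- (a * dot u u)))%:C) =
  (gauss_mass a n * expR (- (dot b b / (4 * a))))%:C.
Proof.
move=> a0; set I := cintegral _ _; set G := gauss_mass a n.
have G0 : 0 < G by exact: gauss_mass_gt0.
pose B : phase := (b, 0).
pose H T : R[i] := cexp (0 + 1 * herm T B).
have hH : holo H by apply: holo_cexp; exact: clinear_herm.
pose g1 (x : vec) := expR (dot x b - a * dot x x).
have mg1 : measurable_fun setT g1.
  apply: measurableT_comp => //; apply: measurable_funB; first exact: measurable_dot.
  by apply: measurable_funM => //; exact: measurable_dot.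
pose g2 (u : vec) : R[i] := expi (dot u b) * (expR (- (a * dot u u)))%:C.
have mg2 : cmeasurable g2.
  apply: cmeasurableM; first by apply: cmeasurable_expi; exact: measurable_dot.
  by apply: cmeasurableR; exact: measurable_rvec_gauss.
have ng2 u : normc (g2 u) = expR (- (a * dot u u)).
  by rewrite normcM normc_expi mul1r normcRge0// expR_ge0.
have ig2 : cintegrable (@lebesgue_rvec R n) g2.
  by apply: (cintegrable_le mg2 (integrable_rvec_gauss a0)) => u; rewrite ng2.
have E x u : H (x, u) * (expR (- (a * sqnorm (x, u))))%:C = (g1 x)%:C * g2 u.
  rewrite /H /g1 /g2 add0r mul1r /sqnorm /= mulrDr opprD !expRD !rmorphM /=.
  rewrite /herm /B /= !dot0r addr0 subr0 /cexp /=; ring.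
have int1 : (\int[@lebesgue_rvec R n]_x (g1 x)%:E = (G * expR (dot b b / (4 * a)))%:E)%E.
  rewrite -(ge0_integral_preserves (preserves_shift ((2 * a)^-1 *: b))); last 2 first.
  - exact/measurable_EFinP.
  - by move=> x; rewrite lee_fin expR_ge0.
  have E1 x : g1 (x + (2 * a)^-1 *: b) = expR (dot b b / (4 * a)) * expR (- (a * dot x x)).
    rewrite /g1 -expRD; congr expR; rewrite !dotE (dotC b x).
    by field; rewrite gt_eqF.
  under eq_integral do rewrite E1.
  rewrite integralZl_ge0 ?expR_ge0//; last exact: measurable_rvec_gauss.
  by rewrite gauss_integral_rvec// -EFinM mulrC.
have mH : cmeasurable (fun T : phase => H T * (expR (- (a * sqnorm T)))%:C).
  apply: cmeasurableM; first exact: holo_cmeasurable.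
  by apply: cmeasurableR; exact: measurable_phase_gauss.
have iHw : cintegrable pm (fun T => H T * (expR (- (a * sqnorm T)))%:C).
  apply: cintegrable_prod12 => //.
  under eq_integral => x _.
    under eq_integral do rewrite E normcM normcRge0 ?expR_ge0// ng2.
    rewrite integralZl_ge0 ?expR_ge0//; last exact: measurable_rvec_gauss.
    rewrite gauss_integral_rvec// -EFinM; over.
  rewrite integralZr_ge0//; last 2 first.
  - by rewrite ltW// gauss_mass_gt0.
  - by move=> x; exact: expR_ge0.
  by rewrite int1 -EFinM ltry.
have rot : rotation_invariant (fun T : phase => expR (- (a * sqnorm T))).
  by move=> t T; rewrite sqnorm_cscale normc_expi expr1n mul1r.
have := mean_value hH (measurable_phase_gauss a) (fun T => expR_ge0 _) rot
  (integrable_phase_gauss a0) iHw.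
rewrite cintegral_fubini1//.
have inner_int x : cintegral (@lebesgue_rvec R n)
    (fun u => H (x, u) * (expR (- (a * sqnorm (x, u))))%:C) = (g1 x)%:C * I.
  by rewrite -cintegralZ//; apply: eq_cintegral => u; rewrite E.
under eq_cintegral do rewrite inner_int.
have ig1 : (@lebesgue_rvec R n).-integrable setT (EFin \o g1).
  apply/integrableP; split; first exact/measurable_EFinP.
  under eq_integral do rewrite /= ger0_norm ?expR_ge0//.
  by rewrite int1 ltry.
rewrite cintegralZr; last exact: cintegrableR.
rewrite cintegralR {1}/Rintegral int1 /=.
have -> : H 0 = 1.
  by rewrite /H /herm /B /= !dot0l addr0 subr0 mul1r add0r cexp0.
rewrite mul1r /Rintegral gauss_integral_phase//= -/G expr2.
set e := expR _.
have e0 : 0 < e by exact: expR_gt0.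
move=> /(congr1 (fun z => ((G * e)^-1)%:C * z)).
rewrite mulrA -!rmorphM /= mulVf ?mul1r; last by rewrite gt_eqF// mulr_gt0.
move=> ->; congr (_%:C).
rewrite expRN -/e; field.
by rewrite !gt_eqF.
Qed.

End hermitian.

(** * The Hilbert space of square-integrable functions *)

Section L2_theory.
Context {R : realType} {n : nat}.
Local Notation leb := (@lebesgue_rvec R n).
Local Notation fct := ('rV[R]_n -> R[i]).
Implicit Types f g : fct.

Definition nrm f : R := Num.sqrt (\int[leb]_u (normc (f u) ^+ 2)).

Lemma nrm_ge0 f : 0 <= nrm f. Proof. exact: sqrtr_ge0. Qed.

Lemma L2norm_sqint f :
  L2norm f = ((\int[leb]_u (normc (f u) ^+ 2)%:E) `^ (2^-1))%E.
Proof.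
rewrite /L2norm unlock; congr (_ `^ _)%E; apply: eq_integral => u _ /=.
by rewrite ger0_norm ?normc_ge0// -powR_mulrn ?normc_ge0.
Qed.

Lemma measurable_sqnormc f : cmeasurable f ->
  measurable_fun setT (fun u => normc (f u) ^+ 2).
Proof. by move=> mf; apply: measurable_funX; exact: measurable_normc. Qed.

Lemma L2P f : L2 f <-> cmeasurable f /\
  leb.-integrable setT (EFin \o (fun u => normc (f u) ^+ 2)).
Proof.
have E : (\int[leb]_u `|(normc (f u) ^+ 2)%:E| =
    \int[leb]_u (normc (f u) ^+ 2)%:E)%E.
  by apply: eq_integral => u _ /=; rewrite ger0_norm ?sqr_ge0.
split=> -[mf foo]; split=> //.
  apply/integrableP; split; first by apply/measurable_EFinP; exact: measurable_sqnormc.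
  rewrite E; move: foo; rewrite L2norm_sqint => foo.
  rewrite ltey; apply/eqP => I; move: foo; by rewrite I poweRyr.
by rewrite L2norm_sqint; apply: poweR_lty; rewrite -E; case/integrableP: foo.
Qed.

Lemma L2_cmeasurable f : L2 f -> cmeasurable f. Proof. by case. Qed.

Lemma L2_integrable f : L2 f ->
  leb.-integrable setT (EFin \o (fun u => normc (f u) ^+ 2)).
Proof. by case/L2P. Qed.

Lemma sqr_nrm f : nrm f ^+ 2 = \int[leb]_u (normc (f u) ^+ 2).
Proof. by rewrite sqr_sqrtr//; apply: Rintegral_ge0 => u _; exact: sqr_ge0. Qed.

Lemma L2normE f : L2 f -> L2norm f = (nrm f)%:E.
Proof.
move=> /L2_integrable fi; rewrite L2norm_sqint.
rewrite -[X in (X `^ _)%E](@fineK R); last exact: integrable_fin_num fi.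
rewrite poweR_EFin powR12_sqrt//.
by apply: Rintegral_ge0 => u _; exact: sqr_ge0.
Qed.

Lemma L2_lin (a : R[i]) f g : L2 f -> L2 g -> L2 (fun u => a * f u + g u).
Proof.
move=> fL gL; apply/L2P.
have mfg : cmeasurable (fun u => a * f u + g u).
  apply: cmeasurableD; last exact: L2_cmeasurable.
  by apply: cmeasurableM; [exact: cmeasurable_cst|exact: L2_cmeasurable].
split=> //.
pose b u := 2 * normc a ^+ 2 * normc (f u) ^+ 2 + 2 * normc (g u) ^+ 2.
apply: (@integrable_le_ge0 _ _ _ leb _ b).
- exact: measurable_sqnormc.
- rewrite (_ : _ \o _ = (fun u => (2 * normc a ^+ 2)%:E * (normc (f u) ^+ 2)%:E
      + 2%:E * (normc (g u) ^+ 2)%:E)%E)//.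
  by apply: integrableD => //; apply: integrableZl => //; exact: L2_integrable.
move=> u; rewrite ger0_norm ?sqr_ge0// /b.
have h := le_normcD (a * f u) (g u); rewrite normcM in h.
have := normc_ge0 (a * f u + g u); have := normc_ge0 (g u).
have := mulr_ge0 (normc_ge0 a) (normc_ge0 (f u)) => p0 q0 r0.
apply: (@le_trans _ _ ((normc a * normc (f u) + normc (g u)) ^+ 2)).
  by rewrite ler_pXn2r// nnegrE// addr_ge0.
have := sqr_ge0 (normc a * normc (f u) - normc (g u)); lra.
Qed.

Lemma L2_0 : L2 ((fun=> 0) : fct).
Proof.
apply/L2P; split; first exact: cmeasurable_cst.
rewrite (_ : _ \o _ = (fun=> 0%E)); first exact: integrable0.
by apply/funext => u /=; rewrite expr0n /= addr0 sqrtr0 expr0n.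
Qed.

Lemma L2_scale (a : R[i]) f : L2 f -> L2 (fun u => a * f u).
Proof.
by move=> fL; have := L2_lin a fL L2_0; under eq_fun do rewrite addr0.
Qed.

Lemma L2_sub f g : L2 f -> L2 g -> L2 (fun u => f u - g u).
Proof.
move=> fL gL; have := L2_lin (-1) gL fL.
by under eq_fun do rewrite mulN1r addrC.
Qed.

Lemma cmeasurable_inner f g : L2 f -> L2 g ->
  cmeasurable (fun u => f u * conjc (g u)).
Proof.
move=> fL gL; apply: cmeasurableM; first exact: L2_cmeasurable.
by apply: cmeasurable_conjc; exact: L2_cmeasurable.
Qed.

Lemma cauchy_schwarzE f g : L2 f -> L2 g ->
  (\int[leb]_u (normc (f u) * normc (g u))%:E <= (nrm f * nrm g)%:E)%E.
Proof.
move=> fL gL.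
have := @hoelder _ _ R leb (fun u => normc (f u)) (fun u => normc (g u)) 2 2.
move=> /(_ (measurable_normc (L2_cmeasurable fL)) (measurable_normc (L2_cmeasurable gL))).
rewrite !ltr0n => /(_ isT isT) h.
have -> : (\int[leb]_u (normc (f u) * normc (g u))%:E =
   'N[leb]_1[EFin \o ((fun u => normc (f u)) \* (fun u => normc (g u)))%R])%E.
  rewrite Lnorm1; apply: eq_integral => u _ /=.
  by rewrite ger0_norm// mulr_ge0// normc_ge0.
apply: le_trans (h _) _; first by lra.
by rewrite -/(L2norm f) -/(L2norm g) !L2normE// EFinM.
Qed.

Lemma cintegrable_inner f g : L2 f -> L2 g ->
  cintegrable leb (fun u => f u * conjc (g u)).
Proof.
move=> fL gL; apply/cintegrableP; split; first exact: cmeasurable_inner.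
under eq_integral do rewrite normcM normc_conjc.
by apply: le_lt_trans (cauchy_schwarzE fL gL) _; rewrite ltry.
Qed.

Lemma cauchy_schwarz f g : L2 f -> L2 g -> normc (inner f g) <= nrm f * nrm g.
Proof.
move=> fL gL; rewrite -lee_fin.
apply: le_trans (normc_cintegral_leE (cintegrable_inner fL gL)) _.
under eq_integral do rewrite normcM normc_conjc.
exact: cauchy_schwarzE.
Qed.

Lemma inner_lin (a : R[i]) f g k : L2 f -> L2 g -> L2 k ->
  inner (fun u => a * f u + g u) k = a * inner f k + inner g k.
Proof.
move=> fL gL kL; rewrite /inner.
have fk := cintegrable_inner fL kL; have gk := cintegrable_inner gL kL.
rewrite -cintegralZ// -cintegralD//; last exact: cintegrableZ.
by apply: eq_cintegral => u; rewrite mulrDl mulrA.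
Qed.

Lemma inner_conjc f g : L2 f -> L2 g -> inner g f = conjc (inner f g).
Proof.
move=> fL gL; rewrite /inner -cintegral_conjc; last exact: cintegrable_inner.
by apply: eq_cintegral => u; rewrite rmorphM /= conjcK mulrC.
Qed.

Lemma innerff f : inner f f = (nrm f ^+ 2)%:C.
Proof.
rewrite sqr_nrm -cintegralR; apply: eq_cintegral => u; exact: mul_conjc.
Qed.

Lemma inner_ae f f' g : cmeasurable f -> cmeasurable f' -> cmeasurable g ->
  {ae leb, forall u, f u = f' u} -> inner f g = inner f' g.
Proof.
move=> mf mf' mg ff'; apply: ae_eq_cintegral.
- by apply: cmeasurableM => //; exact: cmeasurable_conjc.
- by apply: cmeasurableM => //; exact: cmeasurable_conjc.
- by apply: filterS ff' => u ->.
Qed.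

Lemma sqr_nrm_lin (t : R[i]) f g : L2 f -> L2 g ->
  nrm (fun u => t * f u + g u) ^+ 2 =
  normc t ^+ 2 * nrm f ^+ 2 + nrm g ^+ 2 + 2 * complex.Re (t * inner f g).
Proof.
move=> fL gL; set k := fun u => _; have kL : L2 k by exact: L2_lin.
apply: complexI; rewrite -[LHS]innerff {1}/k inner_lin//.
rewrite (inner_conjc kL fL) (inner_conjc kL gL) /k !inner_lin// !innerff.
rewrite (inner_conjc fL gL); set z := inner f g.
rewrite sqr_normcE.
move: (nrm f ^+ 2) (nrm g ^+ 2) => p q.
clearbody z; case: t {k kL} => a b; case: z => c d.
by apply: complex_ext => /=; ring.
Qed.

(** Approximate Riesz representation: near-minimizers of |g|^2 - 2 Re l(g)
    represent l up to a small error, uniformly on the unit ball.  Contrary to the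
    exact statement this does not use completeness. *)
Lemma riesz_approx (l : fct -> R[i]) (C : R) :
  (forall (a : R[i]) f g, L2 f -> L2 g ->
     l (fun u => a * f u + g u) = a * l f + l g) ->
  (forall f, L2 f -> normc (l f) <= C * nrm f) ->
  forall e : R, 0 < e -> exists2 g, L2 g &
    forall f, L2 f -> normc (l f - inner f g) <= e * nrm f.
Proof.
move=> lin bd e e0.
pose J g := nrm g ^+ 2 - 2 * complex.Re (l g).
have Jlb g : L2 g -> - C ^+ 2 <= J g.
  move=> gL; have := bd _ gL; have := Re_le_normc (l g).
  have := ler_norm (complex.Re (l g)); rewrite /J.
  have := sqr_ge0 (nrm g - C); set N := nrm g; set r := complex.Re _ => h1 h2 h3 h4.
  have : r <= C * N by apply: le_trans h2 (le_trans h3 h4).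
  rewrite sqrrB in h1; lra.
pose S := [set J g | g in [set g | L2 g]].
have Sinf : has_inf S.
  split; first by exists (J ((fun=> 0) : fct)), ((fun=> 0) : fct) => //; exact: L2_0.
  by exists (- C ^+ 2) => _ [g gL <-]; exact: Jlb.
have e20 : 0 < e ^+ 2 by rewrite exprn_gt0.
have [_ [g gL <-] Jg] := inf_adherent e20 Sinf.
exists g => // f fL; set w := l f - inner f g; set N := nrm f.
have N0 : 0 <= N := nrm_ge0 _.
have [N_eq0|N_neq0] := eqVneq N 0.
  rewrite N_eq0 mulr0 /w; have := bd _ fL; rewrite -/N N_eq0 mulr0 => h1.
  have := cauchy_schwarz fL gL; rewrite -/N N_eq0 mul0r => h2.
  by apply: le_trans (le_normcB _ _) _; lra.
have Npos : 0 < N by rewrite lt_neqAle eq_sym N_neq0.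
have N2 : 0 < N ^+ 2 by rewrite exprn_gt0.
pose t : R[i] := conjc w * ((N ^+ 2)^-1)%:C.
have JtE : J (fun u => t * f u + g u) = J g - normc w ^+ 2 / N ^+ 2.
  rewrite /J sqr_nrm_lin// lin//.
  have nt : normc t ^+ 2 = normc w ^+ 2 / N ^+ 2 / N ^+ 2.
    rewrite /t normcM normc_conjc normcRge0 ?invr_ge0 ?(ltW N2)// exprMn.
    by rewrite -mulrA; congr (_ * _); rewrite expr2.
  have tw : t * w = (normc w ^+ 2 / N ^+ 2)%:C.
    by rewrite /t mulrAC [conjc w * w]mulrC mul_conjc -rmorphM.
  have -> : l f = w + inner f g by rewrite /w subrK.
  rewrite mulrDr !ReD tw nt -/N [in X in X - _]mulrAC.
  rewrite (_ : complex.Re (normc w ^+ 2 / N ^+ 2)%:C = normc w ^+ 2 / N ^+ 2)//.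
  have -> : normc w ^+ 2 / N ^+ 2 * N ^+ 2 / N ^+ 2 = normc w ^+ 2 / N ^+ 2.
    by rewrite mulfVK ?gt_eqF.
  by ring.
have Jinf : inf S <= J (fun u => t * f u + g u).
  apply: (ge_inf Sinf.2); exists (fun u => t * f u + g u) => //.
  exact: L2_lin.
have h : normc w ^+ 2 / N ^+ 2 <= e ^+ 2 by rewrite JtE in Jinf; lra.
rewrite ler_pdivrMr// -exprMn in h.
by rewrite -(@ler_pXn2r _ 2) ?nnegrE ?normc_ge0// mulr_ge0// ltW.
Qed.

End L2_theory.

Section bounded_operators.
Context {R : realType} {n : nat}.
Local Notation leb := (@lebesgue_rvec R n).
Local Notation fct := ('rV[R]_n -> R[i]).
Implicit Types (f g : fct) (A B : fct -> fct).

Lemma bounded_op_nrm A : bounded_op A -> exists2 C : R, 0 <= C &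
  forall f, L2 f -> nrm (A f) <= C * nrm f.
Proof.
move=> [AL _ [C CP]]; exists `|C|; first exact: normr_ge0.
move=> f fL; rewrite -lee_fin; have := CP _ fL.
rewrite L2normE; last exact: AL.
rewrite (L2normE fL) => /le_trans; apply; rewrite -EFinM lee_fin.
by rewrite ler_wpM2r ?nrm_ge0// ler_norm.
Qed.

Lemma bounded_op_inner_lin A (a : R[i]) f g k : bounded_op A ->
  L2 f -> L2 g -> L2 k ->
  inner (A (fun u => a * f u + g u)) k = a * inner (A f) k + inner (A g) k.
Proof.
move=> [AL Alin _] fL gL kL; rewrite -inner_lin//; [|exact: AL|exact: AL].
apply: inner_ae; last exact: Alin.
- by apply: L2_cmeasurable; apply: AL; exact: L2_lin.
- by apply: L2_cmeasurable; apply: L2_lin; exact: AL.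
- exact: L2_cmeasurable.
Qed.

Lemma bounded_op_riesz A g : bounded_op A -> L2 g -> forall e : R, 0 < e ->
  exists2 k, L2 k & forall f, L2 f -> normc (inner (A f) g - inner f k) <= e * nrm f.
Proof.
move=> bA gL; have [C C0 CP] := bounded_op_nrm bA; have [AL _ _] := bA.
apply: (@riesz_approx _ _ (fun f => inner (A f) g) (C * nrm g)).
  by move=> a f k fL kL; exact: bounded_op_inner_lin.
move=> f fL; apply: le_trans (cauchy_schwarz (AL _ fL) gL) _.
by rewrite mulrAC ler_wpM2r ?nrm_ge0// CP.
Qed.

Lemma nrm_eq0_ae f : L2 f -> nrm f = 0 -> {ae leb, forall u, f u = 0}.
Proof.
move=> fL nf0; have fi := L2_integrable fL.
have I0 : (\int[leb]_u `|(normc (f u) ^+ 2)%:E| = 0)%E.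
  have := sqr_nrm f; rewrite nf0 expr0n /= => /esym.
  under eq_integral do rewrite /= ger0_norm ?sqr_ge0//.
  by rewrite /Rintegral => h; rewrite -(fineK (integrable_fin_num measurableT fi)) h.
have mf : measurable_fun setT (fun u => (normc (f u) ^+ 2)%:E).
  by apply/measurable_EFinP; apply: measurable_sqnormc; exact: L2_cmeasurable.
have := (ae_eq_integral_abs leb measurableT mf).1 I0.
apply: filterS => u /(_ Logic.I) [] /eqP; rewrite sqrf_eq0 => /eqP.
exact: eq0_normc.
Qed.

Lemma bounded_op_comp A B : bounded_op A -> bounded_op B -> bounded_op (A \o B).
Proof.
move=> bA bB; have [AL Alin [CA CAP]] := bA; have [BL Blin [CB CBP]] := bB.
have [C C0 CP] := bounded_op_nrm bA; have [D D0 DP] := bounded_op_nrm bB.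
split.
- by move=> f fL; apply: AL; exact: BL.
- move=> a f g fL gL /=.
  set p := B (fun w => a * f w + g w); set q := fun w => a * B f w + B g w.
  have pL : L2 p by apply: BL; exact: L2_lin.
  have qL : L2 q by apply: L2_lin; exact: BL.
  have dL := L2_sub pL qL.
  have d0 : nrm (fun u => p u - q u) = 0.
    apply/eqP; rewrite -sqrf_eq0 sqr_nrm /Rintegral.
    rewrite (ae_eq_integral (fun=> 0%E))// ?integral0//; last 2 first.
      by apply/measurable_EFinP; apply: measurable_sqnormc; exact: L2_cmeasurable.
    apply: filterS (Blin a f g fL gL) => u /= + _.
    rewrite -/p -/(q u) => ->.
    by rewrite subrr normc0 expr0n.
  have Ad0 : nrm (A (fun u => p u - q u)) = 0.
    apply/eqP; rewrite eq_le nrm_ge0 andbT.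
    by apply: le_trans (CP _ dL) _; rewrite d0 mulr0.
  have /(nrm_eq0_ae (AL _ dL)) aed := Ad0.
  have aep := Alin (-1) q p qL pL.
  have aeq := Alin a (B f) (B g) (BL _ fL) (BL _ gL).
  apply: filterS3 aed aep aeq => u h1 h2 h3.
  rewrite -h3 -/q; apply/eqP; rewrite -subr_eq0 -h1.
  move: h2; rewrite (_ : (fun w => -1 * q w + p w) = (fun u => p u - q u)).
    by move=> ->; rewrite mulN1r addrC.
  by apply/funext => w; rewrite mulN1r addrC.
- exists (C * D) => f fL; rewrite L2normE; last by apply: AL; exact: BL.
  rewrite L2normE// -EFinM lee_fin -mulrA.
  by apply: le_trans (CP _ (BL _ fL)) _; rewrite ler_wpM2l// DP.
Qed.

End bounded_operators.

(** * Uniqueness of the Fourier transform *)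

Section sign_iteration.
Context {R : realType}.

Definition sgn_step (x : R) := (3 * x - x ^+ 3) / 2.

Lemma sgn_step_odd k x : iter k sgn_step (- x) = - iter k sgn_step x.
Proof.
by elim: k => //= k ->; rewrite /sgn_step; field.
Qed.

Lemma sgn_iter_bound x k : 0 < x -> x <= 1 ->
  [/\ x <= iter k sgn_step x, iter k sgn_step x <= 1 &
      1 - iter k sgn_step x <= (1 - x / 2) ^+ k].
Proof.
move=> x0 x1; elim: k => [|k [h1 h2 h3]] /=; first by rewrite expr0; split => //; lra.
set y := iter k sgn_step x in h1 h2 h3 *.
have y0 : 0 < y by exact: lt_le_trans h1.
have E : 1 - sgn_step y = (1 - y) * ((1 - y) * (2 + y) / 2) by rewrite /sgn_step; field.
have E' : sgn_step y - y = y * ((1 - y) * (1 + y)) / 2 by rewrite /sgn_step; field.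
have yy : 0 <= (1 - y) * (1 + y) by rewrite mulr_ge0//; lra.
have yyy : 0 <= y * ((1 - y) * (1 + y)) by rewrite mulr_ge0// ltW.
have z : 0 <= (1 - y) * (2 + y) by rewrite mulr_ge0//; lra.
have z' : 0 <= (1 - y) * ((1 - y) * (2 + y) / 2).
  by rewrite mulr_ge0//; lra.
split; [lra|lra|].
rewrite E exprSr; apply: ler_pM => //; [lra|lra|].
have : 0 <= y ^+ 2 := sqr_ge0 y; lra.
Qed.

Lemma sgn_iter_abs x k : `|x| <= 1 -> `|iter k sgn_step x| <= 1.
Proof.
have pos y : 0 < y -> y <= 1 -> `|iter k sgn_step y| <= 1.
  move=> y0 y1; have [h1 h2 _] := sgn_iter_bound k y0 y1.
  by rewrite ger0_norm// (le_trans (ltW y0)).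
have [x0|x0|<-] := ltgtP 0 x.
- by move=> x1; apply: pos => //; rewrite -(gtr0_norm x0).
- move=> x1; rewrite -[x]opprK sgn_step_odd normrN; apply: pos.
    by rewrite oppr_gt0.
  by rewrite -(ltr0_norm x0).
- move=> _; rewrite (_ : iter k _ 0 = 0) ?normr0//.
  by elim: k {pos} => //= k ->; rewrite /sgn_step expr0n /=; field.
Qed.

(** The cubic (3x - x^3)/2 fixes -1, 0 and 1, the middle one being repulsive. *)
Lemma sgn_iter_cvg x : `|x| <= 1 -> iter k sgn_step x @[k --> \oo] --> Num.sg x.
Proof.
have pos y : 0 < y -> y <= 1 -> iter k sgn_step y @[k --> \oo] --> (1 : R).
  move=> y0 y1.
  have g0 : (1 - y / 2) ^+ k @[k --> \oo] --> (0 : R).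
    by apply: cvg_expr; rewrite ger0_norm; lra.
  have g1 : 1 - (1 - y / 2) ^+ k @[k --> \oo] --> (1 : R).
    by rewrite -[X in _ --> X]subr0; apply: cvgB => //; exact: cvg_cst.
  have g2 : (fun=> 1 : R) @ \oo --> (1 : R) by exact: cvg_cst.
  apply: (squeeze_cvgr _ g1 g2); apply: nearW => k.
  by have [_ h2 h3] := sgn_iter_bound k y0 y1; apply/andP; split => //; lra.
have [x0|x0|<-] := ltgtP 0 x => x1.
- by rewrite gtr0_sg//; apply: pos => //; rewrite -(gtr0_norm x0).
- rewrite ltr0_sg// -[x]opprK; under eq_fun do rewrite sgn_step_odd.
  apply: cvgN; apply: pos; first by rewrite oppr_gt0.
  by rewrite -(ltr0_norm x0).
- rewrite sgr0; apply: cvg_near_cst; apply: nearW => k.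
  by elim: k => //= k ->; rewrite /sgn_step expr0n /=; field.
Qed.

End sign_iteration.

Section fourier_uniqueness.
Context {R : realType} {n : nat}.
Local Notation leb := (@lebesgue_rvec R n).
Local Notation vec := 'rV[R]_n.
Local Notation fct := ('rV[R]_n -> R[i]).
Implicit Types (phi : fct) (m : vec -> R).

Definition fourier_null phi := cintegrable leb phi /\
  forall xi, cintegral leb (fun u => expi (dot u xi) * phi u) = 0.

(** The bounded functions that preserve the functions of zero Fourier transform
    form an algebra closed under bounded pointwise limits. *)
Definition fourier_mult m := [/\ measurable_fun setT m,
  exists B, forall u, `|m u| <= B &
  forall phi, fourier_null phi -> fourier_null (fun u => (m u)%:C * phi u)].

Lemma cintegrable_bounded_mul (b : fct) (B : R) phi : cmeasurable b ->
  (forall u, normc (b u) <= B) -> cintegrable leb phi ->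
  cintegrable leb (fun u => b u * phi u).
Proof.
move=> mb bB ip.
apply: (cintegrable_le (g := fun u => B * normc (phi u))).
- by apply: cmeasurableM => //; exact: cintegrable_meas ip.
- rewrite (_ : _ \o _ = (fun u => B%:E * (normc (phi u))%:E)%E)//.
  by apply: integrableZl => //; exact: cintegrable_normc.
- by move=> u; rewrite normcM ler_wpM2r ?normc_ge0.
Qed.

Lemma cmeasurable_expi_dot (xi : vec) : cmeasurable (fun u => expi (dot u xi) : R[i]).
Proof. by apply: cmeasurable_expi; exact: measurable_dot. Qed.

Lemma cintegrable_expi_mul (xi : vec) phi : cintegrable leb phi ->
  cintegrable leb (fun u => expi (dot u xi) * phi u).
Proof.
by apply: (@cintegrable_bounded_mul _ 1);
  [exact: cmeasurable_expi_dot|move=> u; rewrite normc_expi].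
Qed.

Lemma fourier_mult_lin (a : R) m m' : fourier_mult m -> fourier_mult m' ->
  fourier_mult (fun u => a * m u + m' u).
Proof.
move=> [mm [B mB] mn] [mm' [B' mB'] mn']; split.
- by apply: measurable_funD => //; apply: measurable_funM => //; exact: measurable_cst.
- exists (`|a| * B + B') => u; apply: le_trans (ler_normD _ _) _.
  by apply: lerD => //; rewrite normrM ler_wpM2l.
move=> phi /[dup] /mn [i1 z1] /mn' [i2 z2].
have E u : (a * m u + m' u)%:C * phi u = a%:C * ((m u)%:C * phi u) + (m' u)%:C * phi u.
  by rewrite rmorphD rmorphM; ring.
split; first by apply: eq_cintegrable (cintegrableD (cintegrableZ a%:C i1) i2) => u.
move=> xi; transitivity (cintegral leb (fun u => a%:C * (expi (dot u xi) * ((m u)%:C * phi u))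
   + expi (dot u xi) * ((m' u)%:C * phi u))).
  by apply: eq_cintegral => u; rewrite E; ring.
rewrite cintegralD; last 2 first.
- by apply: cintegrableZ; exact: cintegrable_expi_mul.
- exact: cintegrable_expi_mul.
rewrite cintegralZ; last exact: cintegrable_expi_mul.
by rewrite z1 z2 mulr0 addr0.
Qed.

Lemma fourier_mult_cst (a : R) : fourier_mult (fun=> a).
Proof.
split; [exact: measurable_cst|by exists (`|a|)|].
move=> phi [ip zp]; split; first exact: cintegrableZ.
move=> xi; transitivity (a%:C * cintegral leb (fun u => expi (dot u xi) * phi u)).
  rewrite -cintegralZ; last exact: cintegrable_expi_mul.
  by apply: eq_cintegral => u; ring.
by rewrite zp mulr0.
Qed.

Lemma fourier_mult_mul m m' : fourier_mult m -> fourier_mult m' ->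
  fourier_mult (fun u => m u * m' u).
Proof.
move=> [mm [B mB] mn] [mm' [B' mB'] mn']; split.
- exact: measurable_funM.
- by exists (B * B') => u; rewrite normrM; apply: ler_pM.
move=> phi /mn' /mn; rewrite (_ : (fun u => _) = fun u => (m u * m' u)%:C * phi u)//.
by apply/funext => u; rewrite rmorphM mulrA.
Qed.

Lemma fourier_mult_lim (m_ : nat -> vec -> R) m (B : R) :
  (forall k, fourier_mult (m_ k)) -> (forall k u, `|m_ k u| <= B) ->
  (forall u, m_ k u @[k --> \oo] --> m u) -> fourier_mult m.
Proof.
move=> mm_ m_B m_m.
have mB u : `|m u| <= B.
  apply/ler_addgt0Pr => e e0; have /cvgrPdist_lt/(_ _ e0)[k _ /(_ k)] := m_m u.
  move=> /(_ (leqnn k)) h; rewrite -[m u](subrK (m_ k u)).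
  by apply: le_trans (ler_normD _ _) _; rewrite addrC lerD// ltW.
have mm : measurable_fun setT m.
  apply: (@measurable_fun_cvg _ _ _ setT m_) => // k.
  by case: (mm_ k).
split => //; first by exists B.
move=> phi pn; have [ip zp] := pn.
have mphi := cintegrable_meas ip.
have im : cintegrable leb (fun u => (m u)%:C * phi u).
  apply: (@cintegrable_bounded_mul (fun u => (m u)%:C) B) => //.
  by move=> u; rewrite normcR.
split=> // xi.
have cv := @cdominated R _ _ leb (fun k u => expi (dot u xi) * ((m_ k u)%:C * phi u))
  (fun u => expi (dot u xi) * ((m u)%:C * phi u)) (fun u => B * normc (phi u)).
have {cv} : normc (cintegral leb (fun u => expi (dot u xi) * ((m_ k u)%:C * phi u))
    - cintegral leb (fun u => expi (dot u xi) * ((m u)%:C * phi u))) @[k --> \oo] --> 0.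
  apply: cv.
  - move=> k; apply: cmeasurableM; first exact: cmeasurable_expi_dot.
    by apply: cmeasurableM => //; apply: cmeasurableR; case: (mm_ k).
  - apply: cmeasurableM; first exact: cmeasurable_expi_dot.
    by apply: cmeasurableM => //; exact: cmeasurableR.
  - rewrite (_ : _ \o _ = (fun u => B%:E * (normc (phi u))%:E)%E)//.
    by apply: integrableZl => //; exact: cintegrable_normc.
  - move=> u; under eq_fun do
      rewrite -mulrBr -mulrBl normcM normc_expi mul1r normcM -rmorphB normcR.
    rewrite -(mul0r (normc (phi u))); apply: cvgM; last exact: cvg_cst.
    rewrite -(normr0 R); apply: cvg_norm; rewrite -(subrr (m u)).
    by apply: cvgB; [exact: m_m|exact: cvg_cst].
  - move=> k u; rewrite normcM normc_expi mul1r normcM normcR.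
    by rewrite ler_wpM2r ?normc_ge0.
under eq_fun => k.
  have [_ _ /(_ _ pn) [_ /(_ xi) ->]] := mm_ k.
  over.
by move=> /cvg_lim h; apply: eq0_normc; rewrite -normcN -[- _]add0r -h ?lim_cst.
Qed.

Lemma fourier_mult_sin (eta : vec) (c : R) : fourier_mult (fun u => sin (dot u eta + c)).
Proof.
split.
- apply: measurableT_comp; last by apply: measurable_funD => //; exact: measurable_dot.
  by apply: continuous_measurable_fun; exact: continuous_sin.
- by exists 1 => u; rewrite ler_norml sin_geN1 sin_le1.
move=> phi [ip zp]; split.
  apply: (@cintegrable_bounded_mul _ 1) => //.
    apply: cmeasurableR; apply: measurableT_comp; last first.
      by apply: measurable_funD => //; exact: measurable_dot.
    by apply: continuous_measurable_fun; exact: continuous_sin.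
  by move=> u; rewrite normcR ler_norml sin_geN1 sin_le1.
move=> xi; have i1 := cintegrable_expi_mul (xi + eta) ip.
have i2 := cintegrable_expi_mul (xi - eta) ip.
transitivity (cintegral leb (fun u =>
   (0 +i* - 2^-1) * expi c * (expi (dot u (xi + eta)) * phi u)
   - (0 +i* - 2^-1) * expi (- c) * (expi (dot u (xi - eta)) * phi u))).
  apply: eq_cintegral => u; rewrite !dotDr dotNr !expiD.
  have -> : (sin (dot u eta + c))%:C = (0 +i* - 2^-1) *
     (expi (dot u eta) * expi c - expi (- dot u eta) * expi (- c)) :> R[i].
    rewrite -!expiD -opprD; apply: complex_ext; rewrite /= ?cosN ?sinN; first by field.
    by ring.
  by ring.
rewrite cintegralB; [|exact: cintegrableZ|exact: cintegrableZ].
by rewrite !cintegralZ// !zp !mulr0 subr0.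
Qed.

Lemma fourier_mult_sg m : fourier_mult m -> (forall u, `|m u| <= 1) ->
  fourier_mult (fun u => Num.sg (m u)).
Proof.
move=> mm m1; apply: (@fourier_mult_lim (fun k u => iter k sgn_step (m u)) _ 1).
- elim=> [|k IH] //=; rewrite /sgn_step.
  have m3 := fourier_mult_mul IH (fourier_mult_mul IH IH).
  have := fourier_mult_lin (- 2^-1) m3 (fourier_mult_lin (3 / 2) IH (fourier_mult_cst 0)).
  rewrite (_ : (fun u => _) = fun u => (3 * iter k sgn_step (m u) - iter k sgn_step (m u) ^+ 3) / 2)//.
  by apply/funext => u; field.
- by move=> k u; exact: sgn_iter_abs.
- by move=> u; exact: sgn_iter_cvg.
Qed.

Lemma sg_sin (x : R) : `|x| < pi -> Num.sg (sin x) = Num.sg x.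
Proof.
rewrite ltr_norml => /andP[xp px]; have [x0|x0|<-] := ltgtP 0 x.
- by rewrite !gtr0_sg// sin_gt0_pi// x0.
- rewrite !ltr0_sg// -[x]opprK sinN oppr_lt0 sin_gt0_pi//.
  by apply/andP; split; lra.
- by rewrite sin0.
Qed.

Lemma fourier_mult_sg_coord i (a : R) : fourier_mult (fun u => Num.sg (u ord0 i - a)).
Proof.
pose s k u := sin (dot u ((k.+1%:R)^-1 *: delta_mx ord0 i) + - (a / k.+1%:R)) : R.
have sE k u : s k u = sin ((u ord0 i - a) / k.+1%:R).
  rewrite /s dotZr; congr sin; rewrite mulrBl; congr (_ - _).
  rewrite mulrC; congr (_ * _); rewrite /dot (bigD1 i)//= big1 ?addr0.
    by rewrite mxE !eqxx mulr1.
  by move=> j ji; rewrite mxE eqxx /= (negbTE ji) mulr0.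
apply: (@fourier_mult_lim (fun k u => Num.sg (s k u)) _ 1).
- move=> k; apply: fourier_mult_sg; first exact: fourier_mult_sin.
  by move=> u; rewrite ler_norml sin_geN1 sin_le1.
- by move=> k u; rewrite normr_sg; case: eqP => //= _; rewrite ?lexx.
move=> u; apply: cvg_near_cst; near=> k.
rewrite sE sg_sin; first by rewrite sgrM (_ : Num.sg _^-1 = 1) ?mulr1// gtr0_sg// invr_gt0.
rewrite normrM [X in _ * X]ger0_norm ?invr_ge0// ltr_pdivrMr//.
rewrite mulrC -ltr_pdivrMr ?pi_gt0//; apply: (@lt_trans _ _ k%:R); last by rewrite ltr_nat.
near: k; exact: nbhs_infty_gtr.
Unshelve. all: by end_near. Qed.

Definition fourier_set (E : set vec) := fourier_mult (\1_E : vec -> R).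

Lemma fourier_setT : fourier_set setT.
Proof.
by rewrite /fourier_set (_ : \1_setT = fun=> 1)
  ?indicT//; exact: fourier_mult_cst.
Qed.

Lemma fourier_setC E : fourier_set E -> fourier_set (~` E).
Proof.
move=> hE; have := fourier_mult_lin (-1) hE (fourier_mult_cst 1).
rewrite /fourier_set (_ : (fun u => _) = \1_(~` E))//.
apply/funext => u; rewrite !indicE in_setC; case: (u \in E) => /=; lra.
Qed.

Lemma fourier_setI E F : fourier_set E -> fourier_set F -> fourier_set (E `&` F).
Proof.
by move=> hE hF; have := fourier_mult_mul hE hF; rewrite /fourier_set indicI.
Qed.

Lemma fourier_set_bigcup (E : nat -> set vec) :
  (forall k, fourier_set (E k)) -> fourier_set (\bigcup_k E k).
Proof.
move=> hE; pose F k := \big[setI/setT]_(j < k) ~` E j.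
have FE k : F k = \bigcap_(j < k) ~` E j by rewrite bigcap_mkord.
have hF k : fourier_set (F k).
  elim: k => [|k IH]; first by rewrite /F big_ord0; exact: fourier_setT.
  by rewrite /F big_ord_recr /=; apply: fourier_setI => //; exact: fourier_setC.
apply: (@fourier_mult_lim (fun k => \1_(~` F k)) _ 1) => [k|k u|u].
- exact/fourier_setC.
- by rewrite indicE; case: (_ \in _); rewrite ?normr1 ?normr0.
have [Eu|nE] := pselect ((\bigcup_k E k) u).
  have [j _ Eju] := Eu; apply: cvg_near_cst; exists j.+1 => // k /= jk.
  rewrite !indicE !mem_set//=.
  by rewrite FE => /(_ j jk); exact.
apply: cvg_near_cst; apply: nearW => k; rewrite !indicE !memNset//.
by rewrite FE /=; apply; move=> j _ Eju; apply: nE; exists j.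
Qed.

Lemma fourier_set_measurable (E : set vec) : measurable E -> fourier_set E.
Proof.
move: E; suff : g_sigma_preimage (fun (i : 'I_n) (u : vec) => u ord0 i : measurableTypeR R)
    `<=` fourier_set by [].
apply: smallest_sub.
  split; first by rewrite -setCT; exact/fourier_setC/fourier_setT.
    by move=> A hA; rewrite setTD; exact: fourier_setC.
  exact: fourier_set_bigcup.
move=> A; rewrite -bigcup_seq => -[i /= _ [B mB <-]]; rewrite setTI.
move: B mB.
have mE := RGenOInfty.measurableE R.
rewrite mE.
suff : <<s @RGenOInfty.G R >> `<=`
    [set B | fourier_set ((fun u : vec => u ord0 i) @^-1` B)] by [].
apply: smallest_sub.
  split => /=.
  - by rewrite preimage_set0 -setCT; exact/fourier_setC/fourier_setT.
  - by move=> B hB; rewrite setTD preimage_setC; exact: fourier_setC.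
  - by move=> F hF; rewrite preimage_bigcup; exact: fourier_set_bigcup.
move=> _ [a ->] /=; have sm := fourier_mult_sg_coord i a.
have := fourier_mult_lin 2^-1 (fourier_mult_mul sm sm)
  (fourier_mult_lin 2^-1 sm (fourier_mult_cst 0)).
congr fourier_mult; apply/funext => u; rewrite indicE.
have [ua|ua|ua] := ltgtP a (u ord0 i).
- rewrite mem_set /= ?in_itv/= ?andbT// gtr0_sg ?subr_gt0//; lra.
- rewrite memNset /= ?in_itv/= ?andbT ?ltr0_sg ?subr_lt0//; first by lra.
  by apply/negP; rewrite -leNgt ltW.
- rewrite memNset /= ?in_itv/= ?andbT ?ua ?ltxx// subrr sgr0; lra.
Qed.

Theorem fourier_null_ae0 phi : fourier_null phi -> {ae leb, forall u, phi u = 0}.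
Proof.
move=> pn; have [[i1 i2] _] := pn.
have z E : measurable E -> cintegral leb (fun u => (\1_E u)%:C * phi u) = 0.
  move=> mE; have [_ _ /(_ _ pn) [_ /(_ 0)]] := fourier_set_measurable mE.
  by under eq_cintegral do rewrite dot0r expi0 mul1r.
have aez (f : vec -> R) : leb.-integrable setT (EFin \o f) ->
    (forall E, measurable E -> \int[leb]_u (\1_E u * f u) = 0) ->
    {ae leb, forall u, f u = 0}.
  move=> fi fz; have := @integral_ae_eq _ _ _ leb setT measurableT (fun=> 0%E) (EFin \o f) fi
    (measurable_cst _).
  have h E : E `<=` setT -> measurable E ->
      (\int[leb]_(x in E) (EFin \o f) x = \int[leb]_(x in E) 0)%E.
    move=> _ mE; rewrite integral0 integral_mkcond.
    have Ei : leb.-integrable setT ((EFin \o f) \_ E).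
      apply: (integrable_mkcond (EFin \o f) mE).1.
      exact: (integrableS measurableT mE _ fi).
    rewrite -[LHS]fineK; last exact: integrable_fin_num Ei.
    congr EFin; rewrite -[RHS](fz E mE); congr fine; apply: eq_integral => u _.
    by rewrite patchE indicE; case: ifP => _; rewrite ?mul1r ?mul0r.
  move=> /(_ h); apply: filterS => u /(_ Logic.I) /= [].
  by [].
have re := aez _ i1; have im := aez _ i2.
have {}re : {ae leb, forall u, complex.Re (phi u) = 0}.
  apply: re => E mE; transitivity (complex.Re
    (cintegral leb (fun u => (\1_E u)%:C * phi u))); last by rewrite z.
  by apply: eq_Rintegral => u _; rewrite ReM mul0r subr0.
have {}im : {ae leb, forall u, complex.Im (phi u) = 0}.
  apply: im => E mE; transitivity (complex.Im
    (cintegral leb (fun u => (\1_E u)%:C * phi u))); last by rewrite z.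
  by apply: eq_Rintegral => u _; rewrite ImM mul0r addr0.
by apply: filterS2 re im => u h1 h2; exact: complex_ext.
Qed.

End fourier_uniqueness.

(** * Coherent states *)

Lemma conjcM {R : realType} (z w : R[i]) : conjc (z * w) = conjc z * conjc w.
Proof. exact: rmorphM. Qed.

Section coherent_states.
Context {R : realType} {n : nat} (h : R).
Hypothesis h_gt0 : 0 < h.
Local Notation vec := 'rV[R]_n.
Local Notation phase := ('rV[R]_n * 'rV[R]_n)%type.
Local Notation leb := (@lebesgue_rvec R n).
Local Notation pm := (@phase_measure R n).
Implicit Types (X Y Z P : phase) (u : vec) (H N : phase -> R[i]).

Definition coherent_cst : R := (pi * h) `^ (- (n%:R / 4)).

Let hneq0 : h != 0. Proof. by rewrite gt_eqF. Qed.

Lemma coherent_cst_gt0 : 0 < coherent_cst.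
Proof. by rewrite powR_gt0// mulr_gt0// pi_gt0. Qed.

Lemma coherent_cst2 : coherent_cst ^+ 2 * gauss_mass h^-1 n = 1.
Proof.
have ph : 0 < pi * h by rewrite mulr_gt0// pi_gt0.
rewrite /gauss_mass invrK -powR12_sqrt ?(ltW ph)//.
rewrite -!powR_mulrn ?powR_ge0// /coherent_cst -!powRrM -powRD; last first.
  by apply/implyP => _; rewrite gt_eqF.
have -> : - (n%:R / 4) * 2%:R + 2^-1 * n%:R = 0 :> R by field.
by rewrite powRr0.
Qed.

Lemma coherent_cexp X u : coherent h X u = coherent_cst%:C *
  cexp ((- (dot (u - X.1) (u - X.1) / (2 * h))) +i* (dot u X.2 / h - dot X.1 X.2 / (2 * h))).
Proof. by rewrite /coherent /cexp /= rmorphM mulrA. Qed.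

Lemma normc_coherent X u : normc (coherent h X u) =
  coherent_cst * expR (- (dot (u - X.1) (u - X.1) / (2 * h))).
Proof.
by rewrite coherent_cexp normcM normc_cexp normcRge0// ltW// coherent_cst_gt0.
Qed.

Lemma normc_coherent_le X u : normc (coherent h X u) <= coherent_cst.
Proof.
rewrite normc_coherent ler_piMr ?(ltW coherent_cst_gt0)//.
rewrite -expR0 ler_expR oppr_le0 divr_ge0 ?dot_ge0// mulr_ge0// ltW//.
Qed.

Lemma cmeasurable_coherent2 : cmeasurable (fun p : phase * vec => coherent h p.1 p.2).
Proof.
rewrite (_ : (fun p => _) = fun p : phase * vec => coherent_cst%:C *
  cexp ((- (dot (p.2 - p.1.1) (p.2 - p.1.1) / (2 * h)))
    +i* (dot p.2 p.1.2 / h - dot p.1.1 p.1.2 / (2 * h)))); last first.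
  by apply/funext => p; rewrite coherent_cexp.
apply: cmeasurableM; first exact: cmeasurable_cst.
have m11 : measurable_fun setT (fun p : phase * vec => p.1.1).
  exact: (measurableT_comp measurable_fst measurable_fst).
have m12 : measurable_fun setT (fun p : phase * vec => p.1.2).
  exact: (measurableT_comp measurable_snd measurable_fst).
have m2 : measurable_fun setT (fun p : phase * vec => p.2) by exact: measurable_snd.
have md : measurable_fun setT (fun p : phase * vec => p.2 - p.1.1).
  by apply: measurable_rvecD => //; exact: measurable_rvecN.
apply: cmeasurable_cexp; split => /=.
  apply: measurableT_comp => //; apply: measurable_funM => //.
  exact: measurable_dot.
by apply: measurable_funB; apply: measurable_funM => //; exact: measurable_dot.
Qed.

Lemma cmeasurable_coherent X : cmeasurable (coherent h X).
Proof.
exact: (cmeasurable_comp cmeasurable_coherent2 (measurable_fun_pair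
  (@measurable_cst _ _ _ _ _ X) (@measurable_id _ _ _))).
Qed.

Lemma cmeasurable_coherent_label u : cmeasurable (fun Z => coherent h Z u).
Proof.
exact: (cmeasurable_comp cmeasurable_coherent2 (measurable_fun_pair
  (@measurable_id _ _ _) (@measurable_cst _ _ _ _ _ u))).
Qed.

(** The overlap of two coherent states. *)
Definition overlap X Y : R[i] := cexp (((4 * h)^-1)%:C *
  ((2 : R)%:C * herm X Y - (sqnorm X)%:C - (sqnorm Y)%:C)).

Lemma normc_overlap X Y : normc (overlap X Y) = expR (- (sqnorm (X - Y) / (4 * h))).
Proof.
rewrite normc_cexp; congr expR; rewrite sqnormB.
by rewrite !(ReM, ReD, ReN) /= ; field.
Qed.

Lemma normc_overlap_le X Y : normc (overlap X Y) <= 1.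
Proof.
rewrite normc_overlap -expR0 ler_expR oppr_le0 divr_ge0 ?sqnorm_ge0//.
by rewrite mulr_ge0// ltW.
Qed.

Lemma conjc_overlap X Y : conjc (overlap X Y) = overlap Y X.
Proof.
rewrite conjc_cexp; congr cexp; rewrite -(conjc_herm X Y).
by case: (herm X Y) => a b; apply: complex_ext => /=; ring.
Qed.

Lemma overlapXX X : overlap X X = 1.
Proof.
rewrite /overlap hermXX -cexp0; congr cexp.
by apply: complex_ext => /=; ring.
Qed.

Lemma overlap_neq0 X Y : overlap X Y != 0.
Proof.
apply/eqP => o0; have := normc_overlap X Y; rewrite o0 normc0 => /esym/eqP.
by rewrite gt_eqF// expR_gt0.
Qed.

Lemma cmeasurable_overlap d (S : measurableType d) (f g : S -> phase) :
  measurable_fun setT f -> measurable_fun setT g ->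
  cmeasurable (fun t => overlap (f t) (g t)).
Proof.
move=> mf mg; apply: cmeasurable_cexp; apply: cmeasurableM; first exact: cmeasurable_cst.
apply: cmeasurableB; last by apply: cmeasurableR; exact: measurable_sqnorm_comp.
apply: cmeasurableB; last by apply: cmeasurableR; exact: measurable_sqnorm_comp.
by apply: cmeasurableM; [exact: cmeasurable_cst|exact: cmeasurable_herm].
Qed.

Lemma inner_coherent X Y : inner (coherent h X) (coherent h Y) = overlap X Y.
Proof.
pose m : vec := 2^-1 *: (X.1 + Y.1).
pose K : R[i] := (coherent_cst ^+ 2)%:C *
  cexp ((- (dot (X.1 - Y.1) (X.1 - Y.1) / (4 * h))) +i*
        ((dot Y.1 X.2 - dot X.1 Y.2) / (2 * h))).
pose b : vec := h^-1 *: (X.2 - Y.2).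
have E v : coherent h X (v + m) * conjc (coherent h Y (v + m)) =
    K * (expi (dot v b) * (expR (- (h^-1 * dot v v)))%:C).
  rewrite !coherent_cexp conjcM conjc_cexp conjc_real mulrACA -rmorphM -expr2.
  rewrite /K -mulrA -cexp_imag -cexp_real -!cexpD; congr (_ * cexp _).
  apply: complex_ext; rewrite !(ReD, ImD) /= /m /b !dotE.
    by rewrite !(dotC _ v) !(dotC Y.1 X.1); field.
  by field.
have ig : cintegrable leb (fun v => expi (dot v b) * (expR (- (h^-1 * dot v v)))%:C).
  apply: (cintegrable_le (g := fun v => expR (- (h^-1 * dot v v)))).
  - apply: cmeasurableM; first exact: cmeasurable_expi_dot.
    by apply: cmeasurableR; exact: measurable_rvec_gauss.
  - by apply: integrable_rvec_gauss; rewrite invr_gt0.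
  - by move=> v; rewrite normcM normc_expi mul1r normcRge0// expR_ge0.
rewrite /inner -(cintegral_preserves (preserves_shift m)); last first.
  apply: cmeasurableM; first exact: cmeasurable_coherent.
  by apply: cmeasurable_conjc; exact: cmeasurable_coherent.
under eq_cintegral do rewrite E.
rewrite cintegralZ// gauss_fourier ?invr_gt0//.
rewrite /K; set k := cexp _; set e := expR _.
have -> : (coherent_cst ^+ 2)%:C * k * (gauss_mass h^-1 n * e)%:C =
   (coherent_cst ^+ 2 * gauss_mass h^-1 n)%:C * (k * e%:C).
  by rewrite !rmorphM; ring.
rewrite coherent_cst2 mul1r /k /e -cexp_real -cexpD; congr cexp.
apply: complex_ext; rewrite !(ReM, ImM, ReD, ImD, ReN, ImN) /= /b /sqnorm ?dotE.
  by rewrite (dotC Y.2 X.2) (dotC Y.1 X.1); field.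
by rewrite (dotC Y.1 X.2); field.
Qed.

Lemma coherent_L2 X : L2 (coherent h X).
Proof.
apply/L2P; split; first exact: cmeasurable_coherent.
apply: (@integrable_le_ge0 _ _ _ leb _
   (fun u => coherent_cst ^+ 2 * expR (- (h^-1 * dot (u - X.1) (u - X.1))))).
- by apply: measurable_sqnormc; exact: cmeasurable_coherent.
- have := cintegrable_preserves (preserves_shift (- X.1))
    (cintegrableR (integrable_rvec_gauss (n := n) (a := h^-1) _)).
  rewrite invr_gt0 => /(_ h_gt0) /(cintegrableZ (coherent_cst ^+ 2)%:C) [+ _].
  by apply: eq_integrable => // u _ /=; rewrite mul0r subr0.
- move=> u; rewrite ger0_norm ?sqr_ge0// normc_coherent exprMn.
  rewrite ler_wpM2l ?sqr_ge0// -expRM_natl ler_expR.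
  by rewrite le_eqVlt; apply/orP; left; apply/eqP; field.
Qed.

Lemma nrm_coherent X : nrm (coherent h X) = 1.
Proof.
apply/eqP; rewrite -(@eqrXn2 _ 2) ?nrm_ge0// expr1n; apply/eqP.
by apply: complexI; rewrite -innerff inner_coherent overlapXX.
Qed.

(** In the variable Y, both exp(|Y|^2/4h) times the coherent state Y at a point,
    and exp(|Y|^2/4h) times its overlap with X, are holomorphic. *)
Definition holo_weighted N := holo (fun Y => (expR (sqnorm Y / (4 * h)))%:C * N Y).

Definition phase_conj X : phase := (X.1, - X.2).

Lemma herm_phase_conjC X Y : herm X (phase_conj Y) = herm Y (phase_conj X).
Proof. by apply: complex_ext; rewrite /= !dotE !(dotC Y.1) !(dotC Y.2); ring. Qed.

Lemma norm_phase_conj X : `|phase_conj X| = `|X|.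
Proof. by rewrite !prod_normE /= normrN. Qed.

Lemma holo_quadratic : holo (fun X => herm X (phase_conj X)).
Proof.
move=> X0; exists (fun T => (2 : R)%:C * herm T (phase_conj X0)); first exact: clinear_herm.
move=> e e0; pose C : R := 8 * n%:R + 1.
have C0 : 0 < C by rewrite ltr_wpDl// mulr_ge0.
exists (e / C); first by rewrite divr_gt0.
have cB A B : phase_conj (A - B) = phase_conj A - phase_conj B.
  by apply: phase_ext => i; rewrite /= !mxE ?opprD.
move=> X Y Xe Ye.
have -> : herm X (phase_conj X) - herm Y (phase_conj Y) -
    (2 : R)%:C * herm (X - Y) (phase_conj X0) =
    herm (X - Y) (phase_conj (X - X0)) + herm (X - Y) (phase_conj (Y - X0)).
  rewrite !cB !hermDl !hermDr !hermNl !hermNr (herm_phase_conjC Y X).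
  by rewrite (_ : (2 : R)%:C = 1 + 1) ?rmorphD//; ring.
apply: le_trans (le_normcD _ _) _.
apply: le_trans (lerD (normc_herm_le _ _) (normc_herm_le _ _)) _.
rewrite !norm_phase_conj -mulrDl ler_wpM2r//.
move: Xe Ye; rewrite !ltr_pdivlMr// => Xe Ye.
rewrite -mulrDr -mulrA mulrC.
have := normr_ge0 (X - X0); have := normr_ge0 (Y - X0); rewrite /C in Xe Ye; lra.
Qed.

Lemma holo_weighted_coherent u : holo_weighted (fun Y => coherent h Y u).
Proof.
pose U : phase := (u, 0).
have H1 : holo (fun Y => cexp ((- (dot u u / (2 * h)))%:C + (h^-1)%:C * herm Y U
    + (- (4 * h)^-1)%:C * herm Y (phase_conj Y))).
  apply: holo_exp; apply: holo_add.
    by apply: holo_add; [exact: holo_cst|apply: holo_clinear; exact: clinear_herm].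
  by apply: holo_mul; [exact: holo_cst|exact: holo_quadratic].
have := holo_mul (holo_cst coherent_cst%:C) H1.
rewrite /holo_weighted; congr holo; apply/funext => Y.
rewrite coherent_cexp [RHS]mulrCA -(cexp_real (sqnorm Y / (4 * h))) -cexpD.
congr (_ * cexp _).
apply: complex_ext; rewrite !(ReM, ImM, ReD, ImD) /= /sqnorm !dotE !dot0r.
  by rewrite (dotC Y.1 u); field.
by rewrite (dotC Y.2 u) (dotC Y.2 Y.1); field.
Qed.

Lemma holo_weighted_overlap X : holo_weighted (fun Y => overlap Y X).
Proof.
have H1 : holo (fun Y => cexp ((- (sqnorm X / (4 * h)))%:C + ((2 * h)^-1)%:C * herm Y X)).
  by apply: holo_cexp; exact: clinear_herm.
move: H1; rewrite /holo_weighted; congr holo; apply/funext => Y.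
rewrite -(cexp_real (sqnorm Y / (4 * h))) -cexpD; congr cexp.
by apply: complex_ext; rewrite !(ReM, ImM, ReD, ImD, ReN, ImN) /=; field.
Qed.

Lemma overlap_bargmann P Y : (expR (sqnorm Y / (4 * h)))%:C * bargmann (2 * h)^-1 P Y =
  (expR (sqnorm P / (4 * h)))%:C * overlap P Y.
Proof.
rewrite -(cexp_real (sqnorm Y / (4 * h))) -(cexp_real (sqnorm P / (4 * h))) -!cexpD.
congr cexp.
by apply: complex_ext; rewrite !(ReM, ImM, ReD, ImD, ReN, ImN) /=; field.
Qed.

Lemma overlap_reproducing N P : holo_weighted N ->
  cintegrable pm (fun Y => N Y * overlap P Y) ->
  cintegral pm (fun Y => N Y * overlap P Y) = ((2 * pi * h) ^+ n)%:C * N P.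
Proof.
move=> hN iN; have a0 : 0 < (2 * h)^-1 by rewrite invr_gt0 mulr_gt0.
have E Y : (expR (sqnorm Y / (4 * h)))%:C * N Y * bargmann (2 * h)^-1 P Y =
   (expR (sqnorm P / (4 * h)))%:C * (N Y * overlap P Y).
  by rewrite mulrAC overlap_bargmann; ring.
set K := (expR (sqnorm P / (4 * h)))%:C in E.
have K0 : K != 0.
  by apply/eqP => -[] /eqP; rewrite gt_eqF// expR_gt0.
have iE : cintegrable pm (fun Y =>
    (expR (sqnorm Y / (4 * h)))%:C * N Y * bargmann (2 * h)^-1 P Y).
  by apply: eq_cintegrable (cintegrableZ K iN) => Y; rewrite E.
have := reproducing a0 hN iE; under eq_cintegral do rewrite E.
rewrite cintegralZ// -/K invrK [RHS]mulrCA => /(mulfI K0) ->.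
by rewrite mulrA [pi * 2]mulrC.
Qed.

Lemma overlap_reproducing_conj N P : holo_weighted (fun Y => conjc (N Y)) ->
  cintegrable pm (fun Y => N Y * overlap Y P) ->
  cintegral pm (fun Y => N Y * overlap Y P) = ((2 * pi * h) ^+ n)%:C * N P.
Proof.
move=> hN iN; have := overlap_reproducing hN.
have E Y : conjc (N Y) * overlap P Y = conjc (N Y * overlap Y P).
  by rewrite conjcM conjc_overlap.
move=> /(_ P); under eq_fun do rewrite E.
move=> /(_ (cintegrable_conjc iN)).
rewrite cintegral_conjc// => /(congr1 conjc); rewrite conjcK => ->.
by rewrite conjcM conjcK conjc_real.
Qed.

Lemma integrable_overlap X :
  pm.-integrable setT (EFin \o (fun Y => normc (overlap X Y))).
Proof.
have a0 : 0 < (4 * h)^-1 by rewrite invr_gt0 mulr_gt0.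
have := cintegrable_preserves (preserves_phase_reflect X)
  (cintegrableR (integrable_phase_gauss (n := n) a0)).
move=> [+ _]; apply: eq_integrable => // Y _.
by rewrite /comp normc_overlap [in RHS]mulrC.
Qed.

Lemma cintegrable_overlap X : cintegrable pm (overlap X).
Proof.
apply: (cintegrable_le (g := fun Y => normc (overlap X Y))) => //.
  by apply: cmeasurable_overlap => //; exact: measurable_cst.
exact: integrable_overlap.
Qed.

End coherent_states.

(** * Resolution of the identity *)

Section resolution.
Context {R : realType} {n : nat} (h : R).
Hypothesis h_gt0 : 0 < h.
Local Notation vec := 'rV[R]_n.
Local Notation fct := ('rV[R]_n -> R[i]).
Local Notation phase := ('rV[R]_n * 'rV[R]_n)%type.
Local Notation leb := (@lebesgue_rvec R n).
Local Notation pm := (@phase_measure R n).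
Local Notation Psi := (coherent h).
Implicit Types (X Y Z P : phase) (u : vec) (f g b : fct) (a : phase -> R[i]).

(** Functions of the label that depend on it through the coherent state, in a
    Lipschitz way for the norm, are continuous in the label. *)
Definition coherent_lip a := exists2 C : R, 0 <= C &
  forall X Y, normc (a X - a Y) <= C * nrm (fun u => Psi X u - Psi Y u).

Lemma sqr_nrm_coherentB X Y :
  nrm (fun u => Psi X u - Psi Y u) ^+ 2 = 2 - 2 * complex.Re (overlap h X Y).
Proof.
have XL := coherent_L2 h_gt0 X; have YL := coherent_L2 h_gt0 Y.
rewrite (_ : (fun u => _) = (fun u => -1 * Psi Y u + Psi X u)); last first.
  by apply/funext => u; rewrite mulN1r addrC.
rewrite sqr_nrm_lin// !nrm_coherent// inner_coherent// normcN normc1.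
by rewrite mulN1r ReN -conjc_overlap Re_conjc; ring.
Qed.

Lemma overlap_near X (e : R) : 0 < e -> exists2 d : R, 0 < d &
  forall Y, `|Y - X| < d -> normc (overlap h X Y - 1) <= e.
Proof.
move=> e0; have [d d0 dP] := @cexp_strict R 0 1 ltr01.
pose c : R := 1 + (4 * h)^-1 * (4 * n%:R * (1 + 2 * `|X|)).
have c0 : 0 < c.
  rewrite ltr_wpDr// mulr_ge0// ?invr_ge0 ?mulr_ge0// ?addr_ge0// ltW//.
exists (Num.min 1 (Num.min (d / c) (e / (2 * c)))).
  by rewrite !lt_min ltr01 !divr_gt0// mulr_gt0.
move=> Y; rewrite !lt_min => /and3P[Y1]; rewrite !ltr_pdivlMr ?mulr_gt0// => Yd Ye.
set w := ((4 * h)^-1)%:C * ((2 : R)%:C * herm X Y - (sqnorm X)%:C - (sqnorm Y)%:C).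
have wb : normc w <= `|Y - X| * c.
  have -> : w = ((4 * h)^-1)%:C * (- herm (Y - X) (Y - X)
      + (herm X (Y - X) - herm (Y - X) X)).
    rewrite /w -!hermXX !hermDl !hermDr !hermNl !hermNr.
    by rewrite (_ : (2 : R)%:C = 1 + 1) ?rmorphD//; ring.
  rewrite normcM normcRge0 ?invr_ge0 ?mulr_ge0 ?(ltW h_gt0)//.
  have b1 := normc_herm_le (Y - X) (Y - X).
  have b2 := normc_herm_le X (Y - X); have b3 := normc_herm_le (Y - X) X.
  have t := le_trans (le_normcD _ _) (lerD (lexx (normc (- herm (Y - X) (Y - X))))
     (le_normcB (herm X (Y - X)) (herm (Y - X) X))).
  rewrite normcN in t.
  have n0 : 0 <= n%:R :> R by [].
  have dY := normr_ge0 (Y - X).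
  have b4 : 4 * n%:R * `|Y - X| * `|Y - X| <= 4 * n%:R * `|Y - X| * 1.
    by rewrite ler_wpM2l ?mulr_ge0// ltW.
  apply: le_trans (ler_wpM2l _ t) _; first by rewrite invr_ge0 mulr_ge0// ltW.
  pose B := 4 * n%:R * (1 + 2 * `|X|).
  apply: (@le_trans _ _ ((4 * h)^-1 * (`|Y - X| * B))).
    rewrite ler_wpM2l ?invr_ge0 ?mulr_ge0 ?(ltW h_gt0)//.
    by apply: le_trans (lerD b1 (lerD b2 b3)) _; rewrite /B; lra.
  by rewrite mulrCA ler_wpM2l// /c -/B lerDr.
have := dP w 0; rewrite !subr0 cexp0 mul1r normc0 => h1.
have {h1} h1 := h1 (le_lt_trans wb Yd) d0.
rewrite -[overlap h X Y]/(cexp w) -[cexp w - 1](subrK w).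
apply: le_trans (le_normcD _ _) _; rewrite mul1r in h1; lra.
Qed.

Lemma coherent_lip_dist a X : coherent_lip a -> forall e : R, 0 < e ->
  exists2 d : R, 0 < d & forall Y, `|Y - X| < d -> normc (a Y - a X) < e.
Proof.
move=> [C C0 CP] e e0; pose D := C + 1.
have D0 : 0 < D by rewrite ltr_wpDl.
pose e' := (e / D) ^+ 2 / 4.
have e'0 : 0 < e' by rewrite divr_gt0// exprn_gt0// divr_gt0.
have [d d0 dP] := overlap_near X e'0.
exists d => // Y /dP hY; rewrite normcB; apply: le_lt_trans (CP _ _) _.
set N := nrm _; have N0 : 0 <= N := nrm_ge0 _.
apply: (@le_lt_trans _ _ (D * N)); first by rewrite ler_wpM2r// lerDl.
rewrite mulrC -ltr_pdivlMr// -(@ltr_pXn2r _ 2) ?nnegrE ?divr_ge0 ?(ltW e0) ?(ltW D0)//.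
rewrite sqr_nrm_coherentB.
have := le_trans (Re_le_normc _) hY; rewrite ReD ReN.
rewrite (_ : complex.Re (1 : R[i]) = 1)// ler_norml => /andP[h1 h2].
have : 0 < (e / D) ^+ 2 by rewrite exprn_gt0// divr_gt0.
rewrite /e' in h1 h2; lra.
Qed.

Lemma coherent_lip_cmeasurable a : coherent_lip a -> cmeasurable a.
Proof.
move=> la; split; apply: continuous_phase_measurable => X0;
  apply/cvgrPdist_lt => e e0; have [d d0 dP] := coherent_lip_dist X0 la e0; near=> X.
  rewrite -ReN -ReD; apply: le_lt_trans (Re_le_normc _) _.
  rewrite normcB; apply: dP; rewrite distrC; near: X.
  by apply: (@cvgr_dist_lt _ phase).
rewrite -ImN -ImD; apply: le_lt_trans (Im_le_normc _) _.
rewrite normcB; apply: dP; rewrite distrC; near: X.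
by apply: (@cvgr_dist_lt _ phase).
Unshelve. all: by end_near. Qed.

Lemma inner_subl f g b : L2 f -> L2 g -> L2 b ->
  inner (fun u => f u - g u) b = inner f b - inner g b.
Proof.
move=> fL gL bL; rewrite (_ : (fun u => _) = (fun u => -1 * g u + f u)); last first.
  by apply/funext => u; rewrite mulN1r addrC.
by rewrite inner_lin// mulN1r addrC.
Qed.

Lemma coherent_lip_inner g : L2 g -> coherent_lip (fun Z => inner (Psi Z) g).
Proof.
move=> gL; exists (nrm g); first exact: nrm_ge0.
move=> X Y; have XL := coherent_L2 h_gt0 X; have YL := coherent_L2 h_gt0 Y.
by rewrite -inner_subl// mulrC; apply: cauchy_schwarz => //; exact: L2_sub.
Qed.

Lemma coherent_lip_op (A : fct -> fct) g : bounded_op A -> L2 g ->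
  coherent_lip (fun Z => inner (A (Psi Z)) g).
Proof.
move=> bA gL; have [C C0 CP] := bounded_op_nrm bA; have [AL _ _] := bA.
exists (C * nrm g); first by rewrite mulr_ge0// nrm_ge0.
move=> X Y; have XL := coherent_L2 h_gt0 X; have YL := coherent_L2 h_gt0 Y.
have dL := L2_sub XL YL.
have -> : inner (A (Psi X)) g - inner (A (Psi Y)) g = inner (A (fun u => Psi X u - Psi Y u)) g.
  rewrite (_ : (fun u => Psi X u - Psi Y u) = (fun u => -1 * Psi Y u + Psi X u)).
    by rewrite bounded_op_inner_lin// mulN1r addrC.
  by apply/funext => u; rewrite mulN1r addrC.
apply: le_trans (cauchy_schwarz (AL _ dL) gL) _.
by rewrite mulrAC ler_wpM2r ?nrm_ge0// CP.
Qed.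

Lemma coherent_lip_conjc a : coherent_lip a -> coherent_lip (fun Z => conjc (a Z)).
Proof. by move=> [C C0 CP]; exists C => // X Y; rewrite -rmorphB normc_conjc. Qed.

(** The coherent transform of a square-integrable function. *)
Definition transform f Z := inner f (Psi Z).

Lemma transformE f Z : L2 f -> transform f Z = conjc (inner (Psi Z) f).
Proof. by move=> fL; rewrite /transform (inner_conjc (coherent_L2 h_gt0 Z) fL). Qed.

Lemma cmeasurable_transform f : L2 f -> cmeasurable (transform f).
Proof.
move=> fL; rewrite (_ : transform f = fun Z => conjc (inner (Psi Z) f)).
  by apply: coherent_lip_cmeasurable; apply: coherent_lip_conjc; exact: coherent_lip_inner.
by apply/funext => Z; exact: transformE.
Qed.

Lemma normc_inner_coherent_le f Z : L2 f -> normc (inner (Psi Z) f) <= nrm f.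
Proof.
move=> fL; apply: le_trans (cauchy_schwarz (coherent_L2 h_gt0 Z) fL) _.
by rewrite nrm_coherent// mul1r.
Qed.

Definition superposition a u := cintegral pm (fun Z => a Z * Psi Z u).

Lemma cintegrable_superposition a b : cintegrable pm a -> L2 b ->
  cintegrable (prod_measure leb pm) (fun p => a p.2 * (Psi p.2 p.1 * conjc (b p.1))).
Proof.
move=> ia bL; have ma := cintegrable_meas ia; have mb := L2_cmeasurable bL.
pose F (p : vec * phase) := a p.2 * (Psi p.2 p.1 * conjc (b p.1)).
have mF : cmeasurable F.
  apply: cmeasurableM; first exact: (cmeasurable_comp ma measurable_snd).
  apply: cmeasurableM.
    apply: (cmeasurable_comp (cmeasurable_coherent2 h)
      (phi := fun p : vec * phase => (p.2, p.1))).
    by apply: measurable_fun_pair; [exact: measurable_snd|exact: measurable_fst].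
  exact: (cmeasurable_comp (cmeasurable_conjc mb) measurable_fst).
apply: (cintegrable_prod21 mF).
apply: (@le_lt_trans _ _ (\int[pm]_Z ((nrm b)%:E * (normc (a Z))%:E))%E).
  apply: ge0_le_integral => //.
  - by move=> Z _; apply: integral_ge0 => u _; rewrite lee_fin normc_ge0.
  - apply: (measurable_fun_fubini_tonelli_G (fun p => (normc (F p))%:E)).
      exact: measurable_normcE.
    by move=> p; rewrite lee_fin normc_ge0.
  - by apply: measurable_funeM; exact: measurable_normcE.
  move=> Z _; rewrite (eq_integral (fun u =>
    (normc (a Z) * (normc (Psi Z u) * normc (b u)))%:E)); last first.
    by move=> u _; rewrite /F !normcM normc_conjc.
  rewrite integralZl_ge0 ?normc_ge0//; last 2 first.
  - by apply: measurable_funM; apply: measurable_normc => //; exact: cmeasurable_coherent.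
  - by move=> u; rewrite mulr_ge0// normc_ge0.
  rewrite muleC; apply: lee_wpmul2r; first by rewrite lee_fin normc_ge0.
  apply: le_trans (cauchy_schwarzE (coherent_L2 h_gt0 Z) bL) _.
  by rewrite nrm_coherent// mul1r.
have [_ foo] := (cintegrableP pm a).1 ia.
rewrite ge0_integralZl//; last 3 first.
- exact: measurable_normcE.
- by move=> Z _; rewrite lee_fin normc_ge0.
- by rewrite lee_fin nrm_ge0.
by apply: lte_mul_pinfty => //; rewrite lee_fin nrm_ge0.
Qed.

Lemma inner_superposition a b : cintegrable pm a -> L2 b ->
  cintegrable leb (fun u => superposition a u * conjc (b u)) /\
  cintegral leb (fun u => superposition a u * conjc (b u)) =
    cintegral pm (fun Z => a Z * inner (Psi Z) b).
Proof.
move=> ia bL; have ip := cintegrable_superposition ia bL.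
have ia_u u : cintegrable pm (fun Z => a Z * Psi Z u).
  apply: (cintegrable_le (g := fun Z => coherent_cst (n := n) h * normc (a Z))).
  - apply: cmeasurableM; first exact: cintegrable_meas ia.
    exact: cmeasurable_coherent_label.
  - rewrite (_ : _ \o _ = (fun Z => (coherent_cst (n := n) h)%:E * (normc (a Z))%:E)%E)//.
    by apply: integrableZl => //; exact: cintegrable_normc.
  - by move=> Z; rewrite normcM mulrC ler_wpM2r ?normc_ge0// normc_coherent_le.
have E1 u : cintegral pm (fun Z => a Z * (Psi Z u * conjc (b u))) =
    superposition a u * conjc (b u).
  by rewrite /superposition -cintegralZr//; apply: eq_cintegral => Z; rewrite mulrA.
have E2 Z : cintegral leb (fun u => a Z * (Psi Z u * conjc (b u))) = a Z * inner (Psi Z) b.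
  by rewrite cintegralZ//; apply: cintegrable_inner => //; exact: coherent_L2.
split.
  by have := cintegrable_fubini1 ip; apply: eq_cintegrable => u /=; rewrite E1.
transitivity (cintegral (prod_measure leb pm) (fun p => a p.2 * (Psi p.2 p.1 * conjc (b p.1)))).
  by rewrite cintegral_fubini1//; apply: eq_cintegral => u /=; rewrite E1.
by rewrite cintegral_fubini2//; apply: eq_cintegral => Z /=; rewrite E2.
Qed.

Lemma cmeasurable_superposition a : cintegrable pm a -> cmeasurable (superposition a).
Proof.
move=> ia; have [/cintegrable_meas m0 _] := inner_superposition ia (coherent_L2 h_gt0 0).
have c0 := coherent_cst_gt0 (n := n) h_gt0.
rewrite (_ : superposition a = fun u => superposition a u * conjc (Psi 0 u) *
   (Psi 0 u * ((coherent_cst (n := n) h) ^- 2 * expR (dot u u / h))%:C)).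
  apply: cmeasurableM => //; apply: cmeasurableM; first exact: cmeasurable_coherent.
  apply: cmeasurableR; apply: measurable_funM; first exact: measurable_cst.
  apply: measurableT_comp => //; apply: measurable_funM => //; exact: measurable_dot.
apply/funext => u; rewrite -mulrA [conjc _ * _]mulrA [conjc _ * _]mulrC mul_conjc.
rewrite -rmorphM normc_coherent// subr0 exprMn -expRM_natl.
rewrite (_ : _ * (_ * _) = 1) ?mulr1//.
rewrite mulrACA divff ?mul1r; last by rewrite expf_neq0// gt_eqF.
rewrite -expRD -[RHS]expR0; congr expR; field.
by rewrite gt_eqF.
Qed.

Let c : R := (2 * pi * h) ^- n.

Let c_gt0 : 0 < c.
Proof. by rewrite invr_gt0 exprn_gt0// !mulr_gt0// pi_gt0. Qed.

Lemma transform_reproducing f X : L2 f ->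
  c%:C * cintegral pm (fun Z => transform f Z * overlap h Z X) = transform f X.
Proof.
move=> fL; have [_] := inner_superposition (cintegrable_overlap h_gt0 X) fL.
have S u : superposition (overlap h X) u = ((2 * pi * h) ^+ n)%:C * Psi X u.
  rewrite /superposition.
  under eq_cintegral do rewrite mulrC.
  apply: (overlap_reproducing h_gt0 (holo_weighted_coherent h_gt0 u)).
  apply: (cintegrable_le (g := fun Z => coherent_cst (n := n) h * normc (overlap h X Z))).
  - apply: cmeasurableM.
      exact: cmeasurable_coherent_label.
    by apply: cmeasurable_overlap => //; exact: measurable_cst.
  - rewrite (_ : _ \o _ = (fun Z => (coherent_cst (n := n) h)%:E * (normc (overlap h X Z))%:E)%E)//.
    by apply: integrableZl => //; exact: integrable_overlap.
  - by move=> Z; rewrite normcM ler_wpM2r ?normc_ge0// normc_coherent_le.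
under eq_cintegral do rewrite S -mulrA.
rewrite cintegralZ; last by apply: cintegrable_inner => //; exact: coherent_L2.
rewrite -/(inner (Psi X) f) => /(congr1 conjc).
rewrite conjcM conjc_real -transformE// -cintegral_conjc; last first.
  have := cintegrable_overlap h_gt0 X => io.
  apply: (cintegrable_le (g := fun Z => nrm f * normc (overlap h X Z))).
  - apply: cmeasurableM; first exact: cintegrable_meas io.
    by apply: coherent_lip_cmeasurable; exact: coherent_lip_inner.
  - rewrite (_ : _ \o _ = (fun Z => (nrm f)%:E * (normc (overlap h X Z))%:E)%E)//.
    by apply: integrableZl => //; exact: integrable_overlap.
  - move=> Z; rewrite normcM mulrC ler_wpM2r ?normc_ge0//.
    exact: normc_inner_coherent_le.
under [in X in _ = X -> _]eq_cintegral do rewrite conjcM conjc_overlap -transformE// mulrC.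
move=> <-; rewrite mulrA -rmorphM mulVf ?mul1r//.
by rewrite expf_neq0// gt_eqF// !mulr_gt0// pi_gt0.
Qed.

(** When its coherent transform is integrable, a square-integrable function is
    almost everywhere the superposition it prescribes: both have the same
    coherent transform, hence, up to a Gaussian factor, the same Fourier
    transform. *)
Lemma superposition_transform f : L2 f -> cintegrable pm (transform f) ->
  {ae leb, forall u, f u = c%:C * superposition (transform f) u}.
Proof.
move=> fL ia; set a := transform f in ia *.
pose f' u := c%:C * superposition a u.
pose G : vec -> R[i] := fun u => (expR (- (dot u u / (2 * h))))%:C.
have c0 := coherent_cst_gt0 (n := n) h_gt0.
have GE (xi : vec) u : expi (dot u xi) * G u =
    ((coherent_cst (n := n) h)^-1)%:C * conjc (Psi (0, - h *: xi) u).
  rewrite coherent_cexp conjcM conjc_real mulrA -rmorphM mulVf ?gt_eqF// mul1r.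
  rewrite -cexp_imag /G -(cexp_real (- (dot u u / (2 * h)))) -cexpD conjc_cexp; congr cexp.
  apply: complex_ext; rewrite !(ReD, ImD) ?Re_conjc ?Im_conjc /=.
    by rewrite subr0 add0r.
  rewrite dot0l dotZr mul0r subr0 addr0; field.
  by rewrite gt_eqF.
have iX (X : phase) : cintegrable leb (fun u => (f u - f' u) * conjc (Psi X u)) /\
    cintegral leb (fun u => (f u - f' u) * conjc (Psi X u)) = 0.
  have XL := coherent_L2 h_gt0 X.
  have i1 := cintegrable_inner fL XL.
  have [i2 E2] := inner_superposition ia XL.
  have E u : (f u - f' u) * conjc (Psi X u) =
    f u * conjc (Psi X u) - c%:C * (superposition a u * conjc (Psi X u)).
    by rewrite /f'; ring.
  split.
    apply: eq_cintegrable (cintegrableB i1 (cintegrableZ c%:C i2)) => u.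
    by rewrite E.
  under eq_cintegral do rewrite E.
  rewrite cintegralB//; last exact: cintegrableZ.
  rewrite cintegralZ// E2; under [X in _ * X]eq_cintegral do rewrite inner_coherent//.
  by rewrite transform_reproducing// subrr.
have fn : fourier_null (fun u => (f u - f' u) * G u).
  have EE xi u : expi (dot u xi) * ((f u - f' u) * G u) =
      ((coherent_cst (n := n) h)^-1)%:C * ((f u - f' u) * conjc (Psi (0, - h *: xi) u)).
    by rewrite mulrCA GE mulrCA.
  split=> [|xi].
    have [i0 _] := iX (0, - h *: 0).
    apply: eq_cintegrable (cintegrableZ ((coherent_cst (n := n) h)^-1)%:C i0) => u.
    by rewrite -EE dot0r expi0 mul1r.
  under eq_cintegral do rewrite EE.
  have [i0 z0] := iX (0, - h *: xi).
  by rewrite cintegralZ// z0 mulr0.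
have := fourier_null_ae0 fn; apply: filterS => u /eqP.
rewrite mulf_eq0 subr_eq0 => /orP[/eqP//|/eqP[] /eqP].
by rewrite gt_eqF// expR_gt0.
Qed.

Theorem resolution_of_identity f g : L2 f -> L2 g -> cintegrable pm (transform f) ->
  inner f g = c%:C * cintegral pm (fun Z => transform f Z * inner (Psi Z) g).
Proof.
move=> fL gL ia; have [i2 <-] := inner_superposition ia gL.
have ms := cmeasurable_superposition ia.
rewrite (@inner_ae _ _ f (fun u => c%:C * superposition (transform f) u) g).
- by rewrite /inner -cintegralZ//; apply: eq_cintegral => u; rewrite mulrA.
- exact: L2_cmeasurable.
- by apply: cmeasurableM => //; exact: cmeasurable_cst.
- exact: L2_cmeasurable.
- exact: superposition_transform.
Qed.

Lemma normc_small_eq0 (z : R[i]) (K : R) : (forall e : R, 0 < e -> normc z <= e * K) ->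
  z = 0.
Proof.
move=> zP; apply: eq0_normc; apply/eqP; rewrite eq_le normc_ge0 andbT.
apply/ler_addgt0Pr => e e0; rewrite add0r.
have K0 : 0 < `|K| + 1 by rewrite ltr_wpDl.
apply: le_trans (zP (e / (`|K| + 1)) (divr_gt0 e0 K0)) _.
rewrite mulrAC ler_pdivrMr// ler_pM2l//.
by apply: le_trans (ler_norm K) _; rewrite lerDl.
Qed.

(** A bounded operator can be applied under the integral of the resolution of
    the identity; approximate Riesz representatives replace the adjoint. *)
Theorem inner_op_resolution (A : fct -> fct) f g : bounded_op A -> L2 f -> L2 g ->
  cintegrable pm (transform f) ->
  cintegrable pm (fun Z => transform f Z * inner (A (Psi Z)) g) /\
  inner (A f) g = c%:C * cintegral pm (fun Z => transform f Z * inner (A (Psi Z)) g).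
Proof.
move=> bA fL gL ia; have [C C0 CP] := bounded_op_nrm bA; have [AL _ _] := bA.
have mT := coherent_lip_cmeasurable (coherent_lip_op bA gL).
have ma := cintegrable_meas ia.
have iZ (M : R) : pm.-integrable setT (EFin \o (fun Z => M * normc (transform f Z))).
  rewrite (_ : _ \o _ = (fun Z => M%:E * (normc (transform f Z))%:E)%E)//.
  by apply: integrableZl => //; exact: cintegrable_normc.
have bdd (T : phase -> R[i]) (M : R) : cmeasurable T -> (forall Z, normc (T Z) <= M) ->
    cintegrable pm (fun Z => transform f Z * T Z).
  move=> mT' TM; apply: (cintegrable_le (g := fun Z => M * normc (transform f Z))) => //.
    exact: cmeasurableM.
  by move=> Z; rewrite normcM mulrC ler_wpM2r ?normc_ge0.
have iT : cintegrable pm (fun Z => transform f Z * inner (A (Psi Z)) g).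
  apply: (bdd _ (C * nrm g)) => // Z.
  have ZL := coherent_L2 h_gt0 Z.
  apply: le_trans (cauchy_schwarz (AL _ ZL) gL) _; rewrite ler_wpM2r ?nrm_ge0//.
  by have := CP _ ZL; rewrite nrm_coherent// mulr1.
split=> //; apply/eqP; rewrite -subr_eq0; apply/eqP.
set I := \int[pm]_Z normc (transform f Z).
apply: (@normc_small_eq0 _ (nrm f + c * I)) => e e0.
have [k kL kP] := bounded_op_riesz bA gL e0.
have ik : cintegrable pm (fun Z => transform f Z * inner (Psi Z) k).
  apply: (bdd _ (nrm k)) => [|Z]; last exact: normc_inner_coherent_le.
  by apply: coherent_lip_cmeasurable; exact: coherent_lip_inner.
have := resolution_of_identity fL kL ia.
set J := cintegral pm _ => fk; set J' := cintegral pm _.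
rewrite (_ : inner (A f) g - c%:C * J' = (inner (A f) g - inner f k) + c%:C * (J - J')); last first.
  by rewrite fk; ring.
apply: le_trans (le_normcD _ _) _; rewrite [leRHS]mulrDr; apply: lerD; first exact: kP.
rewrite normcM normcRge0 ?(ltW c_gt0)// mulrCA ler_pM2l//.
rewrite /J /J' -cintegralB//.
apply: le_trans (normc_cintegral_le (cintegrableB ik iT)) _.
rewrite /I -RintegralZl//; last exact: cintegrable_normc.
apply: le_Rintegral => //; first exact: cintegrable_normc (cintegrableB ik iT).
move=> Z _; rewrite -mulrBr normcM mulrC ler_wpM2r ?normc_ge0// normcB.
have ZL := coherent_L2 h_gt0 Z.
by have := kP _ ZL; rewrite nrm_coherent// mulr1.
Qed.

End resolution.

(** * Convolution on phase space *)

Section convolution.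
Context {R : realType} {n : nat}.
Local Notation phase := ('rV[R]_n * 'rV[R]_n)%type.
Local Notation pm := (@phase_measure R n).
Variables f g : phase -> \bar R.
Hypotheses (mf : measurable_fun setT f) (mg : measurable_fun setT g).
Hypotheses (f0 : forall V, (0 <= f V)%E) (g0 : forall V, (0 <= g V)%E).

Let F (p : phase * phase) := (f (p.1 - p.2)%R * g p.2)%E.

Let mF : measurable_fun setT F.
Proof.
apply: emeasurable_funM; last exact: (measurableT_comp mg measurable_snd).
apply: measurableT_comp => //; apply: measurable_phaseB;
  [exact: measurable_fst|exact: measurable_snd].
Qed.

Let F0 p : (0 <= F p)%E.
Proof. exact: mule_ge0. Qed.

Lemma measurable_convolution :
  measurable_fun setT (fun V : phase => \int[pm]_U (f (V - U)%R * g U))%E.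
Proof. exact: (measurable_fun_fubini_tonelli_F (m2 := pm) F mF F0). Qed.

Lemma integral_convolution :
  (\int[pm]_V \int[pm]_U (f (V - U)%R * g U) = \int[pm]_V f V * \int[pm]_V g V)%E.
Proof.
rewrite (fubini_tonelli (m1 := pm) (m2 := pm) F mF F0).
have E U : (\int[pm]_V F (V, U) = (\int[pm]_V f V) * g U)%E.
  rewrite -[LHS]/(\int[pm]_V (f (V - U)%R * g U))%E ge0_integralZr//; last first.
    by apply: measurableT_comp => //; case: (preserves_phase_shift (- U)).
  by rewrite (ge0_integral_preserves (f := f) (preserves_phase_shift (- U))).
under eq_integral do rewrite E.
by rewrite ge0_integralZl//; exact: integral_ge0.
Qed.

End convolution.

(** * Composition of operators with integrable confinement *)

Section confinement_composition.
Context {R : realType} {n : nat} (h : R).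
Hypothesis h_gt0 : 0 < h.
Local Notation fct := ('rV[R]_n -> R[i]).
Local Notation phase := ('rV[R]_n * 'rV[R]_n)%type.
Local Notation pm := (@phase_measure R n).
Local Notation Psi := (coherent h).
Implicit Types (X Y Z V U : phase) (A B : fct -> fct).

Lemma confinement_ge X Y A :
  ((normc (inner (A (Psi X)) (Psi Y)))%:E <= confinement h A (X - Y)%R)%E.
Proof. by apply: ereal_sup_ubound; exists (X, Y). Qed.

Lemma confinement_ge0 A V : (0 <= confinement h A V)%E.
Proof.
have := confinement_ge V 0 A; rewrite subr0; apply: le_trans.
by rewrite lee_fin normc_ge0.
Qed.

(** A supremum of continuous functions is lower semicontinuous. *)
Lemma measurable_confinement A : bounded_op A ->
  measurable_fun setT (confinement h A).
Proof.
move=> bA; apply: (lsc_measurable (@phase_network R n)) => V a.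
move=> /ereal_sup_gt[_ [[X Y] XY' <-] aXY'].
have XY : X - Y = V := XY'.
have aXY : a < normc (inner (A (Psi X)) (Psi Y)) by rewrite -lte_fin.
have YL := coherent_L2 h_gt0 Y.
have e0 : 0 < normc (inner (A (Psi X)) (Psi Y)) - a by rewrite subr_gt0.
have [d d0 dP] := coherent_lip_dist h_gt0 X (coherent_lip_op h_gt0 bA YL) e0.
apply/nbhs_ballP; exists d => //= W; rewrite -ball_normE /= => VW.
apply: lt_le_trans (_ : ((normc (inner (A (Psi (Y + W)%R)) (Psi Y)))%:E <= _)%E).
  rewrite lte_fin.
  have WX : `|Y + W - X| < d.
    have -> : Y + W - X = - (V - W) by rewrite -XY !opprB addrA [W + Y]addrC.
    by rewrite normrN.
  have := dP _ WX; rewrite normcB.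
  have := le_normcD (inner (A (Psi X)) (Psi Y) - inner (A (Psi (Y + W))) (Psi Y))
    (inner (A (Psi (Y + W))) (Psi Y)).
  by rewrite subrK => h1 h2; lra.
by have := confinement_ge (Y + W) Y A; rewrite addrAC subrr add0r.
Qed.

Let c : R := (2 * pi * h) ^- n.

Let c_gt0 : 0 < c.
Proof. by rewrite invr_gt0 exprn_gt0// !mulr_gt0// pi_gt0. Qed.

Lemma integral_confinement_lty A : C_h h A ->
  (\int[pm]_V confinement h A V < +oo)%E.
Proof.
move=> [_ /integrableP[_]]; under eq_integral do rewrite gee0_abs ?confinement_ge0//.
by [].
Qed.

Lemma cintegrable_transform_op B X : C_h h B ->
  cintegrable pm (transform h (B (Psi X))).
Proof.
move=> CB; have [bB iB] := CB; have [BL _ _] := bB.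
have fL := BL _ (coherent_L2 h_gt0 X).
apply/cintegrableP; split; first exact: cmeasurable_transform.
apply: le_lt_trans (integral_confinement_lty CB).
rewrite -(ge0_integral_preserves (f := confinement h B) (preserves_phase_reflect X)); last 2 first.
- exact: measurable_confinement.
- by move=> V; exact: confinement_ge0.
apply: ge0_le_integral => //.
- by move=> Z _; rewrite lee_fin normc_ge0.
- by apply: measurable_normcE; exact: cmeasurable_transform.
- apply: measurableT_comp; first exact: measurable_confinement.
  by case: (preserves_phase_reflect X).
- by move=> Z _; exact: confinement_ge.
Qed.

Lemma confinement_comp_le A B V : C_h h A -> C_h h B ->
  (confinement h (A \o B) V <=
    c%:E * \int[pm]_U (confinement h A (V - U)%R * confinement h B U))%E.
Proof.
move=> CA CB; have [bA _] := CA; have [bB _] := CB; have [BL _ _] := bB.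
have mA := measurable_confinement bA; have mB := measurable_confinement bB.
apply: ub_ereal_sup => _ [[X Y] XY' <-]; have XY : X - Y = V := XY'.
rewrite -[leLHS]/((normc (inner (A (B (Psi X))) (Psi Y)))%:E).
have XL := coherent_L2 h_gt0 X; have YL := coherent_L2 h_gt0 Y.
have [iT ->] := inner_op_resolution h_gt0 bA (BL _ XL) YL (cintegrable_transform_op X CB).
rewrite normcM normcRge0 ?(ltW c_gt0)// EFinM.
apply: lee_wpmul2l; first by rewrite lee_fin ltW.
apply: le_trans (normc_cintegral_leE iT) _.
have mVU : measurable_fun setT (fun U => confinement h A (V - U)).
  by apply: measurableT_comp => //; case: (preserves_phase_reflect V).
rewrite -(ge0_integral_preserves
  (f := fun U => (confinement h A (V - U)%R * confinement h B U)%E)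
  (preserves_phase_reflect X)); last 2 first.
- exact: emeasurable_funM.
- by move=> U; rewrite mule_ge0// confinement_ge0.
apply: ge0_le_integral => //.
- by move=> Z _; rewrite lee_fin normc_ge0.
- exact: measurable_normcE (cintegrable_meas iT).
- have mX : measurable_fun setT (fun Z => X - Z) by case: (preserves_phase_reflect X).
  by apply: emeasurable_funM; [exact: (measurableT_comp mVU mX)|exact: (measurableT_comp mB mX)].
move=> Z _; rewrite normcM EFinM muleC; apply: lee_pmul.
- by rewrite lee_fin normc_ge0.
- by rewrite lee_fin normc_ge0.
- rewrite (_ : V - (X - Z) = Z - Y); first exact: confinement_ge.
  by rewrite -XY opprB addrC addrA subrK.
- exact: confinement_ge.
Qed.

Lemma C_h_comp A B : C_h h A -> C_h h B -> C_h h (A \o B).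
Proof.
move=> CA CB; have [bA _] := CA; have [bB _] := CB.
have mA := measurable_confinement bA; have mB := measurable_confinement bB.
have bAB := bounded_op_comp bA bB; split => //.
apply/integrableP; split; first exact: measurable_confinement.
under eq_integral do rewrite gee0_abs ?confinement_ge0//.
have iA := integral_confinement_lty CA; have iB := integral_confinement_lty CB.
have cA := confinement_ge0 A; have cB := confinement_ge0 B.
apply: (@le_lt_trans _ _ (c%:E * \int[pm]_V \int[pm]_U
    (confinement h A (V - U)%R * confinement h B U))%E).
  have mC := measurable_convolution mA mB cA cB.
  rewrite -ge0_integralZl//; last 2 first.
  - by move=> V _; apply: integral_ge0 => U _; exact: mule_ge0.
  - by rewrite lee_fin ltW.
  apply: ge0_le_integral.
  - exact: measurableT.
  - by move=> V _; exact: confinement_ge0.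
  - exact: measurable_confinement.
  - exact: measurable_funeM.
  - by move=> V _; exact: confinement_comp_le.
rewrite integral_convolution//.
apply: lte_mul_pinfty => //; first by rewrite lee_fin ltW.
have iA0 : (0 <= \int[pm]_V confinement h A V)%E by apply: integral_ge0 => V _; exact: cA.
move: iA iA0 iB; move: (integral _ _ _) (integral _ _ _) => x y xoo x0 yoo.
by apply: lte_mul_pinfty => //; rewrite ge0_fin_numE.
Qed.

End confinement_composition.

(** * Power series *)

Lemma sum_fsetD (V : nmodType) (I : choiceType) (A B : {fset I}) (F : I -> V) :
  (A `<=` B)%fset ->
  \sum_(i <- B) F i = \sum_(i <- A) F i + \sum_(i <- (B `\` A)%fset) F i.
Proof.
move=> AB; rewrite (big_fsetID _ (mem A)) /=; congr (_ + _); apply: eq_fbigl => i.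
  by rewrite !inE; case: (boolP (i \in A)) => [/(fsubsetP AB)->|]; rewrite ?andbF.
by rewrite !inE andbC.
Qed.

Section power_series.
Context {R : realType}.

(** Convergence along all finite sets bounds the positive and the negative
    parts of the real and of the imaginary parts separately. *)
Lemma csum_bounded (I : choiceType) (u : I -> R[i]) (s : R[i]) : has_csum u s ->
  exists2 C : R, 0 <= C & forall A : {fset I}, \sum_(i <- A) normc (u i) <= C.
Proof.
move=> us; have [A0 A0P] := us 1 ltr01.
have small (B : {fset I}) : [disjoint A0 & B]%fset -> normc (\sum_(i <- B) u i) <= 2.
  move=> dB; have := A0P (A0 `|` B)%fset (fsubsetUl _ _).
  have := A0P A0 (fsubset_refl _).
  rewrite (sum_fsetD u (fsubsetUl A0 B)) fsetDUl fsetDv fset0U.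
  rewrite (fsetDidPl _ _ _) 1?fdisjoint_sym// => h1 h2.
  rewrite (_ : \sum_(i <- B) u i = (\sum_(i <- A0) u i + \sum_(i <- B) u i - s)
      - (\sum_(i <- A0) u i - s)); last by ring.
  by apply: le_trans (le_normcB _ _) _; lra.
have part (g : R[i] -> R) : {morph g : x y / x + y} -> g 0 = 0 ->
    (forall z, `|g z| <= normc z) -> forall B : {fset I}, [disjoint A0 & B]%fset ->
    \sum_(i <- B) `|g (u i)| <= 4.
  move=> gD g0 gn B dB.
  have sub (P : pred I) : `|\sum_(i <- B | P i) g (u i)| <= 2.
    rewrite -(big_morph g gD g0); apply: le_trans (gn _) _.
    rewrite big_fset_condE; apply: small.
    by apply: fdisjointWr dB; apply/fsubsetP => x; rewrite !inE => /andP[].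
  rewrite (bigID (fun i => 0 <= g (u i)))/=.
  rewrite (_ : (4 : R) = 2 + 2); last by ring.
  apply: lerD.
    apply: le_trans (sub (fun i => 0 <= g (u i))); apply: le_trans (ler_norm _).
    by apply: ler_sum => i /ger0_norm ->.
  apply: le_trans (sub (fun i => ~~ (0 <= g (u i)))).
  rewrite -normrN; apply: le_trans (ler_norm _); rewrite -sumrN.
  by apply: ler_sum => i; rewrite -ltNge => /ltr0_norm ->.
exists (\sum_(i <- A0) normc (u i) + 8).
  by rewrite addr_ge0//; apply: sumr_ge0 => i _; exact: normc_ge0.
move=> A; apply: (@le_trans _ _ (\sum_(i <- (A0 `|` A)%fset) normc (u i))).
  rewrite (sum_fsetD _ (fsubsetUr A0 A)) lerDl.
  by apply: sumr_ge0 => i _; exact: normc_ge0.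
rewrite (sum_fsetD _ (fsubsetUl A0 A)) lerD2l.
set B := (_ `\` A0)%fset.
have dB : [disjoint A0 & B]%fset by apply/fdisjointP => x xA; rewrite !inE xA.
apply: (@le_trans _ _ (\sum_(i <- B) (`|complex.Re (u i)| + `|complex.Im (u i)|))).
  by apply: ler_sum => i _; exact: normc_le_ReIm.
rewrite big_split/= (_ : (8 : R) = 4 + 4); last by ring.
by apply: lerD; apply: part => //; [exact: ReD|exact: Re_le_normc|exact: ImD|exact: Im_le_normc].
Qed.

(** Differentiability in the strict sense, with derivative [L] at [x0]. *)
Definition strictly_derivable (V : normedModType R) (f : V -> R[i]) (x0 : V)
    (L : V -> R[i]) :=
  forall e : R, 0 < e -> exists2 d : R, 0 < d & forall x y,
    `|x - x0| < d -> `|y - x0| < d -> normc (f x - f y - L (x - y)) <= e * `|x - y|.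

Definition multi_exp m := {ffun 'I_m -> nat}.

Definition degree m (alpha : multi_exp m) := (\sum_i alpha i)%N.

Definition unit_exp m (k : 'I_m) : multi_exp m := [ffun i => nat_of_bool (i == k)].

Definition monomial m (alpha : multi_exp m) (v : 'rV[R]_m) : R :=
  \prod_i v ord0 i ^+ alpha i.

Lemma monomial_unit m (k : 'I_m) v : monomial (unit_exp k) v = v ord0 k.
Proof.
rewrite /monomial (bigD1 k)//= ffunE eqxx expr1 big1 ?mulr1// => i ik.
by rewrite ffunE (negbTE ik).
Qed.

Lemma degree0 m (alpha : multi_exp m) v : degree alpha = 0%N -> monomial alpha v = 1.
Proof.
move=> /eqP; rewrite sum_nat_eq0 => /forallP a0; rewrite /monomial big1// => i _.
by rewrite (eqP (implyP (a0 i) isT)).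
Qed.

Lemma degree1 m (alpha : multi_exp m) : degree alpha = 1%N ->
  exists k, alpha = unit_exp k.
Proof.
move=> a1; case: (pickP (fun k => alpha k != 0%N)) => [k ak|a0]; last first.
  by move: a1; rewrite /degree big1// => i _; apply/eqP; rewrite -[_ == _]negbK a0.
exists k; apply/ffunP => i; rewrite ffunE; move: a1 ak; rewrite /degree (bigD1 k)//=.
case: (eqVneq i k) => [->|ik].
  by move=> + a0; rewrite -lt0n in a0; move: (\sum_(_ | _) _)%N => x h; apply/eqP => /=; rewrite eqn_leq a0 andbT -h leq_addr.
rewrite (bigD1 i)//= -lt0n; move: (alpha k) (alpha i) (\sum_(_ | _) _)%N => x y z.
by case: x => // x /eqP; rewrite addSn eqSS !addn_eq0 => /and3P[_ /eqP].
Qed.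

Lemma unit_exp_inj m : injective (@unit_exp m).
Proof.
move=> k l /ffunP/(_ k); rewrite !ffunE eqxx; by case: eqVneq.
Qed.

Lemma monomial_bound m (alpha : multi_exp m) (v : 'rV[R]_m) (d : R) :
  (forall i, `|v ord0 i| <= d) -> `|monomial alpha v| <= d ^+ degree alpha.
Proof.
move=> vd; rewrite /monomial /degree normr_prod expr_sum.
apply: ler_prod => i _; rewrite normr_ge0 normrX lerXn2r// nnegrE//.
exact: le_trans (vd i).
Qed.

(** Multiplying by [d] avoids the exponent [degree alpha - 1]. *)
Lemma monomial_lip m (alpha : multi_exp m) (v w : 'rV[R]_m) (d e : R) : 0 < d ->
  (forall i, `|v ord0 i| <= d) -> (forall i, `|w ord0 i| <= d) ->
  (forall i, `|v ord0 i - w ord0 i| <= e) ->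
  `|monomial alpha v - monomial alpha w| * d <=
    (degree alpha)%:R * d ^+ degree alpha * e.
Proof.
move=> d0 vd wd vwe.
pose Q (x y : R) (k : nat) := [/\ `|x| <= d ^+ k, `|y| <= d ^+ k & `|x - y| * d <= k%:R * d ^+ k * e].
have QM x y k x' y' k' : Q x y k -> Q x' y' k' -> Q (x * x') (y * y') (k + k')%N.
  move=> [x1 y1 xy] [x2 y2 xy']; have dk := exprn_gt0 k d0; have dk' := exprn_gt0 k' d0.
  split; first by rewrite normrM exprD ler_pM.
    by rewrite normrM exprD ler_pM.
  rewrite (_ : x * x' - y * y' = (x - y) * x' + y * (x' - y')); last by ring.
  apply: (@le_trans _ _ ((`|x - y| * d) * `|x'| + `|y| * (`|x' - y'| * d))).
    rewrite mulrAC mulrA -mulrDl; apply: ler_wpM2r; first exact: ltW.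
    by apply: le_trans (ler_normD _ _) _; rewrite !normrM.
  rewrite natrD exprD (_ : _ * e = (k%:R * d ^+ k * e) * d ^+ k' + d ^+ k * (k'%:R * d ^+ k' * e)); last by ring.
  by apply: lerD; apply: ler_pM => //; rewrite mulr_ge0// ltW.
have Q1 : Q 1 1 0%N by split; rewrite ?expr0 ?normr1// subrr normr0 !mul0r.
suff [] : Q (monomial alpha v) (monomial alpha w) (degree alpha) by [].
rewrite /monomial /degree; elim/big_rec3: _ => // i x y k _ Qk.
apply: (QM _ _ _ _ _ _ _ Qk); elim: (alpha i) => [|a IH]; first by rewrite !expr0.
rewrite !exprS; apply: (QM _ _ 1%N) => //; split; rewrite ?expr1// mul1r mulrC.
by rewrite ler_wpM2l// ltW.
Qed.

Lemma expn_quadratic (d rho : R) j : 0 < d -> 2 * d <= rho ->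
  (j.+2)%:R * d ^+ j <= 4 * rho ^+ j.
Proof.
move=> d0 dr; elim: j => [|j IH]; first by rewrite !expr0; lra.
have dj := exprn_gt0 j d0; rewrite !exprS.
have : (0 : R) <= j%:R by [].
have rj : 0 < rho ^+ j by rewrite exprn_gt0//; lra.
have e1 : (j.+2)%:R = j%:R + 2 :> R by rewrite -[j.+2]addn2 natrD.
have e2 : (j.+3)%:R = j%:R + 3 :> R by rewrite -[j.+3]addn3 natrD.
move: IH; rewrite e1 e2 => IH j0; rewrite mulrCA [leRHS]mulrCA.
have t0 : 0 < d ^+ j * d by rewrite mulr_gt0.
have := mulr_ge0 j0 (ltW t0) => jt.
have h1 : d * ((j%:R + 3) * d ^+ j) <= (j%:R + 2) * d ^+ j * (2 * d) by lra.
apply: le_trans h1 _; apply: le_trans (ler_wpM2r _ IH) _; first by lra.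
by rewrite mulrC; apply: ler_wpM2r => //; lra.
Qed.

(** At the centre of a power series the terms of degree at least two are
    quadratically small, in the Lipschitz sense. *)
Lemma power_series_strict m (f : 'rV[R]_m -> R[i]) p (a : multi_exp m -> R[i]) (r : R) :
  0 < r -> (forall v : 'rV[R]_m, (forall i, `|v ord0 i| < r) ->
    has_csum (fun alpha => a alpha * (monomial alpha v)%:C) (f (p + v))) ->
  strictly_derivable f p (fun v => \sum_k a (unit_exp k) * (v ord0 k)%:C).
Proof.
move=> r0 fP; pose rho := r / 2; have rho0 : 0 < rho by rewrite divr_gt0.
have rhor : rho < r by rewrite /rho; lra.
have [C C0 CP] : exists2 C : R, 0 <= C & forall A : {fset multi_exp m},
    \sum_(alpha <- A) normc (a alpha) * rho ^+ degree alpha <= C.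
  have rv i : `|(const_mx rho : 'rV[R]_m) ord0 i| < r by rewrite mxE ger0_norm ?ltW.
  have [C C0 CP] := csum_bounded (fP _ rv); exists C => // A.
  apply: le_trans (CP A); apply: ler_sum => alpha _; rewrite normcM.
  rewrite (_ : monomial _ _ = rho ^+ degree alpha) ?normcRge0// ?exprn_ge0 ?ltW//.
  by rewrite /monomial /degree expr_sum; apply: eq_bigr => i _; rewrite mxE.
pose A1 := [fset unit_exp k | k in 'I_m]%fset.
pose l (alpha : multi_exp m) (v : 'rV[R]_m) :=
  \sum_k (if alpha == unit_exp k then v ord0 k else 0).
have lE k v : l (unit_exp k) v = v ord0 k.
  rewrite /l (bigD1 k)//= eqxx big1 ?addr0// => i ik.
  by rewrite (inj_eq (@unit_exp_inj m)) eq_sym (negbTE ik).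
have l0 alpha v : alpha \notin A1 -> l alpha v = 0.
  move=> aA; rewrite /l big1// => k _; case: eqP => // ak; move: aA.
  by rewrite ak in_imfset.
move=> e e0; pose d := Num.min (rho / 2) (e * rho ^+ 2 / (4 * (C + 1))).
have C1 : 0 < C + 1 by rewrite ltr_wpDl.
have d0 : 0 < d.
  by rewrite lt_min !divr_gt0// ?mulr_gt0 ?exprn_gt0.
have d1 : 2 * d <= rho.
  have : d <= rho / 2 by rewrite ge_min lexx.
  by move=> ?; lra.
have d2 : d * (4 * (C + 1)) <= e * rho ^+ 2.
  by rewrite -ler_pdivlMr ?mulr_gt0// ge_min lexx orbT.
clearbody d; exists d => // x y xd yd.
set v := x - p in xd; set w := y - p in yd.
have vd i : `|v ord0 i| <= d := le_trans (rvec_coord_le v i) (ltW xd).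
have wd i : `|w ord0 i| <= d := le_trans (rvec_coord_le w i) (ltW yd).
have vwE : x - y = v - w by rewrite /v /w opprB addrA subrK.
have vwd i : `|v ord0 i - w ord0 i| <= `|x - y|.
  by have := rvec_coord_le (v - w) i; rewrite !mxE vwE.
have vr i : `|v ord0 i| < r by apply: le_lt_trans (vd i) _; lra.
have wr i : `|w ord0 i| < r by apply: le_lt_trans (wd i) _; lra.
have xE : x = p + v by rewrite /v addrC subrK.
have yE : y = p + w by rewrite /w addrC subrK.
set E := `|x - y| in vwd *; have E0 : 0 <= E := normr_ge0 _.
have term alpha : normc (a alpha * ((monomial alpha v)%:C - (monomial alpha w)%:C)
     - a alpha * (l alpha (v - w))%:C) <=
    normc (a alpha) * rho ^+ degree alpha * (4 * d / rho ^+ 2 * E).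
  rewrite -mulrBr normcM -!rmorphB normcR -mulrA; apply: ler_wpM2l; first exact: normc_ge0.
  have b0 : 0 <= rho ^+ degree alpha * (4 * d / rho ^+ 2 * E).
    by rewrite !mulr_ge0 ?exprn_ge0 ?invr_ge0 ?exprn_ge0// ltW.
  case: (boolP (alpha \in A1)) => [/imfsetP[k _ ak]|aA].
    by move: b0; rewrite ak lE !monomial_unit !mxE subrr normr0.
  rewrite l0// subr0; case dE : (degree alpha) => [|[|j]].
  - by move: b0; rewrite !(degree0 _ dE) subrr normr0 dE.
  - by have [k ak] := degree1 dE; move: aA; rewrite ak in_imfset.
  have := monomial_lip alpha d0 vd wd vwd; rewrite dE => h1.
  rewrite -(ler_pM2r d0); apply: le_trans h1 _.
  have := expn_quadratic j d0 d1 => h2.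
  rewrite (_ : _ * d ^+ j.+2 * E = (j.+2%:R * d ^+ j) * (d ^+ 2 * E)); last by rewrite !exprS; ring.
  rewrite (_ : rho ^+ j.+2 * _ * d = (4 * rho ^+ j) * (d ^+ 2 * E)); last first.
    by rewrite !exprS expr0; field; rewrite gt_eqF.
  by apply: ler_wpM2r => //; rewrite mulr_ge0// exprn_ge0// ltW.
apply/ler_addgt0Pr => eps eps0.
have eps2 : 0 < eps / 2 by rewrite divr_gt0.
have [Ax AxP] := fP v vr _ eps2; have [Ay AyP] := fP w wr _ eps2.
pose A := (A1 `|` (Ax `|` Ay))%fset.
have := AxP A; have := AyP A; rewrite -xE -yE => hy hx.
have {}hx : normc (\sum_(alpha <- A) a alpha * (monomial alpha v)%:C - f x) < eps / 2.
  by apply: hx; rewrite /A fsubsetU// fsubsetUl orbT.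
have {}hy : normc (\sum_(alpha <- A) a alpha * (monomial alpha w)%:C - f y) < eps / 2.
  by apply: hy; rewrite /A fsubsetU// fsubsetUr orbT.
have LE : \sum_k a (unit_exp k) * ((x - y) ord0 k)%:C =
    \sum_(alpha <- A) a alpha * (l alpha (v - w))%:C.
  rewrite -(@big_fset_incl _ _ _ _ A1 A); last 2 first.
  - exact: fsubsetUl.
  - by move=> alpha _ aA; rewrite l0// mulr0.
  rewrite big_imfset/=; last by move=> ? ? _ _; exact: unit_exp_inj.
  by rewrite big_enum/=; apply: eq_bigr => k _; rewrite lE vwE.
rewrite LE.
set Sx := \sum_(_ <- A) _ in hx; set Sy := \sum_(_ <- A) _ in hy; set Sl := \sum_(_ <- A) _.
have hS : normc (Sx - Sy - Sl) <= C * (4 * d / rho ^+ 2 * E).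
  rewrite /Sx /Sy /Sl -!sumrB; apply: le_trans (le_normc_sum _ _ _) _.
  apply: (@le_trans _ _ (\sum_(alpha <- A) normc (a alpha) * rho ^+ degree alpha *
       (4 * d / rho ^+ 2 * E))).
    by apply: ler_sum => alpha _; rewrite -mulrBr; exact: term.
  rewrite -mulr_suml; apply: ler_wpM2r => //.
  by rewrite !mulr_ge0 ?invr_ge0 ?exprn_ge0// ltW.
rewrite (_ : f x - f y - Sl = (Sx - Sy - Sl) - (Sx - f x) + (Sy - f y)); last by ring.
apply: le_trans (le_normcD _ _) _.
have := le_normcB (Sx - Sy - Sl) (Sx - f x).
suff : C * (4 * d / rho ^+ 2 * E) <= e * E by move=> ? ?; lra.
rewrite mulrA; apply: ler_wpM2r => //.
rewrite mulrA ler_pdivrMr ?exprn_gt0//; apply: le_trans d2.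
by nra.
Qed.

End power_series.

(** * Cauchy-Riemann equations *)

Section real_linear.
Context {R : realType} {V : normedModType R}.
Implicit Types (L : V -> R[i]) (f : V -> R[i]).

Definition rlinear L := (forall x y, L (x + y) = L x + L y) /\
  (forall (t : R) x, L (t *: x) = t%:C * L x).

Lemma rlinearB L x y : rlinear L -> L (x - y) = L x - L y.
Proof. by move=> [LD LZ]; rewrite LD -scaleN1r LZ rmorphN mulN1r. Qed.

Lemma rlinear0 L : rlinear L -> L 0 = 0.
Proof. by move=> lL; rewrite -(subrr 0) rlinearB// subrr. Qed.

Lemma rlinear_sum L (I : Type) (r : seq I) (F : I -> V) : rlinear L ->
  L (\sum_(i <- r) F i) = \sum_(i <- r) L (F i).
Proof. by move=> lL; apply: (big_morph L); [case: lL|exact: rlinear0]. Qed.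

Lemma rlinear_conjc L : rlinear L -> rlinear (fun x => conjc (L x)).
Proof.
move=> [LD LZ]; split=> [x y|t x]; first by rewrite LD rmorphD.
by rewrite LZ conjcM conjc_real.
Qed.

Lemma strictly_derivable_conjc f x L : strictly_derivable f x L ->
  strictly_derivable (fun y => conjc (f y)) x (fun y => conjc (L y)).
Proof.
move=> fL e e0; have [d d0 dP] := fL e e0; exists d => // y z yd zd.
by rewrite -!rmorphB normc_conjc; exact: dP.
Qed.

Lemma strictly_derivable_cderive f x L v : rlinear L -> strictly_derivable f x L ->
  cderive v f x = L v.
Proof.
move=> [_ LZ] fL.
have near (e : R) : 0 < e -> exists2 d : R, 0 < d &
    forall t, `|t| < d -> normc (f (t *: v + x) - f x - t%:C * L v) <= e * `|t|.
  move=> e0; pose c := `|v| + 1; have c0 : 0 < c by rewrite ltr_wpDl.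
  have [d d0 dP] := fL (e / c) (divr_gt0 e0 c0).
  exists (d / c) => [|t]; first exact: divr_gt0.
  rewrite ltr_pdivlMr// => td.
  have n1 : `|t *: v| <= `|t| * c by rewrite normrZ ler_wpM2l// lerDl.
  have := dP (t *: v + x) x; rewrite addrK subrr normr0 LZ => /(_ (le_lt_trans n1 td) d0).
  move=> /le_trans; apply; rewrite mulrAC ler_pdivrMr// -mulrA.
  by apply: ler_wpM2l => //; exact: ltW.
rewrite /cderive; apply: complex_ext => /=.
  suff : is_derive x v (fun y => complex.Re (f y)) (complex.Re (L v)) by move=> [_ ->].
  apply: dist_is_derive => e /near[d d0 dP]; exists d => // t /dP; apply: le_trans.
  by apply: le_trans (Re_le_normc _); rewrite !ReD !ReN ReM /= mul0r subr0.
suff : is_derive x v (fun y => complex.Im (f y)) (complex.Im (L v)) by move=> [_ ->].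
apply: dist_is_derive => e /near[d d0 dP]; exists d => // t /dP; apply: le_trans.
by apply: le_trans (Im_le_normc _); rewrite !ImD !ImN ImM /= mul0r addr0.
Qed.

End real_linear.

Section phase_rows.
Context {R : realType} {n : nat}.
Local Notation phase := ('rV[R]_n * 'rV[R]_n)%type.
Local Notation row2 := 'rV[R]_((n + n) + (n + n)).
Implicit Types (X Y : phase) (Fe : phase -> phase -> R[i]).

Definition phases_of_row (w : row2) : phase * phase :=
  (phase_of_row (lsubmx w), phase_of_row (rsubmx w)).

Definition row_of_phases X Y : row2 := row_mx (row_mx X.1 X.2) (row_mx Y.1 Y.2).

Lemma row_of_phasesK X Y : phases_of_row (row_of_phases X Y) = (X, Y).
Proof.
rewrite /phases_of_row /row_of_phases row_mxKl row_mxKr.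
by rewrite /phase_of_row !row_mxKl !row_mxKr -!surjective_pairing.
Qed.

Lemma row_of_phasesD X Y X' Y' :
  row_of_phases X Y + row_of_phases X' Y' = row_of_phases (X + X') (Y + Y').
Proof. by rewrite /row_of_phases !add_row_mx. Qed.

Lemma row_of_phasesZ (t : R) X Y :
  t *: row_of_phases X Y = row_of_phases (t *: X) (t *: Y).
Proof. by rewrite /row_of_phases !scale_row_mx. Qed.

Lemma row_of_phasesB X Y X' Y' :
  row_of_phases X Y - row_of_phases X' Y' = row_of_phases (X - X') (Y - Y').
Proof. by rewrite -scaleN1r row_of_phasesZ row_of_phasesD !scaleN1r. Qed.

Lemma phases_of_rowD (w w' : row2) :
  phases_of_row (w + w') = phases_of_row w + phases_of_row w'.
Proof. by congr pair; congr pair; apply/matrixP => i j; rewrite !mxE. Qed.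

Lemma phases_of_rowZ (t : R) (w : row2) :
  phases_of_row (t *: w) = t *: phases_of_row w.
Proof. by congr pair; congr pair; apply/matrixP => i j; rewrite !mxE. Qed.

Lemma norm_phases_of_row (w : row2) :
  `|(phases_of_row w).1| <= `|w| /\ `|(phases_of_row w).2| <= `|w|.
Proof.
split; rewrite prod_normE ge_max; apply/andP; split;
  apply: rvec_norm_le => // i; rewrite !mxE; exact: rvec_coord_le.
Qed.

Lemma norm_row_mx_le m k (u : 'rV[R]_m) (v : 'rV[R]_k) e :
  `|u| <= e -> `|v| <= e -> `|row_mx u v| <= e.
Proof.
move=> ue ve; apply: rvec_norm_le => [|i]; first exact: le_trans ue.
by rewrite mxE; case: fintype.split => j; [apply: le_trans ue|apply: le_trans ve]; exact: rvec_coord_le.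
Qed.

Lemma norm_row_of_phases X Y e : `|X| <= e -> `|Y| <= e -> `|row_of_phases X Y| <= e.
Proof.
rewrite !prod_normE !ge_max => /andP[? ?] /andP[? ?].
by apply: norm_row_mx_le; exact: norm_row_mx_le.
Qed.

Lemma phase_expansion X :
  X = \sum_j (X.1 ord0 j *: dir_pos j + X.2 ord0 j *: dir_mom j).
Proof.
have S1 (F : 'I_n -> phase) : (\sum_j F j).1 = \sum_j (F j).1.
  by elim/big_rec2: _ => // j x y _ <-.
have S2 (F : 'I_n -> phase) : (\sum_j F j).2 = \sum_j (F j).2.
  by elim/big_rec2: _ => // j x y _ <-.
have E j : X.1 ord0 j *: dir_pos j + X.2 ord0 j *: dir_mom j =
    (X.1 ord0 j *: delta_mx ord0 j, X.2 ord0 j *: delta_mx ord0 j).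
  by congr pair; rewrite /= scaler0 ?addr0 ?add0r.
under eq_bigr do rewrite E.
by rewrite [RHS]surjective_pairing S1 S2 -!row_sum_delta -surjective_pairing.
Qed.

(** A real-linear form that satisfies the Cauchy-Riemann equations on the basis
    vectors is complex-linear. *)
Lemma cauchy_riemann_clinear (L : phase -> R[i]) : rlinear L ->
  (forall j, L (dir_pos j) + (0 +i* 1) * L (dir_mom j) = 0) -> clinear L.
Proof.
move=> lL CR.
have ii : (0 +i* 1) * (0 +i* 1) = -1 :> R[i].
  by apply: complex_ext => /=; ring.
have Lm j : L (dir_mom j) = (0 +i* 1) * L (dir_pos j).
  have := CR j => /eqP; rewrite addr_eq0 => /eqP ->.
  by rewrite mulrN mulrA ii mulN1r opprK.
have LE X : L X = \sum_j (X.1 ord0 j +i* X.2 ord0 j) * L (dir_pos j).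
  rewrite {1}(phase_expansion X) rlinear_sum//; apply: eq_bigr => j _.
  have [-> LZ] := lL; rewrite !LZ Lm mulrA -mulrDl; congr (_ * _).
  by apply: complex_ext; rewrite !(ReD, ImD, ReM, ImM) /=; ring.
split; first by case: lL.
  move=> z X; rewrite !LE mulr_sumr; apply: eq_bigr => j _; rewrite mulrA; congr (_ * _).
  by apply: complex_ext; rewrite !(ReM, ImM) /= !mxE; ring.
exists (\sum_j 2 * normc (L (dir_pos j))).
  by apply: sumr_ge0 => j _; rewrite mulr_ge0// normc_ge0.
move=> X; rewrite LE mulr_suml; apply: le_trans (le_normc_sum _ _ _) _.
apply: ler_sum => j _; rewrite normcM mulrAC; apply: ler_wpM2r; first exact: normc_ge0.
have h1 := rvec_coord_le X.1 j; have h2 := rvec_coord_le X.2 j.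
have X1 : `|X.1| <= `|X| by rewrite prod_normE le_max lexx.
have X2 : `|X.2| <= `|X| by rewrite prod_normE le_max lexx orbT.
by have := normc_le_ReIm (X.1 ord0 j +i* X.2 ord0 j); move=> /= ?; lra.
Qed.

Lemma strictly_derivable_row_l (f : row2 -> R[i]) X Y L :
  strictly_derivable f (row_of_phases X Y) L ->
  strictly_derivable (fun Z => f (row_of_phases Z Y)) X (fun Z => L (row_of_phases Z 0)).
Proof.
move=> fL e e0; have [d d0 dP] := fL e e0; exists d => // Z W Zd Wd.
have nle (U : phase) : `|row_of_phases U 0| <= `|U|.
  by apply: norm_row_of_phases; rewrite ?normr0.
have E U U' : row_of_phases U Y - row_of_phases U' Y = row_of_phases (U - U') 0.
  by rewrite row_of_phasesB subrr.
rewrite -E; apply: le_trans (dP _ _ _ _) _; rewrite E.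
- exact: le_lt_trans (nle _) _.
- exact: le_lt_trans (nle _) _.
- by apply: ler_wpM2l (nle _); exact: ltW.
Qed.

Lemma strictly_derivable_row_r (f : row2 -> R[i]) X Y L :
  strictly_derivable f (row_of_phases X Y) L ->
  strictly_derivable (fun Z => f (row_of_phases X Z)) Y (fun Z => L (row_of_phases 0 Z)).
Proof.
move=> fL e e0; have [d d0 dP] := fL e e0; exists d => // Z W Zd Wd.
have nle (U : phase) : `|row_of_phases 0 U| <= `|U|.
  by apply: norm_row_of_phases; rewrite ?normr0.
have E U U' : row_of_phases X U - row_of_phases X U' = row_of_phases 0 (U - U').
  by rewrite row_of_phasesB subrr.
rewrite -E; apply: le_trans (dP _ _ _ _) _; rewrite E.
- exact: le_lt_trans (nle _) _.
- exact: le_lt_trans (nle _) _.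
- by apply: ler_wpM2l (nle _); exact: ltW.
Qed.

Lemma rlinear_row_l (L : row2 -> R[i]) : rlinear L -> rlinear (fun Z => L (row_of_phases Z 0)).
Proof.
move=> [LD LZ]; split => [X Y|t X]; first by rewrite -LD row_of_phasesD addr0.
by rewrite -LZ row_of_phasesZ scaler0.
Qed.

Lemma rlinear_row_r (L : row2 -> R[i]) : rlinear L -> rlinear (fun Z => L (row_of_phases 0 Z)).
Proof.
move=> [LD LZ]; split => [X Y|t X]; first by rewrite -LD row_of_phasesD addr0.
by rewrite -LZ row_of_phasesZ scaler0.
Qed.

Lemma strictly_derivable_holo (f : phase -> R[i]) :
  (forall X, exists2 L, clinear L & strictly_derivable f X L) -> holo f.
Proof. by []. Qed.

Lemma real_analytic_strict m (f : 'rV[R]_m -> R[i]) p : real_analytic f ->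
  exists2 L, rlinear L & strictly_derivable f p L.
Proof.
move=> fA; have [a [r r0 aP]] := fA p; exists (fun v : 'rV[R]_m => \sum_k a (unit_exp k) * (v ord0 k)%:C).
  split=> [x y|t x]; first by rewrite -big_split; apply: eq_bigr => k _; rewrite mxE rmorphD mulrDr.
  by rewrite mulr_sumr; apply: eq_bigr => k _; rewrite mxE rmorphM mulrCA.
exact: power_series_strict r0 aP.
Qed.

Lemma rlinear_delta m (L : 'rV[R]_m -> R[i]) v : rlinear L ->
  L v = \sum_k L (delta_mx 0 k) * (v ord0 k)%:C.
Proof.
move=> lL; rewrite {1}[v]row_sum_delta rlinear_sum//; apply: eq_bigr => k _.
by have [_ ->] := lL; rewrite mulrC.
Qed.

Lemma rlinear_bounded m (L : 'rV[R]_m -> R[i]) : rlinear L ->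
  exists2 C : R, 0 <= C & forall v, normc (L v) <= C * `|v|.
Proof.
move=> lL; exists (\sum_k normc (L (delta_mx 0 k))).
  by apply: sumr_ge0 => k _; exact: normc_ge0.
move=> v; rewrite (rlinear_delta v lL); apply: le_trans (le_normc_sum _ _ _) _.
rewrite mulr_suml; apply: ler_sum => k _; rewrite normcM normcR.
by apply: ler_wpM2l; [exact: normc_ge0|exact: rvec_coord_le].
Qed.

Section sesqui_ext.
Variables (h : R) (F : phase -> R[i]) (Fe : phase -> phase -> R[i]).
Hypothesis FeP : is_sesqui_ext h F Fe.

Let f (w : row2) := Fe (phases_of_row w).1 (phases_of_row w).2.

Let fE X Y : f (row_of_phases X Y) = Fe X Y.
Proof. by rewrite /f row_of_phasesK. Qed.

Let f_strict w : exists2 L, rlinear L & strictly_derivable f w L.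
Proof. by apply: real_analytic_strict; case: FeP. Qed.

Lemma sesqui_ext_holo_l Y : holo (Fe^~ Y).
Proof.
apply: strictly_derivable_holo => X; have [L lL Lf] := f_strict (row_of_phases X Y).
have lL' := rlinear_row_l lL; have Lf' := strictly_derivable_row_l Lf.
exists (fun Z => L (row_of_phases Z 0)); last first.
  by rewrite (_ : Fe^~ Y = fun Z => f (row_of_phases Z Y))//; apply/funext => Z; rewrite fE.
apply: cauchy_riemann_clinear => // j; have [_ /(_ j X Y)[+ _] _ _] := FeP.
rewrite (_ : Fe^~ Y = fun Z => f (row_of_phases Z Y)); last by apply/funext => Z; rewrite fE.
by rewrite !(strictly_derivable_cderive _ lL' Lf').
Qed.

Lemma sesqui_ext_holo_r X : holo (fun Y => conjc (Fe X Y)).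
Proof.
apply: strictly_derivable_holo => Y; have [L lL Lf] := f_strict (row_of_phases X Y).
have lL' := rlinear_row_r lL; have Lf' := strictly_derivable_row_r Lf.
have FeE : Fe X = fun Z => f (row_of_phases X Z) by apply/funext => Z; rewrite fE.
exists (fun Z => conjc (L (row_of_phases 0 Z))); last first.
  by rewrite FeE; exact: strictly_derivable_conjc.
apply: cauchy_riemann_clinear; first exact: rlinear_conjc.
move=> j; have [_ /(_ j X Y)[_ +] _ _] := FeP; rewrite FeE.
rewrite !(strictly_derivable_cderive _ lL' Lf') => /eqP; rewrite subr_eq0 => /eqP ->.
rewrite conjcM (_ : conjc (0 +i* 1) = - (0 +i* 1)) ?mulNr ?addNr//.
by apply: complex_ext => /=; rewrite ?oppr0.
Qed.

Lemma sesqui_ext_cmeasurable : cmeasurable (fun p : phase * phase => Fe p.1 p.2).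
Proof.
have cont (p0 : phase * phase) (e : R) : 0 < e ->
    \forall p \near p0, normc (Fe p.1 p.2 - Fe p0.1 p0.2) < e.
  move=> e0; have [L lL Lf] := f_strict (row_of_phases p0.1 p0.2).
  have [C C0 CP] := rlinear_bounded lL; have [d d0 dP] := Lf 1 ltr01.
  have C1 : 0 < C + 1 by rewrite ltr_wpDl.
  pose r := Num.min d (e / (C + 1)).
  have r0 : 0 < r by rewrite lt_min d0 divr_gt0.
  apply/nbhs_ballP; exists r => // p; rewrite -ball_normE /= => pr.
  have {pr} pr : `|row_of_phases (p.1 - p0.1) (p.2 - p0.2)| < r.
    apply: le_lt_trans pr; rewrite distrC.
    have nE : `|p - p0| = Order.max `|p.1 - p0.1| `|p.2 - p0.2| := prod_normE _.
    rewrite nE; apply: norm_row_of_phases; rewrite le_max; apply/orP; [left|right]; exact: lexx.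
  rewrite lt_min in pr; case/andP: pr => pd pe.
  rewrite -row_of_phasesB in pd pe.
  have := dP _ (row_of_phases p0.1 p0.2) pd; rewrite subrr normr0 => /(_ d0).
  rewrite !fE mul1r; set w := _ - _ in pe * => h1.
  rewrite -[Fe _ _ - _](subrK (L w)); apply: le_lt_trans (le_normcD _ _) _.
  rewrite ltr_pdivlMr// in pe.
  by have := CP w; lra.
split; apply: continuous_phase2_measurable => p0; apply/cvgrPdist_lt => e e0;
    near=> p.
  rewrite distrC -ReN -ReD; apply: le_lt_trans (Re_le_normc _) _.
  by near: p; exact: cont.
rewrite distrC -ImN -ImD; apply: le_lt_trans (Im_le_normc _) _.
by near: p; exact: cont.
Unshelve. all: by end_near.
Qed.

End sesqui_ext.

End phase_rows.

(** * Analyticity of exponential integrals *)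

Section exponential_series.
Context {R : realType}.
Implicit Types (x t : R) (z u : R[i]) (N : nat).

Definition exp_sum N x : R := \sum_(k < N) x ^+ k / k`!%:R.

Definition cexp_sum N z : R[i] := \sum_(k < N) z ^+ k * ((k`!%:R)^-1)%:C.

Lemma Re_scale t z : complex.Re (t%:C * z) = t * complex.Re z.
Proof. by rewrite ReM /= mul0r subr0. Qed.

Lemma exp_sumE N x : exp_sum N x = series (exp_coeff x) N.
Proof. by rewrite /series /= big_mkord. Qed.

Lemma exp_sum_ge0 N x : 0 <= x -> 0 <= exp_sum N x.
Proof. by move=> x0; apply: sumr_ge0 => k _; rewrite divr_ge0// exprn_ge0. Qed.

Lemma exp_sum_cvg x : exp_sum N x @[N --> \oo] --> expR x.
Proof.
rewrite (_ : (fun N => _) = series (exp_coeff x)).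
  exact: is_cvg_series_exp_coeff.
by apply/funext => N; exact: exp_sumE.
Qed.

Lemma exp_sum_le N x : 0 <= x -> exp_sum N x <= expR x.
Proof.
move=> x0; rewrite exp_sumE; apply: nondecreasing_cvgn_le.
  by apply: nondecreasing_series => k _ _; exact: exp_coeff_ge0.
exact: is_cvg_series_exp_coeff.
Qed.

Lemma is_derive_truncated_series (b : nat -> R) N t :
  is_derive t 1 (fun s => \sum_(k < N.+1) b k * (s ^+ k / k`!%:R))
    (\sum_(k < N) b k.+1 * (t ^+ k / k`!%:R)).
Proof.
elim: N => [|N IH].
  rewrite big_ord0 (_ : (fun s => _) = cst (b 0%N)); first exact: is_derive_cst.
  by apply/funext => s; rewrite big_ord_recl big_ord0 addr0 expr0 divr1 mulr1.
rewrite big_ord_recr/=.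
rewrite (_ : (fun s => _) = (fun s => \sum_(k < N.+1) b k * (s ^+ k / k`!%:R)) +
    (b N.+1 / (N.+1)`!%:R) *: (id ^+ N.+1 : R -> R)); last first.
  apply/funext => s; rewrite big_ord_recr/= !fctE.
  by rewrite -[_ *: _]/(_ * _); congr (_ + _); ring.
apply: is_deriveD; apply: is_derive_eq.
rewrite -[_ *: 1]/(_ * 1) mulr1 -[_ *: _]/(_ * _) factS natrM /=.
have f0 : N`!%:R != 0 :> R by rewrite pnatr_eq0 -lt0n fact_gt0.
have n0 : N.+1%:R != 0 :> R by rewrite pnatr_eq0.
by field; rewrite f0 nat1r n0.
Qed.

Lemma is_derive_cexp_ray u z t :
  is_derive t 1 (fun s => complex.Re (u * cexp (s%:C * z)))
    (complex.Re (u * z * cexp (t%:C * z))).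
Proof.
apply: dist_is_derive => e e0.
pose K := normc u * normc z + 1.
have K0 : 0 < K by rewrite ltr_wpDl// mulr_ge0// normc_ge0.
have [d d0 dP] := cexp_strict (t%:C * z) (divr_gt0 e0 K0).
have z1 : 0 < normc z + 1 by rewrite ltr_wpDl// normc_ge0.
exists (d / (normc z + 1)) => [|s]; first exact: divr_gt0.
rewrite ltr_pdivlMr// => sd.
have E : (s *: 1 + t : R)%:C * z - t%:C * z = s%:C * z.
  by rewrite -mulrBl -rmorphB addrK -[s *: 1]/(s * 1) mulr1.
have := dP ((s *: 1 + t : R)%:C * z) (t%:C * z); rewrite E subrr normc0 => /(_ _ d0).
have sz : normc (s%:C * z) <= `|s| * (normc z + 1).
  by rewrite normcM normcR ler_wpM2l// lerDl.
move=> /(_ (le_lt_trans sz sd)) h1.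
rewrite (_ : _ - s * _ = complex.Re (u * (cexp ((s *: 1 + t : R)%:C * z) - cexp (t%:C * z) -
    cexp (t%:C * z) * (s%:C * z)))); last first.
  have -> : s * complex.Re (u * z * cexp (t%:C * z)) =
      complex.Re (u * (cexp (t%:C * z) * (s%:C * z))).
    rewrite (_ : u * (_ * _) = s%:C * (u * z * cexp (t%:C * z))); last by ring.
    by rewrite Re_scale.
  by rewrite -!ReN -!ReD !mulrBr.
apply: le_trans (Re_le_normc _) _; rewrite normcM.
apply: le_trans (ler_wpM2l (normc_ge0 u) h1) _; rewrite normcM normcR.
rewrite mulrCA mulrAC ler_pdivrMr// -!mulrA ler_pM2l// mulrCA [leRHS]mulrC.
rewrite [leRHS]mulrC; apply: ler_wpM2l => //; rewrite /K lerDl ler01//.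
Qed.

Lemma exp_sum_ray N (r t : R) : exp_sum N (t * r) = \sum_(k < N) r ^+ k * (t ^+ k / k`!%:R).
Proof. by apply: eq_bigr => k _; rewrite exprMn -mulrA mulrCA. Qed.

Lemma Re_cexp_sum_ray N u z t : complex.Re (u * cexp_sum N (t%:C * z)) =
  \sum_(k < N) complex.Re (u * z ^+ k) * (t ^+ k / k`!%:R).
Proof.
rewrite /cexp_sum mulr_sumr (big_morph (@complex.Re R) (@ReD R) (erefl : complex.Re 0 = 0)).
apply: eq_bigr => k _; rewrite exprMn -rmorphXn [RHS]mulrC -Re_scale; congr complex.Re.
by rewrite rmorphM; ring.
Qed.

Lemma exp_sum0 N : exp_sum N.+1 0 = 1.
Proof.
rewrite /exp_sum big_ord_recl big1 ?addr0 ?expr0 ?divr1// => k _.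
by rewrite expr0n mul0r.
Qed.

Lemma cexp_sum0 N : cexp_sum N.+1 0 = 1.
Proof.
rewrite /cexp_sum big_ord_recl big1 ?addr0 => [|k _]; last by rewrite expr0n mul0r.
by rewrite expr0 mul1r fact0 invr1.
Qed.

(** The remainder is compared with that of the real series at [normc z], by
    induction on the order: along the ray to [z], the derivatives of the two
    remainders compare. *)
Lemma Re_exp_remainder N u z :
  complex.Re (u * (cexp z - cexp_sum N z)) <=
  normc u * (expR (normc z) - exp_sum N (normc z)).
Proof.
elim: N u z => [|N IH] u z.
  rewrite /cexp_sum /exp_sum !big_ord0 !subr0; apply: le_trans (ler_norm _) _.
  apply: le_trans (Re_le_normc _) _; rewrite normcM; apply: ler_wpM2l; first exact: normc_ge0.
  by rewrite normc_cexp ler_expR (le_trans (ler_norm _))// Re_le_normc.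
pose r := normc z.
pose H t := normc u * (expR (t * r) - \sum_(k < N.+1) r ^+ k * (t ^+ k / k`!%:R)) -
  (complex.Re (u * cexp (t%:C * z)) -
   \sum_(k < N.+1) complex.Re (u * z ^+ k) * (t ^+ k / k`!%:R)).
have HE t : H t = normc u * (expR (t * r) - exp_sum N.+1 (t * r)) -
    complex.Re (u * (cexp (t%:C * z) - cexp_sum N.+1 (t%:C * z))).
  by rewrite [u * _]mulrBr ReD ReN Re_cexp_sum_ray exp_sum_ray.
pose dH t := normc u * (r * expR (t * r) - \sum_(k < N) r ^+ k.+1 * (t ^+ k / k`!%:R)) -
  (complex.Re (u * z * cexp (t%:C * z)) -
   \sum_(k < N) complex.Re (u * z ^+ k.+1) * (t ^+ k / k`!%:R)).
have HdH t : is_derive t 1 H (dH t).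
  have d1 : is_derive t 1 (fun t => expR (t * r)) (r * expR (t * r)).
    have dr : is_derive t 1 (fun t => t * r) r.
      rewrite (_ : (fun t => _) = r *: (id : R -> R)); last first.
        by apply/funext => s; rewrite mulrC.
      by apply: is_derive_eq; rewrite -[_ *: _]/(_ * _) mulr1.
    rewrite [r * _]mulrC; exact: (@is_derive1_comp R expR (fun t => t * r) t _ _ (is_derive_expR (t * r)) dr).
  have d2 := is_derive_truncated_series (fun k => r ^+ k) N t.
  have d3 := is_derive_cexp_ray u z t.
  have d4 := is_derive_truncated_series (fun k => complex.Re (u * z ^+ k)) N t.
  exact: is_deriveB (is_deriveZ _ (is_deriveB d1 d2)) (is_deriveB d3 d4).
have dH0 t : 0 <= t -> 0 <= dH t.
  move=> t0; have tr : normc (t%:C * z) = t * r by rewrite normcM normcRge0.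
  have := IH (u * z) (t%:C * z); rewrite tr [u * z * _]mulrBr ReD ReN Re_cexp_sum_ray exp_sum_ray normcM -/r.
  rewrite -subr_ge0 => h1; rewrite [leRHS](_ : _ = normc u * r * (expR (t * r) -
    \sum_(k < N) r ^+ k * (t ^+ k / k`!%:R)) - (complex.Re (u * z * cexp (t%:C * z)) -
      \sum_(k < N) complex.Re (u * z * z ^+ k) * (t ^+ k / k`!%:R)))// /dH.
  rewrite -[normc u * r * _]mulrA; congr (_ * _ - (_ - _)).
    by rewrite mulrBr mulr_sumr; congr (_ - _); apply: eq_bigr => k _; rewrite exprS -!mulrA.
  by apply: eq_bigr => k _; rewrite exprS !mulrA.
have : H 0 <= H 1.
  apply: (@ger0_derive1_ndecr R H 0 1) => //.
  - move=> t; rewrite in_itv/= => /andP[t0 _]; rewrite derive1E.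
    by have [_ ->] := HdH t; apply: dH0; exact: ltW.
  - by apply: derivable_within_continuous => t _.
rewrite !HE !mul1r !mul0r exp_sum0 cexp_sum0 cexp0 expR0 !subrr mulr0 mulr0 subr0.
by rewrite subr_ge0.
Qed.

Lemma normc_exp_remainder N z :
  normc (cexp z - cexp_sum N z) <= expR (normc z) - exp_sum N (normc z).
Proof.
set w := cexp z - _; have := Re_exp_remainder N (conjc w) z; rewrite -/w.
rewrite mulrC mul_conjc normc_conjc /= expr2.
have := normc_ge0 w; rewrite le_eqVlt => /orP[/eqP <- _|w0].
  by rewrite subr_ge0 exp_sum_le// normc_ge0.
by rewrite ler_pM2l.
Qed.

Lemma normc_cexp_sum_le N z : normc (cexp_sum N z) <= exp_sum N (normc z).
Proof.
apply: le_trans (le_normc_sum _ _ _) _; apply: ler_sum => k _.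
by rewrite normcM normcX normcRge0 ?invr_ge0.
Qed.

(** Componentwise domination of errors passes to products. *)
Lemma prod_error_le m (x y : 'I_m -> R[i]) (X Y : 'I_m -> R) :
  (forall k, normc (x k - y k) <= X k - Y k) -> (forall k, normc (y k) <= Y k) ->
  normc (\prod_k x k - \prod_k y k) <= \prod_k X k - \prod_k Y k.
Proof.
move=> xy yY.
have xX k : normc (x k) <= X k.
  by rewrite -[x k](subrK (y k)) (le_trans (le_normcD _ _))//; have := xy k; have := yY k; lra.
suff [] : normc (\prod_k x k - \prod_k y k) <= \prod_k X k - \prod_k Y k /\
   (normc (\prod_k x k) <= \prod_k X k) by [].
elim: (index_enum _) => [|k s [h1 h2]]; first by rewrite !big_nil !subrr normc0 normc1.
rewrite !big_cons; move: h1 h2; move: (\prod_(_ <- s) x _) (\prod_(_ <- s) y _).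
move: (\prod_(_ <- s) X _) (\prod_(_ <- s) Y _) => B A b a h1 h2.
split; last by rewrite normcM ler_pM// normc_ge0.
rewrite (_ : _ - _ = (x k - y k) * b + y k * (b - a)); last by ring.
apply: le_trans (le_normcD _ _) _; rewrite !normcM.
rewrite (_ : _ - _ = (X k - Y k) * B + Y k * (B - A)); last by ring.
by apply: lerD; apply: ler_pM; rewrite ?normc_ge0.
Qed.

End exponential_series.

Section exponential_monomials.
Context {R : realType} {m : nat}.
Implicit Types (A : {fset multi_exp m}) (alpha : multi_exp m).

Definition exp_box N : {fset multi_exp m} :=
  [fset ([ffun k => nat_of_ord ((g : {ffun 'I_m -> 'I_N}) k)] : multi_exp m) |
    g in {ffun 'I_m -> 'I_N}]%fset.

Lemma mem_exp_box N alpha : (forall k, (alpha k < N)%N) -> alpha \in exp_box N.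
Proof.
move=> aN; apply/imfsetP; exists [ffun k => Ordinal (aN k)] => //.
by apply/ffunP => k; rewrite !ffunE.
Qed.

Lemma exp_box_cofinal A : exists N, (A `<=` exp_box N)%fset.
Proof.
exists (\sum_(alpha <- A) degree alpha).+1; apply/fsubsetP => alpha aA.
apply: mem_exp_box => k; rewrite ltnS; apply: (@leq_trans (degree alpha)).
  by rewrite /degree (bigD1 k)//= leq_addr.
by rewrite (big_fsetD1 alpha)//= leq_addr.
Qed.

Lemma exp_box_prod (K : comPzRingType) N (G : 'I_m -> nat -> K) :
  \prod_k \sum_(j < N) G k j = \sum_(alpha <- exp_box N) \prod_k G k (alpha k).
Proof.
rewrite bigA_distr_bigA big_imfset/=; last first.
  move=> f g _ _ /ffunP fg; apply/ffunP => k; apply: val_inj.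
  by have := fg k; rewrite !ffunE.
rewrite big_enum/=; apply: eq_bigr => g _; apply: eq_bigr => k _.
by rewrite ffunE.
Qed.

Definition exp_monomial (z : 'I_m -> R[i]) alpha : R[i] :=
  \prod_k (z k ^+ alpha k * (((alpha k)`!%:R)^-1)%:C).

Lemma normc_exp_monomial z alpha :
  normc (exp_monomial z alpha) = \prod_k (normc (z k) ^+ alpha k / (alpha k)`!%:R).
Proof.
rewrite /exp_monomial (big_morph (@normc R) (@normcM R) (@normc1 R)).
by apply: eq_bigr => k _; rewrite normcM normcX normcRge0 ?invr_ge0.
Qed.

Lemma expR_sum_prod (t : 'I_m -> R) : expR (\sum_k t k) = \prod_k expR (t k).
Proof. exact: (big_morph expR (@expRD R) (@expR0 R)). Qed.

Lemma cexp_sum_prod (z : 'I_m -> R[i]) : cexp (\sum_k z k) = \prod_k cexp (z k).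
Proof. exact: (big_morph cexp (@cexpD R) (@cexp0 R)). Qed.

Definition exp_tail N (t : 'I_m -> R) := expR (\sum_k t k) - \prod_k exp_sum N (t k).

Lemma sum_normc_exp_monomial (z : 'I_m -> R[i]) A :
  \sum_(alpha <- A) normc (exp_monomial z alpha) <= expR (\sum_k normc (z k)).
Proof.
have [N AN] := exp_box_cofinal A.
apply: (@le_trans _ _ (\sum_(alpha <- exp_box N) normc (exp_monomial z alpha))).
  rewrite (sum_fsetD _ AN) lerDl; apply: sumr_ge0 => alpha _; exact: normc_ge0.
under eq_bigr do rewrite normc_exp_monomial.
rewrite -(exp_box_prod N (fun k j => normc (z k) ^+ j / j`!%:R)) expR_sum_prod.
apply: ler_prod => k _; rewrite exp_sum_ge0 ?normc_ge0//=.
by apply: exp_sum_le; exact: normc_ge0.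
Qed.

Lemma exp_monomial_remainder (z : 'I_m -> R[i]) A N : (exp_box N `<=` A)%fset ->
  normc (\sum_(alpha <- A) exp_monomial z alpha - cexp (\sum_k z k)) <=
  2 * exp_tail N (fun k => normc (z k)).
Proof.
move=> NA; have b0 k := normc_ge0 (z k).
have h1 : normc (\prod_k cexp (z k) - \prod_k cexp_sum N (z k)) <=
    exp_tail N (fun k => normc (z k)).
  rewrite /exp_tail expR_sum_prod; apply: prod_error_le => k.
    exact: normc_exp_remainder.
  exact: normc_cexp_sum_le.
have h2 : \sum_(alpha <- (A `\` exp_box N)%fset) normc (exp_monomial z alpha) <=
    exp_tail N (fun k => normc (z k)).
  rewrite lerBrDl; apply: le_trans (sum_normc_exp_monomial z A).
  rewrite (sum_fsetD _ NA); apply: lerD => //.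
  rewrite (eq_bigr _ (fun alpha _ => normc_exp_monomial z alpha)).
  by rewrite -(exp_box_prod N (fun k j => normc (z k) ^+ j / j`!%:R)).
rewrite (sum_fsetD _ NA) -(exp_box_prod N (fun k j => z k ^+ j * ((j`!%:R)^-1)%:C)).
rewrite cexp_sum_prod; set P := \prod_k cexp _ in h1 *.
set S := \prod_k cexp_sum _ _ in h1; set D := \sum_(_ <- (_ `\` _)%fset) _.
rewrite (_ : _ - P = D - (P - S)); last by rewrite /S /cexp_sum; ring.
apply: le_trans (le_normcB _ _) _.
have : normc D <= exp_tail N (fun k => normc (z k)) by exact: le_trans (le_normc_sum _ _ _) h2.
by move: h1; move: (exp_tail _ _) => ? ? ?; lra.
Qed.

Lemma exp_tail_ge0 N t : (forall k, 0 <= t k) -> 0 <= exp_tail N t.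
Proof.
move=> t0; rewrite subr_ge0 expR_sum_prod; apply: ler_prod => k _.
by rewrite exp_sum_ge0//= exp_sum_le.
Qed.

Lemma exp_tail_le N t : (forall k, 0 <= t k) -> exp_tail N t <= expR (\sum_k t k).
Proof. by move=> t0; rewrite gerBl; apply: prodr_ge0 => k _; exact: exp_sum_ge0. Qed.

Lemma exp_tail_cvg t : exp_tail N t @[N --> \oo] --> 0.
Proof.
rewrite -(subrr (expR (\sum_k t k))); apply: cvgB; first exact: cvg_cst.
rewrite expR_sum_prod; apply: cvg_big => [|k _]; last exact: exp_sum_cvg.
exact: mul_continuous.
Qed.

End exponential_monomials.

Section exponential_integral.
Context d (T : measurableType d) {R : realType} (mu : {measure set T -> \bar R}).
Variables (m : nat) (M : T -> R[i]) (l : T -> 'rV[R]_m -> R[i]).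
Hypotheses (mM : cmeasurable M) (l_linear : forall w, rlinear (l w)).
Hypothesis ml : forall v, cmeasurable (l^~ v).
Implicit Types (v p : 'rV[R]_m) (w : T) (alpha : multi_exp m).

Definition form_size w : R := \sum_k normc (l w (delta_mx 0 k)).

Hypothesis iM : forall r : R,
  mu.-integrable setT (EFin \o (fun w => normc (M w) * expR (r * form_size w))).

Definition exp_integral v := cintegral mu (fun w => M w * cexp (l w v)).

Let z v w k := l w (delta_mx 0 k) * (v ord0 k)%:C.

Let sum_z v w : \sum_k z v w k = l w v.
Proof. by rewrite (rlinear_delta v (l_linear w)). Qed.

Let form_size_ge0 w : 0 <= form_size w.
Proof. by apply: sumr_ge0 => k _; exact: normc_ge0. Qed.

Let sum_normc_z v w : \sum_k normc (z v w k) <= `|v| * form_size w.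
Proof.
rewrite mulr_sumr; apply: ler_sum => k _; rewrite normcM normcR mulrC.
by apply: ler_wpM2r; [exact: normc_ge0|exact: rvec_coord_le].
Qed.

Let normc_cexp_l v w : normc (cexp (l w v)) <= expR (`|v| * form_size w).
Proof.
rewrite normc_cexp ler_expR; apply: le_trans (sum_normc_z v w).
apply: le_trans (ler_norm _) _; apply: le_trans (Re_le_normc _) _.
by rewrite -sum_z; exact: le_normc_sum.
Qed.

Let cintegrable_M (g : T -> R[i]) r : cmeasurable g ->
  (forall w, normc (g w) <= expR (r * form_size w)) -> cintegrable mu (fun w => M w * g w).
Proof.
move=> mg gr; apply: (cintegrable_le (g := fun w => normc (M w) * expR (r * form_size w))) => //.
  exact: cmeasurableM.
by move=> w; rewrite normcM; apply: ler_wpM2l; first exact: normc_ge0.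
Qed.

Let mexp_monomial (c : 'I_m -> T -> R[i]) alpha : (forall k, cmeasurable (c k)) ->
  cmeasurable (fun w => exp_monomial (fun k => c k w) alpha).
Proof.
move=> mc; apply: cmeasurable_prod => k; apply: cmeasurableM; last exact: cmeasurable_cst.
exact: cmeasurableX.
Qed.

Let mz v k : cmeasurable (fun w => z v w k).
Proof. by apply: cmeasurableM => //; exact: cmeasurable_cst. Qed.

Let exp_monomial_z alpha v w : exp_monomial (z v w) alpha =
  exp_monomial (fun k => l w (delta_mx 0 k)) alpha * (monomial alpha v)%:C.
Proof.
rewrite /exp_monomial /monomial (rmorph_prod (real_complex R)) -big_split/=.
by apply: eq_bigr => k _; rewrite exprMn -rmorphXn mulrAC.
Qed.

Let bound_monomial p v alpha w :
  normc (cexp (l w p) * exp_monomial (z v w) alpha) <= expR ((`|p| + `|v|) * form_size w).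
Proof.
rewrite normcM mulrDl expRD; apply: ler_pM; rewrite ?normc_ge0//.
have := sum_normc_exp_monomial (z v w) [fset alpha]%fset; rewrite big_seq_fset1.
by move=> /le_trans; apply; rewrite ler_expR.
Qed.

Definition exp_integral_coef p alpha := cintegral mu (fun w =>
  M w * (cexp (l w p) * exp_monomial (fun k => l w (delta_mx 0 k)) alpha)).

Let iterm p v alpha :
  cintegrable mu (fun w => M w * (cexp (l w p) * exp_monomial (z v w) alpha)).
Proof.
apply: (cintegrable_M (r := `|p| + `|v|)) => [|w]; last exact: bound_monomial.
by apply: cmeasurableM; [exact: cmeasurable_cexp|exact: (@mexp_monomial (fun k w => z v w k) alpha (mz v))].
Qed.

Let icoef p alpha : cintegrable mu (fun w =>
  M w * (cexp (l w p) * exp_monomial (fun k => l w (delta_mx 0 k)) alpha)).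
Proof.
apply: eq_cintegrable (iterm p (const_mx 1) alpha) => w.
by rewrite exp_monomial_z /monomial big1 ?mulr1// => k _; rewrite mxE expr1n.
Qed.

Lemma exp_integral_csum p v :
  has_csum (fun alpha => exp_integral_coef p alpha * (monomial alpha v)%:C)
    (exp_integral (p + v)).
Proof.
pose t w k := normc (z v w k).
have t0 w k : 0 <= t w k := normc_ge0 _.
pose G N w := normc (M w * cexp (l w p)) * exp_tail N (t w).
pose g w := normc (M w) * expR ((`|p| + `|v|) * form_size w).
have mMp : cmeasurable (fun w => M w * cexp (l w p)).
  by apply: cmeasurableM => //; exact: cmeasurable_cexp.
have mG N : measurable_fun setT (G N).
  apply: measurable_funM; first exact: measurable_normc.
  apply: measurable_funB.
    by apply: measurableT_comp => //; apply: measurable_sum => k; exact: measurable_normc.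
  apply: measurable_prod => k _; apply: measurable_sum => j.
  apply: measurable_funM => //; apply: measurable_funX; exact: measurable_normc.
have Gg N w : 0 <= G N w <= g w.
  rewrite mulr_ge0 ?normc_ge0 ?exp_tail_ge0//= /G /g normcM mulrDl expRD -mulrA.
  apply: ler_wpM2l; first exact: normc_ge0.
  apply: ler_pM; rewrite ?normc_ge0 ?exp_tail_ge0//.
  by apply: le_trans (exp_tail_le _ (t0 w)) _; rewrite ler_expR; exact: sum_normc_z.
have G0 : normc (cintegral mu (fun w => (G N w)%:C) - cintegral mu (fun=> 0)) @[N --> \oo] --> 0.
  apply: (cdominated (g := g)).
  - by move=> N; exact: cmeasurableR.
  - exact: cmeasurable_cst.
  - exact: iM.
  - move=> w; rewrite (_ : (fun N => _) = (fun N => normc (M w * cexp (l w p)) * exp_tail N (t w))).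
      by rewrite -(mulr0 (normc (M w * cexp (l w p)))); apply: cvgMr; exact: exp_tail_cvg.
    by apply/funext => N; rewrite subr0 normcRge0//; case/andP: (Gg N w).
  - by move=> N w; case/andP: (Gg N w) => ? ?; rewrite normcRge0.
move=> e e0; have e2 : 0 < e / 2 by rewrite divr_gt0.
have [N NP] : exists N, \int[mu]_w G N w < e / 2.
  have /cvgrPdist_lt/(_ _ e2)[N _ /(_ N (leqnn N)) h1] := G0; exists N.
  have {h1} : `|0 - normc (cintegral mu (fun w => (G N w)%:C) - cintegral mu (fun=> 0))| < e / 2.
    exact: h1.
  rewrite cintegral0 subr0 cintegralR sub0r normrN ger0_norm ?normc_ge0// normcR.
  by apply: le_lt_trans; exact: ler_norm.
exists (exp_box N) => A NA.
have E : \sum_(alpha <- A) exp_integral_coef p alpha * (monomial alpha v)%:C =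
    cintegral mu (fun w => \sum_(alpha <- A) M w * (cexp (l w p) * exp_monomial (z v w) alpha)).
  rewrite cintegral_sum//; apply: eq_bigr => alpha _; rewrite -cintegralZr//.
  by apply: eq_cintegral => w; rewrite exp_monomial_z !mulrA.
have i1 : cintegrable mu (fun w => \sum_(alpha <- A) M w * (cexp (l w p) * exp_monomial (z v w) alpha)).
  exact: cintegrable_sum.
have i2 : cintegrable mu (fun w => M w * cexp (l w (p + v))).
  by apply: (cintegrable_M (r := `|p + v|)) => //; exact: cmeasurable_cexp.
rewrite E /exp_integral -cintegralB//.
apply: le_lt_trans (normc_cintegral_le (cintegrableB i1 i2)) _.
have iG : mu.-integrable setT (EFin \o G N).
  apply: (integrable_le_ge0 (mG N) (iM (`|p| + `|v|))) => w.
  by case/andP: (Gg N w) => ? ?; rewrite ger0_norm.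
apply: (@le_lt_trans _ _ (\int[mu]_w (2 * G N w))); last by rewrite RintegralZl//; lra.
apply: le_Rintegral => //.
- exact: cintegrable_normc (cintegrableB i1 i2).
- by rewrite (_ : _ \o _ = (fun w => 2%:E * (G N w)%:E)%E)//; exact: integrableZl.
move=> w _; have [lD _] := l_linear w.
rewrite (_ : _ - _ = (M w * cexp (l w p)) *
    (\sum_(alpha <- A) exp_monomial (z v w) alpha - cexp (l w v))); last first.
  rewrite mulrBr mulr_sumr lD cexpD mulrA; congr (_ - _).
  by apply: eq_bigr => alpha _; rewrite mulrA.
rewrite normcM /G [2 * _]mulrCA; apply: ler_wpM2l; first exact: normc_ge0.
by rewrite -(sum_z v); exact: exp_monomial_remainder.
Qed.

Lemma cintegrable_exp_integral v : cintegrable mu (fun w => M w * cexp (l w v)).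
Proof. by apply: (cintegrable_M (r := `|v|)) => //; exact: cmeasurable_cexp. Qed.

Lemma exp_integral_analytic : real_analytic exp_integral.
Proof.
move=> p; exists (exp_integral_coef p); exists 1 => // v _; exact: exp_integral_csum.
Qed.

Lemma cintegrable_exp_derivative p v :
  cintegrable mu (fun w => M w * (cexp (l w p) * l w v)).
Proof.
apply: (cintegrable_M (r := `|p| + `|v|)) => [|w].
  by apply: cmeasurableM => //; exact: cmeasurable_cexp.
rewrite normcM mulrDl expRD; apply: ler_pM; rewrite ?normc_ge0//.
rewrite -(sum_z v w); apply: le_trans (le_normc_sum _ _ _) _.
apply: le_trans (sum_normc_z v w) _.
by apply: le_trans (expR_ge1Dx _); rewrite lerDr.
Qed.

Lemma rlinear_exp_derivative p :
  rlinear (fun v => cintegral mu (fun w => M w * (cexp (l w p) * l w v))).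
Proof.
have i := cintegrable_exp_derivative p; split=> [u v|t v].
  rewrite -cintegralD//; apply: eq_cintegral => w.
  by have [-> _] := l_linear w; rewrite !mulrDr.
rewrite -cintegralZ//; apply: eq_cintegral => w; have [_ ->] := l_linear w.
by move: (cexp _) (l w v) => e b; ring.
Qed.

Lemma exp_integral_derivative p : strictly_derivable exp_integral p
  (fun v => cintegral mu (fun w => M w * (cexp (l w p) * l w v))).
Proof.
have := power_series_strict ltr01 (fun v _ => exp_integral_csum p v).
rewrite (_ : (fun v => \sum_k _) = (fun v : 'rV[R]_m =>
  cintegral mu (fun w => M w * (cexp (l w p) * l w v))))//.
apply/funext => v.
have U k w : exp_monomial (fun k => l w (delta_mx 0 k)) (unit_exp k) = l w (delta_mx 0 k).
  rewrite /exp_monomial (bigD1 k)//= ffunE eqxx /= expr1 (_ : 1`!%N = 1%N)// invr1 mulr1 big1 ?mulr1// => j jk.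
  by rewrite ffunE (negbTE jk) /= expr0 fact0 invr1 mulr1.
transitivity (cintegral mu (fun w => \sum_k M w * (cexp (l w p) * l w (delta_mx 0 k)) * (v ord0 k)%:C)).
  have i k : cintegrable mu (fun w => M w * (cexp (l w p) * l w (delta_mx 0 k)) * (v ord0 k)%:C).
    apply: eq_cintegrable (cintegrableZ (v ord0 k)%:C (icoef p (unit_exp k))) => w.
    by rewrite U mulrC.
  rewrite cintegral_sum//; apply: eq_bigr => k _.
  rewrite cintegralZr; last by apply: eq_cintegrable (icoef p (unit_exp k)) => w; rewrite U.
  by congr (_ * _); apply: eq_cintegral => w; rewrite U.
apply: eq_cintegral => w; rewrite (rlinear_delta v (l_linear w)) !mulr_sumr.
by apply: eq_bigr => k _; rewrite !mulrA.
Qed.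

End exponential_integral.

(** * Extensions with integrable and bounded weights *)

Section bounded_functions.
Context d (T : measurableType d) {R : realType} (mu : {measure set T -> \bar R}).

Lemma Lfun_oo_bounded (f : T -> R) : f \in Lfun mu +oo%E ->
  exists2 K : R, 0 <= K & {ae mu, forall x, `|f x| <= K}.
Proof.
move=> /andP[_]; rewrite inE /= /finite_norm unlock.
case: ifPn => [mu0|]; last first.
  rewrite -leNgt => mu0 _; exists 0 => //; exists setT; split => //.
  by apply/eqP; rewrite eq_le mu0 measure_ge0.
move=> fo; have [M fM] := @ess_supr_bounded _ _ _ mu (fun x => `|f x|) fo.
exists (Num.max M 0); first by rewrite le_max lexx orbT.
by apply: filterS fM => x /= fx; rewrite le_max fx.
Qed.

Lemma bounded_Lfun_oo (f : T -> R) (K : R) : measurable_fun setT f ->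
  (forall x, `|f x| <= K) -> f \in Lfun mu +oo%E.
Proof.
move=> mf fK; apply/andP; split; first by rewrite inE.
rewrite inE /= /finite_norm unlock; case: ifPn => // _.
apply: (@le_lt_trans _ _ K%:E); last exact: ltry.
by apply/ess_supP; apply: nearW => x /=; rewrite lee_fin.
Qed.

End bounded_functions.

Section wick_weight.
Context {R : realType} {n : nat} (h : R).
Hypothesis h_gt0 : 0 < h.
Local Notation phase := ('rV[R]_n * 'rV[R]_n)%type.
Local Notation pm := (@phase_measure R n).
Implicit Types (X Y Z V : phase) (psi : phase -> R) (Fe : phase -> phase -> R[i]).

(** The growth condition on extensions, with the sign of the weight and its
    essential bound made explicit. *)
Definition wick_weight Fe psi :=
  [/\ measurable_fun setT psi, forall V, 0 <= psi V,
      pm.-integrable setT (EFin \o psi),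
      exists2 K : R, 0 <= K & {ae pm, forall V, psi V <= K} &
      forall X Y, normc (Fe X Y * overlap h X Y) <= psi (X - Y)].

Lemma sesqui_ext_weight F Fe : is_sesqui_ext h F Fe -> exists psi, wick_weight Fe psi.
Proof.
move=> [_ _ _ [psi [psi1 psioo psiP]]]; exists psi.
have psi0 V : 0 <= psi V.
  have := psiP V 0; rewrite subr0 => h1; have := le_trans (normc_ge0 _) h1.
  by rewrite pmulr_rge0// expR_gt0.
have ipsi := (Lfun1_integrable _ _).1 psi1; split => //.
- by have := sub_Lfun_mfun psi1; rewrite inE.
- have [K K0 psiK] := Lfun_oo_bounded psioo; exists K => //.
  by apply: filterS psiK => V; rewrite ger0_norm.
move=> X Y; rewrite normcM normc_overlap//.
apply: le_trans (ler_wpM2r (expR_ge0 _) (psiP X Y)) _.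
by rewrite mulrAC -expRD subrr expR0 mul1r.
Qed.

Lemma wick_weight_le Fe psi X Y : wick_weight Fe psi ->
  normc (Fe X Y) <= expR (sqnorm (X - Y) / (4 * h)) * psi (X - Y).
Proof.
move=> [_ _ _ _ /(_ X Y)]; rewrite normcM normc_overlap// expRN.
by rewrite ler_pdivrMr ?expR_gt0// mulrC.
Qed.

End wick_weight.

(** * The Wick product *)

Section wick_product.
Context {R : realType} {n : nat} (h : R).
Hypothesis h_gt0 : 0 < h.
Local Notation vec := 'rV[R]_n.
Local Notation fct := (vec -> R[i]).
Local Notation phase := ('rV[R]_n * 'rV[R]_n)%type.
Local Notation pm := (@phase_measure R n).
Local Notation Psi := (coherent h).
Implicit Types (X Y Z V P Q : phase) (F : phase -> R[i]) (A B : fct -> fct).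

Let c : R := (2 * pi * h) ^- n.

Let c_gt0 : 0 < c.
Proof. by rewrite invr_gt0 exprn_gt0// !mulr_gt0// pi_gt0. Qed.

Lemma sesqui_ext_spec F : D_h h F -> is_sesqui_ext h F (sesqui_ext h F).
Proof. by move=> [Fe FeP]; exact: (xgetPex _ (ex_intro _ Fe FeP)). Qed.

(** Weighted by the Gaussian that makes coherent states holomorphic in their
    label, matrix elements inherit the (anti)holomorphy of the extension. *)
Lemma sesqui_ext_weighted_l F Fe Y : is_sesqui_ext h F Fe ->
  holo_weighted h (fun Z => Fe Z Y * overlap h Z Y).
Proof.
move=> FeP; rewrite /holo_weighted.
rewrite (_ : (fun Z => _) = (fun Z => Fe Z Y * ((expR (sqnorm Z / (4 * h)))%:C * overlap h Z Y))).
  apply: holo_mul; first exact: sesqui_ext_holo_l FeP Y.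
  exact: holo_weighted_overlap.
by apply/funext => Z; rewrite mulrCA.
Qed.

Lemma sesqui_ext_weighted_r F Fe X : is_sesqui_ext h F Fe ->
  holo_weighted h (fun Z => conjc (Fe X Z * overlap h X Z)).
Proof.
move=> FeP; rewrite /holo_weighted.
rewrite (_ : (fun Z => _) = (fun Z => conjc (Fe X Z) * ((expR (sqnorm Z / (4 * h)))%:C * overlap h Z X))).
  apply: holo_mul; first exact: sesqui_ext_holo_r FeP X.
  exact: holo_weighted_overlap.
by apply/funext => Z; rewrite conjcM conjc_overlap mulrCA.
Qed.

Lemma integrable_preserves_real (f : phase -> R) phi : preserves pm phi ->
  pm.-integrable setT (EFin \o f) -> pm.-integrable setT (EFin \o (fun V => f (phi V))).
Proof.
by move=> pphi jf; have [] := cintegrable_preserves pphi (cintegrableR jf).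
Qed.

Lemma integrable_weight_shift Fe psi Y : wick_weight h Fe psi ->
  pm.-integrable setT (EFin \o (fun Z => psi (Z - Y))).
Proof.
by move=> [_ _ ipsi _ _]; apply: integrable_preserves_real (preserves_phase_shift (- Y)) ipsi.
Qed.

Lemma integrable_weight_reflect Fe psi X : wick_weight h Fe psi ->
  pm.-integrable setT (EFin \o (fun Z => psi (X - Z))).
Proof.
by move=> [_ _ ipsi _ _]; apply: integrable_preserves_real (preserves_phase_reflect X) ipsi.
Qed.

Lemma inner_scale (a : R[i]) (f g : fct) : L2 f -> L2 g ->
  inner (fun u => a * f u) g = a * inner f g.
Proof.
move=> fL gL; rewrite /inner -cintegralZ; last exact: cintegrable_inner.
by apply: eq_cintegral => u; rewrite mulrA.
Qed.

Lemma inner_cproj P Q X Y :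
  inner (cproj h X (cproj h Y (Psi P))) (Psi Q) =
    overlap h P Y * overlap h Y X * overlap h X Q.
Proof.
have L := coherent_L2 h_gt0 (n := n).
by rewrite /cproj inner_scale// inner_scale// !inner_coherent.
Qed.

Section one_extension.
Variables (F : phase -> R[i]) (Fe : phase -> phase -> R[i]) (psi : phase -> R).
Hypotheses (FeP : is_sesqui_ext h F Fe) (psiP : wick_weight h Fe psi).

Lemma cmeasurable_weighted d (S : measurableType d) (f g : S -> phase) :
  measurable_fun setT f -> measurable_fun setT g ->
  cmeasurable (fun t => Fe (f t) (g t) * overlap h (f t) (g t)).
Proof.
move=> mf mg; apply: cmeasurableM; last exact: cmeasurable_overlap.
exact: (cmeasurable_comp (sesqui_ext_cmeasurable FeP) (measurable_fun_pair mf mg)).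
Qed.

Lemma cintegrable_weighted_l P X :
  cintegrable pm (fun Y => Fe Y X * overlap h Y X * overlap h P Y).
Proof.
have [_ _ _ _ psile] := psiP.
apply: cintegrable_le (integrable_weight_shift X psiP) _.
  apply: cmeasurableM; first exact: cmeasurable_weighted.
  by apply: cmeasurable_overlap => //; exact: measurable_cst.
move=> Y; rewrite normcM -[leRHS]mulr1.
by apply: ler_pM; rewrite ?normc_ge0 ?normc_overlap_le.
Qed.

Lemma cintegrable_weighted_r P Q :
  cintegrable pm (fun X => Fe P X * overlap h P X * overlap h X Q).
Proof.
have [_ _ _ _ psile] := psiP.
apply: cintegrable_le (integrable_weight_reflect P psiP) _.
  apply: cmeasurableM; first exact: cmeasurable_weighted.
  by apply: cmeasurable_overlap => //; exact: measurable_cst.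
move=> X; rewrite normcM -[leRHS]mulr1.
by apply: ler_pM; rewrite ?normc_ge0 ?normc_overlap_le.
Qed.

Lemma reproducing_weighted_l P X :
  cintegral pm (fun Y => Fe Y X * overlap h Y X * overlap h P Y) =
    ((2 * pi * h) ^+ n)%:C * (Fe P X * overlap h P X).
Proof.
apply: (overlap_reproducing h_gt0 (sesqui_ext_weighted_l X FeP)).
exact: cintegrable_weighted_l.
Qed.

Lemma reproducing_weighted_r P Q :
  cintegral pm (fun X => Fe P X * overlap h P X * overlap h X Q) =
    ((2 * pi * h) ^+ n)%:C * (Fe P Q * overlap h P Q).
Proof.
apply: (overlap_reproducing_conj h_gt0 (sesqui_ext_weighted_r P FeP)).
exact: cintegrable_weighted_r.
Qed.

End one_extension.

(** The matrix elements of the operator in the coherent states are the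
    extension itself, up to the overlap: the weak integral reproduces it once
    in each variable. *)
Lemma op_wick_coherent F A P Q : D_h h F -> is_op_wick h F A ->
  inner (A (Psi P)) (Psi Q) = sesqui_ext h F P Q * overlap h P Q.
Proof.
move=> FD [_ AP]; have FeP := sesqui_ext_spec FD.
have [psi psiP] := sesqui_ext_weight h_gt0 FeP.
have [iK ->] := AP _ _ (coherent_L2 h_gt0 P) (coherent_L2 h_gt0 Q).
rewrite cintegral_fubini1//.
rewrite (eq_cintegral _ (g := fun X => ((2 * pi * h) ^+ n)%:C *
  (sesqui_ext h F P X * overlap h P X * overlap h X Q))); last first.
  move=> X; rewrite mulrA -(reproducing_weighted_l FeP psiP) -cintegralZr.
    by apply: eq_cintegral => Y; rewrite inner_cproj; ring.
  exact: cintegrable_weighted_l FeP psiP P X.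
rewrite cintegralZ; last exact: cintegrable_weighted_r FeP psiP P Q.
rewrite (reproducing_weighted_r FeP psiP).
have q0 : (2 * pi * h) ^+ n != 0 by rewrite expf_neq0// gt_eqF// !mulr_gt0// pi_gt0.
move: (_ * overlap _ _ _) => N; rewrite !mulrA -!rmorphM mulnC exprM expr2.
by rewrite -mulrA mulVf ?mul1r// mulf_neq0.
Qed.

(** The exponents of the three overlaps differ by the hermitian product of the
    two sides at the intermediate point. *)
Lemma overlap_triple X Y Z : overlap h X Z * overlap h Z Y =
  overlap h X Y * cexp ((- (2 * h)^-1)%:C * herm (Z - X) (Z - Y)).
Proof.
rewrite /overlap -!cexpD; congr cexp.
rewrite !hermDl !hermDr !hermNl !hermNr hermXX.
have -> : - (2 * h)^-1 = - ((4 * h)^-1 * (1 + 1)) :> R by field; rewrite gt_eqF.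
move: (sqnorm X) (sqnorm Y) (sqnorm Z) (4 * h)^-1 => a b d k.
by rewrite !(rmorphN, rmorphM, rmorphD, rmorph1); ring.
Qed.

Section two_extensions.
Variables (F G : phase -> R[i]) (Fe Ge : phase -> phase -> R[i]) (psiF psiG : phase -> R).
Hypotheses (FeP : is_sesqui_ext h F Fe) (GeP : is_sesqui_ext h G Ge).
Hypotheses (psiFP : wick_weight h Fe psiF) (psiGP : wick_weight h Ge psiG).

Definition wick_kernel X Y Z : R[i] :=
  Fe Z Y * Ge X Z * cexp ((- (2 * h)^-1)%:C * herm (Z - X) (Z - Y)).

Definition wick_product_ext X Y : R[i] := c%:C * cintegral pm (wick_kernel X Y).

Lemma wick_kernel_overlap X Y Z : wick_kernel X Y Z * overlap h X Y =
  (Ge X Z * overlap h X Z) * (Fe Z Y * overlap h Z Y).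
Proof.
rewrite [RHS]mulrACA overlap_triple /wick_kernel.
by move: (cexp _) (overlap _ _ _) => e o; ring.
Qed.

Lemma normc_wick_kernel_le X Y Z : normc (wick_kernel X Y Z) <=
  expR (sqnorm (X - Y) / (4 * h)) * (psiG (X - Z) * psiF (Z - Y)).
Proof.
have [_ _ _ _ leF] := psiFP; have [_ _ _ _ leG] := psiGP.
have := congr1 (@normc R) (wick_kernel_overlap X Y Z).
rewrite normcM normc_overlap// expRN => E.
have e0 : expR (sqnorm (X - Y) / (4 * h)) != 0 by rewrite gt_eqF// expR_gt0.
rewrite -(mulfK (invr_neq0 e0) (normc (wick_kernel X Y Z))) E invrK mulrC.
apply: ler_wpM2l; first exact: expR_ge0.
by rewrite normcM; apply: ler_pM; rewrite ?normc_ge0.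
Qed.

Lemma cmeasurable_wick_kernel d (S : measurableType d) (f g k : S -> phase) :
  measurable_fun setT f -> measurable_fun setT g -> measurable_fun setT k ->
  cmeasurable (fun t => wick_kernel (f t) (g t) (k t)).
Proof.
move=> mf mg mk; apply: cmeasurableM; first apply: cmeasurableM.
- exact: (cmeasurable_comp (sesqui_ext_cmeasurable FeP) (measurable_fun_pair mk mg)).
- exact: (cmeasurable_comp (sesqui_ext_cmeasurable GeP) (measurable_fun_pair mf mk)).
apply: cmeasurable_cexp; apply: cmeasurableM; first exact: cmeasurable_cst.
by apply: cmeasurable_herm; exact: measurable_phaseB.
Qed.

Let conv V : \bar R := (\int[pm]_U ((psiG (V - U)%R)%:E * (psiF U)%:E))%E.

Let conv_ge0 V : (0 <= conv V)%E.
Proof.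
have [_ F0 _ _ _] := psiFP; have [_ G0 _ _ _] := psiGP.
by apply: integral_ge0 => U _; rewrite mule_ge0// lee_fin.
Qed.

Let measurable_reflect V : measurable_fun setT (fun U : phase => V - U).
Proof. by case: (preserves_phase_reflect V). Qed.

Lemma convolution_bounded : exists2 K : R, 0 <= K & forall V, (conv V <= K%:E)%E.
Proof.
have [mF F0 iF _ _] := psiFP; have [mG G0 iG [K K0 GK] _] := psiGP.
exists (K * fine (\int[pm]_U (psiF U)%:E)%E) => [|V].
  by rewrite mulr_ge0// fine_ge0// integral_ge0// => U _; rewrite lee_fin.
rewrite EFinM fineK; last exact: (integrable_fin_num measurableT iF).
rewrite -integralZl_ge0//; apply: ae_ge0_le_integral => //.
- by move=> U _; rewrite mule_ge0// lee_fin.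
- apply: emeasurable_funM; apply/measurable_EFinP => //.
  exact: (measurableT_comp mG (measurable_reflect V)).
- by move=> U _; rewrite lee_fin mulr_ge0.
- by apply/measurable_EFinP; exact: measurable_funM.
have := ae_preserves (preserves_phase_reflect V) GK.
by apply: filterS => U GKU _; rewrite -EFinM lee_fin ler_wpM2r.
Qed.

Lemma integral_weights X Y :
  (\int[pm]_Z (psiG (X - Z)%R * psiF (Z - Y)%R)%:E = conv (X - Y)%R)%E.
Proof.
have [mF F0 _ _ _] := psiFP; have [mG G0 _ _ _] := psiGP.
rewrite /conv -(ge0_integral_preserves (preserves_phase_shift (- Y))
  (f := fun U : phase => ((psiG (X - Y - U)%R)%:E * (psiF U)%:E)%E)).
- apply: eq_integral => Z _; rewrite EFinM.
  by have -> : X - Y - (Z - Y) = X - Z by rewrite opprB addrA subrK.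
- apply: emeasurable_funM; apply/measurable_EFinP => //.
  exact: (measurableT_comp mG (measurable_reflect (X - Y))).
- by move=> U; rewrite mule_ge0// lee_fin.
Qed.

Lemma integrable_weights X Y :
  pm.-integrable setT (EFin \o (fun Z => psiG (X - Z) * psiF (Z - Y))).
Proof.
have [mF F0 _ _ _] := psiFP; have [mG G0 _ _ _] := psiGP.
apply/integrableP; split.
  apply/measurable_EFinP; apply: measurable_funM.
    exact: (measurableT_comp mG (measurable_reflect X)).
  by apply: (measurableT_comp mF); case: (preserves_phase_shift (- Y)).
rewrite (eq_integral (fun Z => (psiG (X - Z) * psiF (Z - Y))%:E)) => [|Z _].
  rewrite integral_weights; have [K _ KP] := convolution_bounded.
  exact: le_lt_trans (KP _) (ltry _).
by rewrite /= ger0_norm// mulr_ge0.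
Qed.

Lemma cintegrable_wick_kernel X Y : cintegrable pm (wick_kernel X Y).
Proof.
apply: (cintegrable_le (g := fun Z => expR (sqnorm (X - Y) / (4 * h)) * (psiG (X - Z) * psiF (Z - Y)))).
- by apply: (cmeasurable_wick_kernel (f := fun=> X) (g := fun=> Y) (k := id));
    [exact: measurable_cst|exact: measurable_cst|exact: measurable_id].
- rewrite (_ : _ \o _ = (fun Z => (expR (sqnorm (X - Y)%R / (4 * h)))%:E *
    (psiG (X - Z)%R * psiF (Z - Y)%R)%:E)%E)//.
  by apply: integrableZl => //; exact: integrable_weights.
- exact: normc_wick_kernel_le.
Qed.

Lemma wick_product_ext_weight : exists psi : phase -> R,
  [/\ psi \in Lfun pm 1%E, psi \in Lfun pm +oo%E &
    forall X Y, normc (wick_product_ext X Y) <=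
      expR (sqnorm (X - Y) / (4 * h)) * psi (X - Y)].
Proof.
have [mF F0 iF _ _] := psiFP; have [mG G0 iG _ _] := psiGP.
have [K K0 KP] := convolution_bounded.
have cfin V : conv V \is a fin_num.
  by rewrite ge0_fin_numE//; exact: le_lt_trans (KP V) (ltry _).
have EmF : measurable_fun setT (EFin \o psiF) by exact/measurable_EFinP.
have EmG : measurable_fun setT (EFin \o psiG) by exact/measurable_EFinP.
have EF0 V : (0 <= (EFin \o psiF) V)%E by rewrite lee_fin.
have EG0 V : (0 <= (EFin \o psiG) V)%E by rewrite lee_fin.
have mc : measurable_fun setT conv := measurable_convolution EmG EmF EG0 EF0.
have mpsi : measurable_fun setT (fun V => c * fine (conv V)).
  by apply: measurable_funM => //; exact: measurableT_comp.
have psi0 V : 0 <= c * fine (conv V) by rewrite mulr_ge0 ?(ltW c_gt0)// fine_ge0.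
exists (fun V => c * fine (conv V)); split.
- apply/Lfun1_integrable; rewrite (_ : _ \o _ = (fun V => c%:E * conv V)%E).
    apply: integrableZl => //; apply/integrableP; split=> //.
    under eq_integral do rewrite gee0_abs//.
    rewrite (integral_convolution EmG EmF EG0 EF0).
    have /fineK <- := integrable_fin_num measurableT iF.
    by have /fineK <- := integrable_fin_num measurableT iG; exact: ltry.
  by apply/funext => V; rewrite /= EFinM fineK.
- apply: (@bounded_Lfun_oo _ _ _ _ _ (c * K)) => // V; rewrite ger0_norm//.
  by rewrite ler_pM2l// -lee_fin fineK.
move=> X Y; rewrite /wick_product_ext normcM normcRge0 ?(ltW c_gt0)// mulrCA.
rewrite ler_pM2l//; have iK := cintegrable_wick_kernel X Y.
rewrite -lee_fin; apply: le_trans (normc_cintegral_leE iK) _.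
rewrite EFinM fineK// -integral_weights -integralZl_ge0 ?expR_ge0//; last 2 first.
- apply: measurable_funM.
    exact: (measurableT_comp mG (measurable_reflect X)).
  by apply: (measurableT_comp mF); case: (preserves_phase_shift (- Y)).
- by move=> Z; rewrite mulr_ge0.
apply: ge0_le_integral => //.
- by move=> Z _; rewrite lee_fin normc_ge0.
- exact: measurable_normcE (cintegrable_meas iK).
- apply/measurable_EFinP; apply: measurable_funM => //; apply: measurable_funM.
    exact: (measurableT_comp mG (measurable_reflect X)).
  by apply: (measurableT_comp mF); case: (preserves_phase_shift (- Y)).
- by move=> Z _; rewrite lee_fin normc_wick_kernel_le.
Qed.

End two_extensions.

End wick_product.

(** * Analyticity of the Wick product *)

Section wick_product_analytic.
Context {R : realType} {n : nat} (h : R).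
Hypothesis h_gt0 : 0 < h.
Local Notation phase := ('rV[R]_n * 'rV[R]_n)%type.
Local Notation pm := (@phase_measure R n).
Local Notation row2 := 'rV[R]_((n + n) + (n + n)).
Local Notation triple := (phase * (phase * phase))%type.
Local Notation pm2 := (prod_measure pm pm).
Local Notation pm3 := (prod_measure pm pm2).
Variables (F G : phase -> R[i]) (Fe Ge : phase -> phase -> R[i]) (psiF psiG : phase -> R).
Hypotheses (FeP : is_sesqui_ext h F Fe) (GeP : is_sesqui_ext h G Ge).
Hypotheses (psiFP : wick_weight h Fe psiF) (psiGP : wick_weight h Ge psiG).
Local Notation kernel := (wick_kernel h Fe Ge).
Implicit Types (X Y Z P Q : phase) (w : triple) (v : row2).

Let a : R := h^-1.

Let a_gt0 : 0 < a. Proof. by rewrite invr_gt0. Qed.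

Lemma holo_wick_kernel_l Y Z : holo (fun X => kernel X Y Z).
Proof.
rewrite (_ : (fun X => _) = (fun X => Fe Z Y * (Ge X Z *
   cexp ((- (2 * h)^-1)%:C * herm Z (Z - Y) + ((2 * h)^-1)%:C * herm X (Z - Y))))).
  apply: holo_mul; first exact: holo_cst.
  apply: holo_mul; first exact: sesqui_ext_holo_l GeP Z.
  by apply: holo_cexp; exact: clinear_herm.
apply/funext => X; rewrite /wick_kernel -mulrA; congr (_ * (_ * cexp _)).
by rewrite hermDl hermNl rmorphN; ring.
Qed.

Lemma holo_wick_kernel_r X Z : holo (fun Y => conjc (kernel X Y Z)).
Proof.
rewrite (_ : (fun Y => _) = (fun Y => conjc (Fe Z Y) * (conjc (Ge X Z) *
   cexp ((- (2 * h)^-1)%:C * herm Z (Z - X) + ((2 * h)^-1)%:C * herm Y (Z - X))))).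
  apply: holo_mul; first exact: sesqui_ext_holo_r FeP Z.
  apply: holo_mul; first exact: holo_cst.
  by apply: holo_cexp; exact: clinear_herm.
apply/funext => Y; rewrite /wick_kernel conjcM conjc_cexp [in X in X * _]conjcM -mulrA; congr (_ * (_ * cexp _)).
by rewrite conjcM conjc_real conjc_herm hermDl hermNl rmorphN; ring.
Qed.

Lemma sqnormB_le P Q : sqnorm (P - Q) <= 2 * (sqnorm P + sqnorm Q).
Proof.
have := sqnormB P Q; have := Re_herm_le P (- Q); rewrite hermNr ReN sqnormN.
by move=> h1 ->; lra.
Qed.

Lemma normc_bargmann X P : normc (bargmann a X P) =
  expR (a * (complex.Re (herm X P) - sqnorm P)).
Proof. by rewrite normc_cexp Re_scale ReD ReN. Qed.

Lemma bargmann_bound X P Q k : 0 <= k ->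
  normc (bargmann a X P) * (expR (sqnorm (P - Q) / (4 * h)) * k) <=
  expR ((sqnorm X + sqnorm Q) / (2 * h)) * k.
Proof.
move=> k0; rewrite mulrA normc_bargmann -expRD; apply: ler_wpM2r => //.
rewrite ler_expR -(ler_pM2r (_ : 0 < 2 * h)) ?mulr_gt0// divfK ?gt_eqF ?mulr_gt0//.
rewrite mulrDl (_ : sqnorm _ / (4 * h) * (2 * h) = sqnorm (P - Q) / 2); last first.
  by field; rewrite gt_eqF.
rewrite (_ : a * _ * (2 * h) = 2 * (complex.Re (herm X P) - sqnorm P)); last first.
  by rewrite /a; field; rewrite gt_eqF.
by have := Re_herm_le X P; have := sqnormB_le P Q; lra.
Qed.

Let measurable_reflect X : measurable_fun setT (fun Z : phase => X - Z).
Proof. by case: (preserves_phase_reflect X). Qed.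

Let measurable_shift X : measurable_fun setT (fun Z : phase => Z - X).
Proof. by case: (preserves_phase_shift (- X)). Qed.

Let cintegrable_kernel_l X Y Z : cintegrable pm (fun P => kernel P Y Z * bargmann a X P).
Proof.
have [mF F0 iF _ _] := psiFP; have [mG G0 iG _ _] := psiGP.
apply: (cintegrable_le (g := fun P => expR ((sqnorm X + sqnorm Y) / (2 * h)) *
   (psiG (P - Z) * psiF (Z - Y)))).
- apply: cmeasurableM; last by apply: cmeasurable_bargmann; [exact: measurable_cst|exact: measurable_id].
  apply: (cmeasurable_wick_kernel FeP GeP (f := id) (g := fun=> Y) (k := fun=> Z));
    [exact: measurable_id|exact: measurable_cst|exact: measurable_cst].
- rewrite (_ : _ \o _ = (fun P => (expR ((sqnorm X + sqnorm Y) / (2 * h)) * psiF (Z - Y)%R)%:E *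
    (psiG (P - Z)%R)%:E)%E); last first.
    by apply/funext => P; rewrite /= -EFinM; congr EFin; ring.
  by apply: integrableZl => //; exact: integrable_weight_shift psiGP.
move=> P; rewrite normcM mulrC.
apply: le_trans (bargmann_bound X P Y _); last by rewrite mulr_ge0.
by apply: ler_wpM2l; [exact: normc_ge0|exact: normc_wick_kernel_le].
Qed.

Let cintegrable_kernel_r P Y Z : cintegrable pm (fun Q => conjc (kernel P Q Z) * bargmann a Y Q).
Proof.
have [mF F0 iF _ _] := psiFP; have [mG G0 iG _ _] := psiGP.
apply: (cintegrable_le (g := fun Q => expR ((sqnorm Y + sqnorm P) / (2 * h)) *
   (psiG (P - Z) * psiF (Z - Q)))).
- apply: cmeasurableM; last by apply: cmeasurable_bargmann; [exact: measurable_cst|exact: measurable_id].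
  apply: cmeasurable_conjc.
  apply: (cmeasurable_wick_kernel FeP GeP (f := fun=> P) (g := id) (k := fun=> Z));
    [exact: measurable_cst|exact: measurable_id|exact: measurable_cst].
- rewrite (_ : _ \o _ = (fun Q => (expR ((sqnorm Y + sqnorm P) / (2 * h)) * psiG (P - Z)%R)%:E *
    (psiF (Z - Q)%R)%:E)%E); last first.
    by apply/funext => Q; rewrite /= -EFinM; congr EFin; ring.
  by apply: integrableZl => //; exact: integrable_weight_reflect psiFP.
move=> Q; rewrite normcM normc_conjc mulrC.
apply: le_trans (bargmann_bound Y Q P _); last by rewrite mulr_ge0.
apply: ler_wpM2l; first exact: normc_ge0.
by rewrite -sqnormN opprB; exact: normc_wick_kernel_le.
Qed.

Lemma reproducing_kernel_l X Y Z :
  cintegral pm (fun P => kernel P Y Z * bargmann a X P) = ((pi / a) ^+ n)%:C * kernel X Y Z.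
Proof.
exact: (reproducing (H := fun P => kernel P Y Z) a_gt0 (holo_wick_kernel_l Y Z)).
Qed.

Lemma reproducing_kernel_r P Y Z :
  cintegral pm (fun Q => kernel P Q Z * conjc (bargmann a Y Q)) =
    ((pi / a) ^+ n)%:C * kernel P Y Z.
Proof.
have iK := cintegrable_kernel_r P Y Z.
have := reproducing (H := fun Q => conjc (kernel P Q Z)) a_gt0 (holo_wick_kernel_r P Z) iK.
move=> /(congr1 conjc); rewrite -cintegral_conjc// conjcM conjc_real conjcK => <-.
by apply: eq_cintegral => Q; rewrite [RHS]conjcM conjcK.
Qed.

Let k0 : R := (2 * pi * h) ^- n * (pi / a) ^- n * (pi / a) ^- n.

Let dens w : R[i] := k0%:C * (kernel w.2.1 w.2.2 w.1 *
  (expR (- (a * (sqnorm w.2.1 + sqnorm w.2.2))))%:C).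

Let form w v : R[i] :=
  a%:C * (herm (phases_of_row v).1 w.2.1 + herm w.2.2 (phases_of_row v).2).

Let measurable_P : measurable_fun setT (fun w : triple => w.2.1).
Proof. exact: (measurableT_comp measurable_fst measurable_snd). Qed.

Let measurable_Q : measurable_fun setT (fun w : triple => w.2.2).
Proof. exact: (measurableT_comp measurable_snd measurable_snd). Qed.

Let dens_cmeasurable : cmeasurable dens.
Proof.
apply: cmeasurableM; first exact: cmeasurable_cst.
apply: cmeasurableM.
  exact: (cmeasurable_wick_kernel FeP GeP measurable_P measurable_Q measurable_fst).
apply: cmeasurableR; apply: measurableT_comp => //; apply: measurableT_comp => //.
by apply: measurable_funM => //; apply: measurable_funD; exact: measurable_sqnorm_comp.
Qed.

Let form_rlinear w : rlinear (form w).
Proof.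
split=> [v v'|t v]; rewrite /form.
  rewrite phases_of_rowD /= hermDl hermDr; ring.
by rewrite phases_of_rowZ /= hermZl hermZr; ring.
Qed.

Let form_cmeasurable v : cmeasurable (form^~ v).
Proof.
apply: cmeasurableM; first exact: cmeasurable_cst.
apply: cmeasurableD; apply: cmeasurable_herm => //; exact: measurable_cst.
Qed.

Let density_exp w v : dens w * cexp (form w v) = k0%:C *
  (kernel w.2.1 w.2.2 w.1 * bargmann a (phases_of_row v).1 w.2.1 *
   conjc (bargmann a (phases_of_row v).2 w.2.2)).
Proof.
have E : (expR (- (a * (sqnorm w.2.1 + sqnorm w.2.2))))%:C * cexp (form w v) =
    bargmann a (phases_of_row v).1 w.2.1 * conjc (bargmann a (phases_of_row v).2 w.2.2).
  rewrite /bargmann conjc_cexp -(cexp_real (- _)) -!cexpD; congr cexp.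
  rewrite conjcM conjc_real (_ : conjc (_ - _) = herm w.2.2 (phases_of_row v).2 - (sqnorm w.2.2)%:C).
    by rewrite rmorphN rmorphM rmorphD /form; ring.
  rewrite -(conjc_herm (phases_of_row v).2); move: (herm _ _) => z.
  apply: complex_ext; rewrite !(ReD, ReN, Re_conjc, ImD, ImN, Im_conjc)//=.
  by rewrite oppr0 !addr0.
rewrite /dens -[LHS]mulrA; congr (_ * _); rewrite -[LHS]mulrA -[RHS]mulrA; congr (_ * _).
exact: E.
Qed.

Let weight_dens w : R := psiG (w.2.1 - w.1) * psiF (w.1 - w.2.2) *
  expR (- ((4 * h)^-1 * sqnorm w.2.1)).

Let measurable_weights : measurable_fun setT
  (fun w : triple => psiG (w.2.1 - w.1) * psiF (w.1 - w.2.2)).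
Proof.
have [mF _ _ _ _] := psiFP; have [mG _ _ _ _] := psiGP.
apply: measurable_funM; first apply: (measurableT_comp mG); last apply: (measurableT_comp mF).
all: by apply: measurable_phaseB => //; exact: measurable_fst.
Qed.

Let weight_dens_measurable : measurable_fun setT weight_dens.
Proof.
apply: measurable_funM; first exact: measurable_weights.
apply: measurableT_comp => //; apply: measurableT_comp => //.
by apply: measurable_funM => //; exact: measurable_sqnorm_comp.
Qed.

Let weight_dens_ge0 w : 0 <= weight_dens w.
Proof.
have [_ F0 _ _ _] := psiFP; have [_ G0 _ _ _] := psiGP.
by rewrite mulr_ge0 ?expR_ge0// mulr_ge0.
Qed.

Let massF : R := fine (\int[pm]_V (psiF V)%:E)%E.

Let massFE Z : (\int[pm]_Q (psiF (Z - Q)%R)%:E = massF%:E)%E.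
Proof.
have [mF F0 iF _ _] := psiFP.
rewrite (ge0_integral_preserves (preserves_phase_reflect Z) (f := EFin \o psiF)).
- by rewrite /massF fineK//; exact: integrable_fin_num.
- exact/measurable_EFinP.
- by move=> V; rewrite lee_fin.
Qed.

Let massF_ge0 : 0 <= massF.
Proof.
by have [_ F0 _ _ _] := psiFP; apply: fine_ge0; apply: integral_ge0 => V _; rewrite lee_fin.
Qed.

Let product_weights_integrable Z : pm2.-integrable setT
  (EFin \o (fun p : phase * phase => psiG (p.1 - Z) * psiF (Z - p.2))).
Proof.
have [mF F0 iF _ _] := psiFP; have [mG G0 iG _ _] := psiGP.
have mGF : measurable_fun setT (fun p : phase * phase => psiG (p.1 - Z) * psiF (Z - p.2)).
  exact: (measurableT_comp measurable_weights (measurable_pair1 Z)).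
have GF0 (p : phase * phase) : 0 <= psiG (p.1 - Z) * psiF (Z - p.2) by rewrite mulr_ge0.
apply/integrableP; split; first exact/measurable_EFinP.
under eq_integral do rewrite gee0_abs ?lee_fin//.
rewrite [X in (X < _)%E](fubini_tonelli1 (fun p : phase * phase =>
  (psiG (p.1 - Z)%R * psiF (Z - p.2)%R)%:E)); last 2 first.
- exact/measurable_EFinP.
- by move=> p; rewrite lee_fin.
rewrite -[X in (X < _)%E]/(\int[pm]_P \int[pm]_Q (psiG (P - Z)%R * psiF (Z - Q)%R)%:E)%E.
have inner_int P : (\int[pm]_Q (psiG (P - Z)%R * psiF (Z - Q)%R)%:E =
    (psiG (P - Z)%R)%:E * massF%:E)%E.
  rewrite -(massFE Z) -integralZl_ge0//.
  exact: (measurableT_comp mF (measurable_reflect Z)).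
under eq_integral do rewrite inner_int.
rewrite ge0_integralZr//; last 2 first.
- by apply/measurable_EFinP; exact: (measurableT_comp mG (measurable_shift Z)).
- by move=> P _; rewrite lee_fin.
have := integrable_weight_shift Z psiGP.
by move=> /(integrable_fin_num measurableT)/fineK <-; exact: ltry.
Qed.

(** Integrating first over the second label, then, for the convolution, over
    the first and the intermediate one. *)
Let weight_dens_integrable : pm3.-integrable setT (EFin \o weight_dens).
Proof.
have [mF F0 iF _ _] := psiFP; have [mG G0 iG _ _] := psiGP.
pose g P := expR (- ((4 * h)^-1 * sqnorm P)).
have mg : measurable_fun setT g := measurable_phase_gauss (4 * h)^-1.
have h4 : 0 < (4 * h)^-1 by rewrite invr_gt0 mulr_gt0.
have mGN : measurable_fun setT (fun V : phase => psiG (- V)).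
  by apply: (measurableT_comp mG); case: (@preserves_phase_opp R n).
have inner_int Z : (\int[pm2]_p (weight_dens (Z, p))%:E =
    massF%:E * \int[pm]_P ((psiG (- (Z - P))%R)%:E * (g P)%:E))%E.
  rewrite /prod_measure (fubini_tonelli1 (fun p : phase * phase => (weight_dens (Z, p))%:E)); last 2 first.
  - apply/measurable_EFinP; exact: (measurableT_comp weight_dens_measurable (measurable_pair1 _)).
  - by move=> p; rewrite lee_fin.
  rewrite -[LHS]/(\int[pm]_P \int[pm]_Q (weight_dens (Z, (P, Q)))%:E)%E.
  rewrite -ge0_integralZl//; last 2 first.
  - apply: emeasurable_funM; apply/measurable_EFinP => //.
    exact: (measurableT_comp mGN (measurable_reflect Z)).
  - by move=> P _; rewrite mule_ge0// lee_fin ?expR_ge0.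
  apply: eq_integral => P _; rewrite -(massFE Z) [RHS]muleC -EFinM opprB.
  rewrite -integralZl_ge0; last 3 first.
  - by rewrite mulr_ge0 ?expR_ge0.
  - exact: (measurableT_comp mF (measurable_reflect Z)).
  - by move=> Q.
  by apply: eq_integral => Q _; rewrite /weight_dens mulrAC.
apply/integrableP; split; first exact/measurable_EFinP.
under eq_integral do rewrite gee0_abs ?lee_fin//.
rewrite [X in (X < _)%E](fubini_tonelli1 (fun w : triple => (weight_dens w)%:E)); last 2 first.
- exact/measurable_EFinP.
- by move=> w; rewrite lee_fin.
rewrite -[X in (X < _)%E]/(\int[pm]_Z \int[pm2]_p (weight_dens (Z, p))%:E)%E.
under eq_integral do rewrite inner_int.
have EmG : measurable_fun setT (fun V : phase => (psiG (- V)%R)%:E) by exact/measurable_EFinP.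
have Emg : measurable_fun setT (EFin \o g) by exact/measurable_EFinP.
have EG0 V : (0 <= (psiG (- V)%R)%:E)%E by rewrite lee_fin.
have Eg0 V : (0 <= (EFin \o g) V)%E by rewrite lee_fin expR_ge0.
rewrite ge0_integralZl//; last 2 first.
- exact: (measurable_convolution EmG Emg EG0 Eg0).
- by move=> Z _; apply: integral_ge0 => P _; rewrite mule_ge0// lee_fin expR_ge0.
rewrite (integral_convolution EmG Emg EG0 Eg0) gauss_integral_phase//.
have := integrable_preserves_real (@preserves_phase_opp R n) iG.
by move=> /(integrable_fin_num measurableT)/fineK <-; exact: ltry.
Qed.

Let form_size_le : exists2 N0 : R, 0 <= N0 &
  forall w, form_size form w <= N0 * (`|w.2.1| + `|w.2.2|).
Proof.
exists (\sum_(k < (n + n) + (n + n)) a * (4 * n%:R)).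
  by apply: sumr_ge0 => k _; rewrite mulr_ge0// ltW.
move=> w; rewrite /form_size mulr_suml; apply: ler_sum => k _.
set v := delta_mx _ _; have v1 : `|v| <= 1.
  by apply: rvec_norm_le => // i; rewrite mxE; case: (_ && _); rewrite ?normr1 ?normr0.
have [vX vY] := norm_phases_of_row v.
rewrite /form normcM normcRge0 ?(ltW a_gt0)// -mulrA ler_pM2l//.
apply: le_trans (le_normcD _ _) _; rewrite mulrDr.
have n4 : 0 <= 4 * n%:R :> R by [].
apply: lerD; apply: le_trans (normc_herm_le _ _) _.
  by rewrite -[leRHS]mulr1; apply: ler_wpM2l; [rewrite mulr_ge0|exact: le_trans v1].
rewrite mulrAC -[leRHS]mulr1; apply: ler_wpM2l; first by rewrite mulr_ge0.
exact: le_trans v1.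
Qed.

Let dens_integrable (r : R) : pm3.-integrable setT
  (EFin \o (fun w => normc (dens w) * expR (r * form_size form w))).
Proof.
have [N0 N00 N0P] := form_size_le.
pose B := `|r| * N0; have B0 : 0 <= B by rewrite mulr_ge0.
have [mF F0 iF _ _] := psiFP; have [mG G0 iG _ _] := psiGP.
pose K := `|k0| * expR (2 * B ^+ 2 * h).
apply: (integrable_le_ge0 (g := fun w => K * weight_dens w)).
- apply: measurable_funM; first exact: measurable_normc.
  apply: measurableT_comp => //; apply: measurable_funM => //.
  apply: measurable_sum => k; exact: measurable_normc.
- rewrite (_ : _ \o _ = (fun w => K%:E * (weight_dens w)%:E)%E)//.
  by apply: integrableZl => //; exact: weight_dens_integrable.
move=> w; rewrite ger0_norm; last by rewrite mulr_ge0 ?normc_ge0 ?expR_ge0.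
set P := w.2.1; set Q := w.2.2; set Z := w.1.
set e1 := expR (- (a * (sqnorm P + sqnorm Q))).
have -> : normc (dens w) = `|k0| * (normc (kernel P Q Z) * e1).
  by rewrite /dens normcM normcR [in LHS]normcM (normcRge0 (expR_ge0 _)).
set e2 := expR (r * _); rewrite /K -[leLHS]mulrA -[leRHS]mulrA.
apply: ler_wpM2l => //; rewrite -[leLHS]mulrA.
apply: (@le_trans _ _ (expR (sqnorm (P - Q) / (4 * h)) * (psiG (P - Z) * psiF (Z - Q)) * (e1 * e2))).
  apply: ler_wpM2r; first by rewrite mulr_ge0 ?expR_ge0.
  exact: normc_wick_kernel_le.
rewrite /weight_dens -/P -/Q -/Z mulrAC [leRHS]mulrCA [leLHS]mulrC.
apply: ler_wpM2l; first by rewrite mulr_ge0.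
rewrite /e1 /e2 -!expRD ler_expR.
have hB : r * form_size form w <= B * (`|P| + `|Q|).
  have s0 : 0 <= form_size form w by apply: sumr_ge0 => k _; exact: normc_ge0.
  apply: (@le_trans _ _ (`|r| * form_size form w)).
    by apply: ler_wpM2r => //; exact: ler_norm.
  by rewrite /B -mulrA; apply: ler_wpM2l.
have amgm (x s : R) : 0 <= x -> x ^+ 2 <= s -> B * x <= B ^+ 2 * h + s / (4 * h).
  move=> x0 xs; rewrite -(ler_pM2r (_ : 0 < 4 * h)) ?mulr_gt0//.
  rewrite [leRHS]mulrDl divfK ?gt_eqF ?mulr_gt0//.
  by have := sqr_ge0 (2 * B * h - x); rewrite expr2; nra.
have hP := amgm _ _ (normr_ge0 P) (sqr_norm_le_sqnorm P).
have hQ := amgm _ _ (normr_ge0 Q) (sqr_norm_le_sqnorm Q).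
have hPQ : sqnorm (P - Q) / (4 * h) <= (sqnorm P + sqnorm Q) / (2 * h).
  rewrite ler_pdivrMr ?mulr_gt0// (_ : _ / _ * _ = 2 * (sqnorm P + sqnorm Q)).
    exact: sqnormB_le.
  by field; rewrite gt_eqF.
have Q0 : 0 <= sqnorm Q / (4 * h) by rewrite divr_ge0 ?sqnorm_ge0// mulr_ge0// ltW.
have aE s : a * s = 4 * (s / (4 * h)) by rewrite /a; field; rewrite gt_eqF.
have bE s : s / (2 * h) = 2 * (s / (4 * h)) by field; rewrite gt_eqF.
rewrite aE [(4 * h)^-1 * _]mulrC; move: hP hQ hPQ hB Q0.
rewrite bE mulrDr [(sqnorm P + sqnorm Q) / (4 * h)]mulrDl.
by move: (sqnorm P / _) (sqnorm Q / _) (sqnorm (P - Q) / _) => x y z; lra.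
Qed.

Lemma wick_product_exp_integral v :
  exp_integral pm3 dens form v =
  wick_product_ext h Fe Ge (phases_of_row v).1 (phases_of_row v).2.
Proof.
have i3 := cintegrable_exp_integral dens_cmeasurable form_rlinear form_cmeasurable dens_integrable v.
set X := (phases_of_row v).1; set Y := (phases_of_row v).2.
rewrite /exp_integral cintegral_fubini1//.
rewrite /wick_product_ext -cintegralZ; last exact: cintegrable_wick_kernel FeP GeP psiFP psiGP _ _.
apply: eq_cintegral => Z.
have [mF F0 iF _ _] := psiFP; have [mG G0 iG _ _] := psiGP.
pose J p := kernel p.1 p.2 Z * bargmann a X p.1 * conjc (bargmann a Y p.2).
have mJ : cmeasurable J.
  apply: cmeasurableM; first apply: cmeasurableM.
  - exact: (cmeasurable_wick_kernel FeP GeP measurable_fst measurable_snd (measurable_cst Z)).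
  - by apply: cmeasurable_bargmann; [exact: measurable_cst|exact: measurable_fst].
  apply: cmeasurable_conjc.
  by apply: cmeasurable_bargmann; [exact: measurable_cst|exact: measurable_snd].
have iJ : cintegrable pm2 J.
  pose C := expR (sqnorm X / (2 * h)) * expR (sqnorm Y / (2 * h)).
  apply: (cintegrable_le (g := fun p : phase * phase => C * (psiG (p.1 - Z) * psiF (Z - p.2)))) => //.
    rewrite (_ : _ \o _ = (fun p : phase * phase =>
      C%:E * (psiG (p.1 - Z)%R * psiF (Z - p.2)%R)%:E)%E)//.
    by apply: integrableZl => //; exact: product_weights_integrable.
  move=> [P Q]; rewrite -[J _]/(kernel P Q Z * bargmann a X P * conjc (bargmann a Y Q)).
  rewrite 2!normcM normc_conjc -mulrA [normc (bargmann a X P) * _]mulrC mulrCA.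
  set k := psiG _ * psiF _; have k0' : 0 <= k by rewrite mulr_ge0.
  apply: (@le_trans _ _ (normc (bargmann a Y Q) * (expR ((sqnorm X + sqnorm Q) / (2 * h)) * k))).
    apply: ler_wpM2l; first exact: normc_ge0.
    apply: le_trans (bargmann_bound X P Q k0'); rewrite mulrC.
    by apply: ler_wpM2l; [exact: normc_ge0|exact: normc_wick_kernel_le].
  rewrite mulrA normc_bargmann -expRD /C -expRD; apply: ler_wpM2r => //; rewrite ler_expR.
  have aE s : a * s = s / h by rewrite /a mulrC.
  have bE s : s / (2 * h) = (s / h) / 2 by field; rewrite gt_eqF.
  have hR : 2 * complex.Re (herm Y Q) * h^-1 <= (sqnorm Y + sqnorm Q) * h^-1.
    by rewrite ler_pM2r ?invr_gt0//; exact: Re_herm_le.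
  rewrite aE !bE; move: hR.
  by move: (complex.Re (herm Y Q)) (sqnorm X) (sqnorm Y) (sqnorm Q) => s x y q; lra.
rewrite (eq_cintegral _ (g := fun p => k0%:C * J p)); last by move=> p; exact: density_exp.
rewrite cintegralZ// cintegral_fubini1//.
rewrite (eq_cintegral _ (g := fun P => ((pi / a) ^+ n)%:C * (kernel P Y Z * bargmann a X P))); last first.
  move=> P; rewrite mulrA -reproducing_kernel_r -cintegralZr.
    by apply: eq_cintegral => Q; rewrite -[J _]/(kernel P Q Z * bargmann a X P * conjc (bargmann a Y Q)) mulrAC.
  apply: eq_cintegrable (cintegrable_conjc (cintegrable_kernel_r P Y Z)) => Q.
  by rewrite conjcM conjcK.
rewrite cintegralZ// reproducing_kernel_l; move: (kernel X Y Z) => z.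
rewrite !mulrA -!rmorphM; congr (_%:C * _).
have p0 : (pi / a) ^+ n != 0 by rewrite expf_neq0// gt_eqF// divr_gt0// pi_gt0.
by rewrite /k0 !mulfVK.
Qed.

Let dir_momE j : dir_mom j = cscale (0 +i* 1) (dir_pos j) :> phase.
Proof.
by apply: phase_ext => k; rewrite /cscale /= !mxE ?mul0r ?mul1r ?subr0 ?addr0 ?oppr0.
Qed.

Let ii : (0 +i* 1) * (0 +i* 1) = -1 :> R[i].
Proof. by apply: complex_ext => /=; ring. Qed.

Let formE w X Y :
  form w (row_of_phases X Y) = a%:C * (herm X w.2.1 + herm w.2.2 Y).
Proof. by rewrite /form row_of_phasesK. Qed.

Lemma wick_product_cauchy_riemann j X Y :
  cderive (dir_pos j) ((wick_product_ext h Fe Ge)^~ Y) X +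
    (0 +i* 1) * cderive (dir_mom j) ((wick_product_ext h Fe Ge)^~ Y) X = 0 /\
  cderive (dir_pos j) (wick_product_ext h Fe Ge X) Y -
    (0 +i* 1) * cderive (dir_mom j) (wick_product_ext h Fe Ge X) Y = 0.
Proof.
pose p := row_of_phases X Y.
have E U V : wick_product_ext h Fe Ge U V = exp_integral pm3 dens form (row_of_phases U V).
  by rewrite wick_product_exp_integral row_of_phasesK.
have D := exp_integral_derivative dens_cmeasurable form_rlinear form_cmeasurable dens_integrable p.
have lD := rlinear_exp_derivative dens_cmeasurable form_rlinear form_cmeasurable dens_integrable p.
have iD := cintegrable_exp_derivative dens_cmeasurable form_rlinear form_cmeasurable dens_integrable p.
have h00 (U : phase) : herm 0 U = 0 /\ herm U 0 = 0.
  by split; apply: complex_ext; rewrite /= ?(dot0l, dot0r) ?addr0 ?subr0.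
split.
- rewrite (_ : (wick_product_ext h Fe Ge)^~ Y =
    fun U => exp_integral pm3 dens form (row_of_phases U Y)); last by apply/funext => U; exact: E.
  rewrite !(strictly_derivable_cderive _ (rlinear_row_l lD) (strictly_derivable_row_l D)).
  rewrite -cintegralZ// -cintegralD//; last exact: cintegrableZ.
  rewrite -[RHS](cintegral0 pm3); apply: eq_cintegral => w.
  rewrite !formE (h00 w.2.2).2 !addr0 dir_momE herm_cscale.
  move: (cexp _) => e; move: (dens w) (herm _ _) (a%:C) => d z b.
  rewrite (_ : _ + _ = d * e * b * z * (1 + (0 +i* 1) * (0 +i* 1))); last by ring.
  by rewrite ii subrr mulr0.
- rewrite (_ : wick_product_ext h Fe Ge X =
    fun U => exp_integral pm3 dens form (row_of_phases X U)); last by apply/funext => U; exact: E.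
  rewrite !(strictly_derivable_cderive _ (rlinear_row_r lD) (strictly_derivable_row_r D)).
  rewrite -cintegralZ// -cintegralB//; last exact: cintegrableZ.
  rewrite -[RHS](cintegral0 pm3); apply: eq_cintegral => w.
  rewrite !formE (h00 w.2.1).1 !add0r dir_momE -[herm _ (cscale _ _)]conjc_herm herm_cscale.
  rewrite conjcM conjc_herm (_ : conjc (0 +i* 1) = - (0 +i* 1)); last first.
    by apply: complex_ext => /=; rewrite ?oppr0.
  move: (cexp _) => e; move: (dens w) (herm _ _) (a%:C) => d z b.
  rewrite (_ : _ - _ = d * e * b * z * (1 + (0 +i* 1) * (0 +i* 1))); last by ring.
  by rewrite ii subrr mulr0.
Qed.

Theorem wick_product_sesqui_ext FG : (forall X, wick_product_ext h Fe Ge X X = FG X) ->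
  is_sesqui_ext h FG (wick_product_ext h Fe Ge).
Proof.
move=> FGE; split => //.
- rewrite (_ : (fun v : row2 => _) = exp_integral pm3 dens form).
    exact: exp_integral_analytic dens_cmeasurable form_rlinear form_cmeasurable dens_integrable.
  by apply/funext => v; rewrite wick_product_exp_integral.
- exact: wick_product_cauchy_riemann.
- by have := wick_product_ext_weight h_gt0 FeP GeP psiFP psiGP.
Qed.

End wick_product_analytic.

Section wick_symbol_product.
Context {R : realType} {n : nat} (h : R).
Hypothesis h_gt0 : 0 < h.
Local Notation phase := ('rV[R]_n * 'rV[R]_n)%type.
Local Notation pm := (@phase_measure R n).
Local Notation Psi := (coherent h).
Implicit Types (X Y Z T : phase) (F G : phase -> R[i]).

Definition wick_product F G X : R[i] :=
  wick_product_ext h (sesqui_ext h F) (sesqui_ext h G) X X.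

Lemma wick_product_D_h F G : D_h h F -> D_h h G -> D_h h (wick_product F G).
Proof.
move=> FD GD; have FeP := sesqui_ext_spec FD; have GeP := sesqui_ext_spec GD.
have [psiF psiFP] := sesqui_ext_weight h_gt0 FeP.
have [psiG psiGP] := sesqui_ext_weight h_gt0 GeP.
exists (wick_product_ext h (sesqui_ext h F) (sesqui_ext h G)).
by apply: (wick_product_sesqui_ext h_gt0 FeP GeP psiFP psiGP) => X.
Qed.

Lemma wick_product_integral F G X : D_h h F -> D_h h G ->
  let K := fun T : phase =>
    sesqui_ext h F (X + T) X * sesqui_ext h G X (X + T) *
    (expR (- (sqnorm T / (2 * h))))%:C in
  cintegrable pm K /\ wick_product F G X = ((2 * pi * h) ^- n)%:C * cintegral pm K.
Proof.
move=> FD GD K; have FeP := sesqui_ext_spec FD; have GeP := sesqui_ext_spec GD.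
have [psiF psiFP] := sesqui_ext_weight h_gt0 FeP.
have [psiG psiGP] := sesqui_ext_weight h_gt0 GeP.
set Fe := sesqui_ext h F in FeP psiFP K *; set Ge := sesqui_ext h G in GeP psiGP K *.
have iK := cintegrable_wick_kernel h_gt0 FeP GeP psiFP psiGP X X.
have KE T : wick_kernel h Fe Ge X X (T + X) = K T.
  rewrite /wick_kernel /K addrK hermXX [T + X]addrC; congr (_ * _).
  rewrite -rmorphM cexp_real; congr (expR _)%:C.
  by rewrite mulNr mulrC.
split.
  by apply: eq_cintegrable (cintegrable_preserves (preserves_phase_shift X) iK).
rewrite /wick_product /wick_product_ext; congr (_ * _).
rewrite -(cintegral_preserves (preserves_phase_shift X) (cintegrable_meas iK)).
exact: eq_cintegral.
Qed.

(** In the resolution of the identity between [Ah] and [Bh], both factors are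
    matrix elements in coherent states. *)
Lemma wick_symbol_comp F G Ah Bh : D_h h F -> D_h h G ->
  is_op_wick h F Ah -> is_op_wick h G Bh ->
  wick_symbol h (Ah \o Bh) = wick_product F G.
Proof.
move=> FD GD AF BG; have FeP := sesqui_ext_spec FD; have GeP := sesqui_ext_spec GD.
have [psiF psiFP] := sesqui_ext_weight h_gt0 FeP.
have [psiG psiGP] := sesqui_ext_weight h_gt0 GeP.
have [bA _] := AF; have [bB _] := BG; have [BL _ _] := bB.
apply/funext => X; have XL := coherent_L2 h_gt0 X.
have TE Z : transform h (Bh (Psi X)) Z = sesqui_ext h G X Z * overlap h X Z.
  exact: op_wick_coherent.
have iT : cintegrable pm (transform h (Bh (Psi X))).
  apply: cintegrable_le (integrable_weight_reflect X psiGP) _.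
    exact: cmeasurable_transform (BL _ XL).
  by move=> Z; rewrite TE; have [_ _ _ _] := psiGP; apply.
have [_ E] := inner_op_resolution h_gt0 bA (BL _ XL) XL iT.
rewrite -[LHS]/(inner (Ah (Bh (Psi X))) (Psi X)) E.
rewrite /wick_product /wick_product_ext; congr (_ * _); apply: eq_cintegral => Z.
rewrite TE (op_wick_coherent h_gt0 _ _ FD AF).
by rewrite -[RHS]mulr1 -(overlapXX h X) wick_kernel_overlap.
Qed.

End wick_symbol_product.

Theorem theorem2p7 (R : realType) (n : nat) (h : R) (h_gt0 : 0 < h) :
  (forall A B : ('rV[R]_n -> R[i]) -> ('rV[R]_n -> R[i]),
     C_h h A -> C_h h B ->
     C_h h (A \o B) /\
     forall V : 'rV[R]_n * 'rV[R]_n,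
       (confinement h (A \o B) V <=
        ((2 * pi * h) ^- n)%R%:E *
        \int[@phase_measure R n]_U (confinement h A (V - U)%R * confinement h B U))%E)
  /\
  (forall F G : 'rV[R]_n * 'rV[R]_n -> R[i],
     D_h h F -> D_h h G ->
     exists FG : 'rV[R]_n * 'rV[R]_n -> R[i],
       [/\ D_h h FG,
           forall Ah Bh : ('rV[R]_n -> R[i]) -> ('rV[R]_n -> R[i]),
             is_op_wick h F Ah -> is_op_wick h G Bh ->
             wick_symbol h (Ah \o Bh) = FG &
           forall X : 'rV[R]_n * 'rV[R]_n,
             let K := fun T : 'rV[R]_n * 'rV[R]_n =>
               sesqui_ext h F (X + T) X * sesqui_ext h G X (X + T) *
               (expR (- (sqnorm T / (2 * h))))%:C in
             cintegrable (@phase_measure R n) K /\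
             FG X = ((2 * pi * h) ^- n)%:C * cintegral (@phase_measure R n) K]).
Proof.
split=> [A B AC BC|F G FD GD].
  by split=> [|V]; [exact: C_h_comp|exact: confinement_comp_le].
exists (wick_product h F G); split.
- exact: wick_product_D_h.
- by move=> Ah Bh; exact: wick_symbol_comp.
- by move=> X; exact: wick_product_integral.
Qed.
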